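(* Let $0<p<\hat p\le 1/2$, let $1=t_0<t_1<\cdots<t_n<\cdots$ be integers with $\lim_{n\to+\infty}t_{n+1}/t_n=+\infty$, and let $\mu$ be the associated probability measure on $[0,1]$ described in the context. Let $\overline{\tau}(q)=\log_2\big(\hat p^q+(1-\hat p)^q\big)$. Assume that $\alpha\in\big(-\overline{\tau}'(+\infty),\,-\overline{\tau}'(-\infty)\big)$. (1) For $\alpha\notin\big[-\mathsf{b}_{\mu_+}'(0),-\mathsf{b}_{\mu_-}'(0)\big]\cup\big[-\mathsf{b}_{\mu_+}'(1),-\mathsf{b}_{\mu_-}'(1)\big]$, we have $$\dim_H\big(E_\mu(\alpha)\big)=\underline{\dim}_{MB}\big(E_\mu(\alpha)\big)=\mathsf{b}_\mu^*(\alpha).$$ (2) For $\alpha\notin\big[-\mathsf{B}_{\mu_+}'(0),-\mathsf{B}_{\mu_-}'(0)\big]\cup\big[-\mathsf{B}_{\mu_+}'(1),-\mathsf{B}_{\mu_-}'(1)\big]$, we have $$\dim_P\big(E_\mu(\alpha)\big)=\overline{\dim}_{MB}\big(E_\mu(\alpha)\big)=\mathsf{B}_\mu^*(\alpha).$$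
   Context: The measure $\mu$. For $\varepsilon_1,\dots,\varepsilon_n\in\{0,1\}$, $I_{\varepsilon_1\cdots\varepsilon_n}$ is the dyadic subinterval of $[0,1]$ of generation $n$ coded by the binary digits $\varepsilon_1,\dots,\varepsilon_n$. The probability measure $\mu$ satisfies $\mu(I_{\varepsilon_1\cdots\varepsilon_n})=\prod_{j=1}^n\varpi_j$, where: if $t_{2k-1}\le j<t_{2k}$ for some $k$, then $\varpi_j=p$ if $\varepsilon_j=0$ and $\varpi_j=1-p$ otherwise; if $t_{2k}\le j<t_{2k+1}$ for some $k$, then $\varpi_j=\hat p$ if $\varepsilon_j=0$ and $\varpi_j=1-\hat p$ otherwise. Put $K=\operatorname{supp}\mu$. $\overline{\tau}'(\pm\infty)=\lim_{q\to\pm\infty}\overline{\tau}'(q)$. For a function $\chi$, $\chi'_+$ and $\chi'_-$ denote right and left derivatives; thus $\mathsf{b}_{\mu_\pm}'$ and $\mathsf{B}_{\mu_\pm}'$ are the one-sided derivatives of $\mathsf{b}_\mu$, $\mathsf{B}_\mu$. Legendre transform: $\chi^*(x)=\inf_{y\in\mathbb{R}}(xy+\chi(y))$. $\dim_H$ and $\dim_P$ are the Hausdorff and packing dimensions. Level sets: $E_\mu(\alpha)=\{x\in K:\lim_{r\to0}\frac{\log\mu(B(x,r))}{\log r}=\alpha\}$, with $B(x,r)$ the open ball of center $x$ and radius $r$. Hewitt-Stromberg dimensions. For $A\subseteq\mathbb{R}$, $r>0$, let $N_r(A)$ be the infimum of the cardinalities of families of open balls $B(x_i,r)$ with $x_i\in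 A$ covering $A$, and $M_r(A)$ the supremum of the cardinalities of families of pairwise disjoint open balls $B(x_i,r)$ with $x_i\in A$. Put $\mathsf{L}^t(A)=\liminf_{r\to0}N_r(A)(2r)^t$, $\overline{\mathsf{H}}^t(A)=\sup_{F\subseteq A}\mathsf{L}^t(F)$, $\overline{\mathsf{P}}^t(A)=\limsup_{r\to0}M_r(A)(2r)^t$, $\mathsf{H}^t(A)=\inf\{\sum_i\overline{\mathsf{H}}^t(A_i):A\subseteq\bigcup_iA_i\}$, $\mathsf{P}^t(A)=\inf\{\sum_i\overline{\mathsf{P}}^t(A_i):A\subseteq\bigcup_iA_i\}$ (countable covers); $\underline{\dim}_{MB}(A)=\inf\{t\ge0:\mathsf{H}^t(A)=0\}$, $\overline{\dim}_{MB}(A)=\inf\{t\ge0:\mathsf{P}^t(A)=0\}$. Multifractal Hewitt-Stromberg functions. For $A\subseteq K$, $q,t\in\mathbb{R}$: a centered covering (resp. centered packing) of $A$ by balls of radius $r$ is a family of balls $B(x_i,r)$, $x_i\in A$, covering $A$ (resp. pairwise disjoint). Let $N^q_{\mu,r}(A)=\inf\sum_i\mu(B(x_i,r))^q$ over centered coverings of $A$, and $M^q_{\mu,r}(A)=\sup\sum_i\mu(B(x_i,r))^q$ over centered packings of $A$. Put $\mathsf{L}^{q,t}_\mu(A)=\liminf_{r\to0}N^q_{\mu,r}(A)(2r)^t$, $\overline{\mathsf{H}}^{q,t}_\mu(A)=\sup_{F\subseteq A}\mathsf{L}^{q,t}_\mu(F)$, $\overline{\mathsf{P}}^{q,t}_\mu(A)=\limsup_{r\to0}M^q_{\mu,r}(A)(2r)^t$,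 $\mathsf{H}^{q,t}_\mu(A)=\inf\{\sum_i\overline{\mathsf{H}}^{q,t}_\mu(A_i):A\subseteq\bigcup_iA_i\}$, $\mathsf{P}^{q,t}_\mu(A)=\inf\{\sum_i\overline{\mathsf{P}}^{q,t}_\mu(A_i):A\subseteq\bigcup_iA_i\}$ (countable covers by subsets of $K$). Then $\mathsf{b}_\mu(q)=\inf\{t\in\mathbb{R}:\mathsf{H}^{q,t}_\mu(K)=0\}$ and $\mathsf{B}_\mu(q)=\inf\{t\in\mathbb{R}:\mathsf{P}^{q,t}_\mu(K)=0\}$. *)

(* Defs.v *)
From HB Require Import structures.
From mathcomp Require Import all_boot all_order all_algebra.
From mathcomp Require Import all_classical all_reals all_analysis.

Set Implicit Arguments.
Unset Strict Implicit.
Unset Printing Implicit Defensive.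

Import Order.TTheory GRing.Theory Num.Theory.
Import numFieldNormedType.Exports.

Local Open Scope classical_set_scope.
Local Open Scope ring_scope.
Local Open Scope ereal_scope.

(* Conventions.  A family of balls of a common radius is given by its set of
   centers: repeating a ball never lowers the infimum over coverings, and the
   members of a packing are distinct.  Sums over arbitrary sets of indices are
   [\esum], so no countability has to be imposed.  Balls are open:
   [ball x r = [set y | `|x - y| < r]].  Dimensions, sums and set functions take
   their values in [\bar R], with [ereal_inf set0 = +oo]. *)

Section Balls.
Context {R : realType}.
Implicit Types (A C : set R) (r : R).

Definition centered_covering A r C :=
  C `<=` A /\ A `<=` \bigcup_(x in C) ball x r.

Definition centered_packing A r C :=
  C `<=` A /\ trivIset C (fun x => ball x r).

End Balls.

Section HewittStromberg.
Context {R : realType}.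
Implicit Types (A F : set R) (r t : R).

Definition covering_number r A : \bar R :=
  ereal_inf [set counting C | C in centered_covering A r].

Definition packing_number r A : \bar R :=
  ereal_sup [set counting C | C in centered_packing A r].

Definition HS_L t A : \bar R :=
  limf_einf (fun r => covering_number r A * ((2 * r) `^ t)%:E) 0^'+.

Definition HS_Hbar t A : \bar R := ereal_sup [set HS_L t F | F in [set F | F `<=` A]].

Definition HS_Pbar t A : \bar R :=
  limf_esup (fun r => packing_number r A * ((2 * r) `^ t)%:E) 0^'+.

(* Both premeasures vanish on the empty set, so covers indexed by [nat] account
   for all countable covers. *)
Definition HS_H t A : \bar R :=
  ereal_inf [set \sum_(0 <= i <oo) HS_Hbar t (F i) |
             F in [set F : (set R)^nat | A `<=` \bigcup_i F i]].

Definition HS_P t A : \bar R :=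
  ereal_inf [set \sum_(0 <= i <oo) HS_Pbar t (F i) |
             F in [set F : (set R)^nat | A `<=` \bigcup_i F i]].

Definition lower_MB_dim A : \bar R :=
  ereal_inf [set t%:E | t in [set t : R | (0 <= t)%R /\ HS_H t A = 0]].

Definition upper_MB_dim A : \bar R :=
  ereal_inf [set t%:E | t in [set t : R | (0 <= t)%R /\ HS_P t A = 0]].

End HewittStromberg.

Section HausdorffPacking.
Context {R : realType}.
Implicit Types (A U : set R) (s delta : R).

Definition diam U : \bar R :=
  maxe 0 (ereal_sup [set `|z.1 - z.2|%:E | z in U `*` U]).

Definition delta_cover delta A (G : set (set R)) :=
  [/\ countable G, A `<=` \bigcup_(U in G) U &
      forall U, G U -> diam U <= delta%:E].

Definition hausdorff_premeasure s delta A : \bar R :=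
  ereal_inf [set \esum_(U in G) (diam U `^ s) | G in delta_cover delta A].

Definition hausdorff_measure s A : \bar R :=
  ereal_sup [set hausdorff_premeasure s delta A | delta in [set d : R | (0 < d)%R]].

Definition hausdorff_dim A : \bar R :=
  ereal_inf [set s%:E | s in [set s : R | (0 <= s)%R /\ hausdorff_measure s A = 0]].

(* Here radii vary: a packing is a set of pairs (center, radius). *)
Definition delta_packing delta A (D : set (R * R)) :=
  (forall c, D c -> A c.1 /\ (0 < c.2 <= delta)%R) /\
  trivIset D (fun c => ball c.1 c.2).

Definition packing_premeasure_delta s delta A : \bar R :=
  ereal_sup [set \esum_(c in D) ((2 * c.2) `^ s)%:E | D in delta_packing delta A].

Definition packing_premeasure s A : \bar R :=
  ereal_inf [set packing_premeasure_delta s delta A | delta in [set d : R | (0 < d)%R]].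

Definition packing_measure s A : \bar R :=
  ereal_inf [set \sum_(0 <= i <oo) packing_premeasure s (F i) |
             F in [set F : (set R)^nat | A `<=` \bigcup_i F i]].

Definition packing_dim A : \bar R :=
  ereal_inf [set s%:E | s in [set s : R | (0 <= s)%R /\ packing_measure s A = 0]].

End HausdorffPacking.

Section Multifractal.
Context {R : realType} (mu : probability (measurableTypeR R) R).
Implicit Types (A F : set R) (q t r alpha : R).

Definition supp : set R :=
  [set x | forall U : set R, open U -> U x -> 0 < mu U].

(* The sets A below are subsets of [supp], so that every ball with center in A
   has positive measure and negative powers are meaningful. *)
Definition mu_covering_sum q r A : \bar R :=
  ereal_inf [set \esum_(x in C) (mu (ball x r) `^ q) | C in centered_covering A r].

Definition mu_packing_sum q r A : \bar R :=
  ereal_sup [set \esum_(x in C) (mu (ball x r) `^ q) | C in centered_packing A r].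

Definition mu_L q t A : \bar R :=
  limf_einf (fun r => mu_covering_sum q r A * ((2 * r) `^ t)%:E) 0^'+.

Definition mu_Hbar q t A : \bar R :=
  ereal_sup [set mu_L q t F | F in [set F | F `<=` A]].

Definition mu_Pbar q t A : \bar R :=
  limf_esup (fun r => mu_packing_sum q r A * ((2 * r) `^ t)%:E) 0^'+.

Definition supp_cover A (F : (set R)^nat) :=
  (forall i, F i `<=` supp) /\ A `<=` \bigcup_i F i.

Definition mu_H q t A : \bar R :=
  ereal_inf [set \sum_(0 <= i <oo) mu_Hbar q t (F i) | F in supp_cover A].

Definition mu_P q t A : \bar R :=
  ereal_inf [set \sum_(0 <= i <oo) mu_Pbar q t (F i) | F in supp_cover A].

Definition b_fun q : \bar R :=
  ereal_inf [set t%:E | t in [set t : R | mu_H q t supp = 0]].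

Definition B_fun q : \bar R :=
  ereal_inf [set t%:E | t in [set t : R | mu_P q t supp = 0]].

Definition level_set alpha : set R :=
  [set x | supp x /\
    (ln (fine (mu (ball x r))) / ln r)%R @[r --> 0^'+] --> alpha].

End Multifractal.

Section OneVariable.
Context {R : realType}.
Implicit Types (chi : R -> \bar R) (x : R).

Definition right_derivative chi x : \bar R :=
  lim ((chi (x + h)%R - chi x) * (h^-1)%:E @[h --> 0^'+]).

Definition left_derivative chi x : \bar R :=
  lim ((chi (x + h)%R - chi x) * (h^-1)%:E @[h --> 0^'-]).

Definition legendre chi x : \bar R :=
  ereal_inf [set (x * y)%:E + chi y | y in [set: R]].

(* [-chi'_+(x), -chi'_-(x)], empty when the left end exceeds the right end. *)
Definition slope_interval chi x : set (\bar R) :=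
  `[- right_derivative chi x, - left_derivative chi x]%classic.

Definition log2 x : R := (ln x / ln 2)%R.

Definition tau (a q : R) : R := log2 (a `^ q + (1 - a) `^ q).

End OneVariable.

Section TheMeasure.
Context {R : realType}.
Implicit Types (p ph : R) (t : nat -> nat) (e : nat -> bool).

(* Digits are numbered from 1, and [e j = true] means that the j-th digit is 1;
   only e 1, ..., e n matter.  The intervals are half-open. *)
Definition dyadic_left n e : R := (\sum_(1 <= j < n.+1) (e j)%:R / 2 ^+ j)%R.

Definition dyadic n e : set R :=
  `[dyadic_left n e, (dyadic_left n e + (2 ^+ n)^-1)%R[%classic.

(* t_(2k-1) <= j < t_(2k) for some k >= 1.  As t_0 = 1 and t is increasing, the
   other j >= 1 are those with t_(2k) <= j < t_(2k+1) for some k >= 0. *)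
Definition odd_block t j : Prop :=
  exists k : nat, (t k.*2.+1 <= j < t k.*2.+2)%N.

Definition digit_weight p ph t e j : R :=
  let a := if `[< odd_block t j >] then p else ph in
  if e j then (1 - a)%R else a.

(* For n = 0 this says that mu gives full measure to [0, 1). *)
Definition associated_measure p ph t (mu : probability (measurableTypeR R) R) :=
  forall n e, mu (dyadic n e) = (\prod_(1 <= j < n.+1) digit_weight p ph t e j)%:E.

End TheMeasure.

(* Main.v *)
Require Import Defs.
From HB Require Import structures.
From mathcomp Require Import all_boot all_order all_algebra.
From mathcomp Require Import finmap.
From mathcomp Require Import all_classical all_reals all_analysis.
From mathcomp Require Import measurable_realfun.
From mathcomp Require Import ring lra zify.

Import Order.TTheory GRing.Theory Num.Theory.
Import numFieldNormedType.Exports.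

Set Implicit Arguments.
Unset Strict Implicit.
Unset Printing Implicit Defensive.

Local Open Scope classical_set_scope.
Local Open Scope ring_scope.

(** Call type of a position the weight, [p] or [ph], that it gives to the digit 0, and
    run a maximal interval of positions of one type.  The runs grow so fast that at the end
    of a run almost all the digits written so far have its type, and both types recur
    for ever.  At such scales the measure looks like the Bernoulli measure of weight
    [p] or like that of weight [ph], and the proof consists in showing that lower
    quantities see the worse of the two, and upper quantities the better one.

    Lower bounds.  For each type [b] the assumption on [alpha] provides a frequency
    [f b] such that a digit of type [b] that is 0 with frequency [f b] has mean
    information [alpha * ln 2].  Take the Cantor set of the points whose digits are 0
    with frequency [f b] in the runs of type [b], for both [b].  It lies in the level
    set ([cantor_set_sub_level_set]), since the local information is the same in all the
    runs.  It splits into about [expR (n * entropy (f b))] pieces of size [2^-n] at the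
    end [n] of a run of type [b].  A Kraft inequality ([kraft_cover]) shows that its
    Hausdorff dimension is at least [entropy (f b) / ln 2] for the smaller entropy
    ([hausdorff_dim_cantor]), and a Baire argument ([code_baire]) that its packing
    dimension is at least this number for the larger one ([packing_dim_cantor]).  When
    [f b] is written as a Gibbs frequency with exponent [q b], the number
    [entropy (f b) / ln 2] is [alpha * q b + tau b (q b)], where [tau b] is [tau] at the
    weight of type [b] ([entropy_gibbs]).

    Upper bounds.  The inequalities between the dimensions are comparisons of covers
    and of packings ([hausdorff_dim_le_lower_MB_dim], [packing_dim_le_upper_MB_dim]).  On
    the sets where the measure of a ball is uniformly close to [r `^ alpha], the sums
    of the [mu (ball x r) `^ q] count the balls, whence the bounds by the Legendre
    transforms ([lower_MB_dim_level_set_le], [upper_MB_dim_level_set_le]).  These are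
    evaluated with the partition sums over the dyadic intervals, which are products:
    at the end of a run of type [b] they are about [2^(n * tau b q)].  Hence
    [b_fun mu q] is at most [tau b q] for both types ([b_fun_le]), so that
    [legendre (b_fun mu) alpha] is at most the smaller of the two numbers above and the
    first chain of inequalities closes ([lower_spectrum]).

    For packings, [B_fun mu] is exactly the maximum of the two functions [tau]
    ([B_funE]), the lower bound being given by Cantor sets again.  By convexity or
    concavity of the powers the maximum is [tau p] outside the unit interval and
    [tau ph] inside.  This gives the one-sided derivatives of [B_fun mu] at 0 and 1,
    and outside the two slope intervals the exponent [q b] of one of the types lies
    where [tau b] is the maximum ([legendre_B_fun_le]).  The Legendre transform is then
    at most [alpha * q b + tau b (q b)], a lower bound for the packing dimension, and the
    second chain closes ([upper_spectrum]). *)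

(** * Limits at zero from the right and unordered sums *)

Section Liminf.
Context {R : realType}.
Implicit Types (f : R -> \bar R) (a : \bar R) (V : set R).

Lemma at_right0P V :
  nbhs (0 : R)^'+ V <-> exists2 d : R, 0 < d & forall r, 0 < r < d -> V r.
Proof.
split=> [[d /= d0 dV]|[d d0 dV]].
  exists d => // r /andP[r0 rd]; apply: dV => //=.
  by rewrite sub0r normrN gtr0_norm.
exists d => //= r /=; rewrite sub0r normrN => rd r0.
by apply: dV; rewrite r0 -(gtr0_norm r0).
Qed.

Lemma limf_einf_le_frequently f a :
  (forall d : R, 0 < d -> exists2 r, 0 < r < d & (f r <= a)%E) ->
  (limf_einf f 0^'+ <= a)%E.
Proof.
move=> H; rewrite limf_einfE; apply: ge_ereal_sup => _ [V /at_right0P[d d0 dV] <-].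
have [r rd fra] := H _ d0; apply: le_trans fra.
by apply: ereal_inf_lbound; exists r => //; exact: dV.
Qed.

Lemma limf_einf_lt_frequently f a : (limf_einf f 0^'+ < a)%E ->
  forall d : R, 0 < d -> exists2 r, 0 < r < d & (f r < a)%E.
Proof.
move=> fa d d0; apply: contrapT => H.
have : (a <= limf_einf f 0^'+)%E; last by rewrite leNgt fa.
rewrite limf_einfE; apply: ereal_sup_ge.
exists (ereal_inf (f @` [set r | 0 < r < d])).
  by exists [set r | 0 < r < d] => //; apply/at_right0P; exists d.
apply: le_ereal_inf_tmp => _ [r rd <-]; rewrite leNgt; apply/negP => fr.
by apply: H; exists r.
Qed.

Lemma limf_esup_le_near f a (d : R) : 0 < d ->
  (forall r, 0 < r < d -> (f r <= a)%E) -> (limf_esup f 0^'+ <= a)%E.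
Proof.
move=> d0 H; rewrite limf_esupE; apply: ereal_inf_le.
exists (ereal_sup (f @` [set r | 0 < r < d])).
  by exists [set r | 0 < r < d] => //; apply/at_right0P; exists d.
by apply: ge_ereal_sup => _ [r rd <-]; exact: H.
Qed.

Lemma limf_esup_lt_near f a : (limf_esup f 0^'+ < a)%E ->
  exists2 d : R, 0 < d & forall r, 0 < r < d -> (f r < a)%E.
Proof.
rewrite limf_esupE => /ereal_inf_lt[_ [V /at_right0P[d d0 dV] <-] Va].
exists d => // r rd; apply: le_lt_trans Va.
by apply: ereal_sup_ubound; exists r => //; exact: dV.
Qed.

Lemma limf_esup_ge_frequently f a :
  (forall d : R, 0 < d -> exists2 r, 0 < r < d & (a <= f r)%E) ->
  (a <= limf_esup f 0^'+)%E.
Proof.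
move=> H; rewrite limf_esupE; apply: le_ereal_inf_tmp => _ [V /at_right0P[d d0 dV] <-].
have [r rd fra] := H _ d0; apply: le_trans fra _.
by apply: ereal_sup_ubound; exists r => //; exact: dV.
Qed.

Lemma limf_einf_ge_near f a (d : R) : 0 < d ->
  (forall r, 0 < r < d -> (a <= f r)%E) -> (a <= limf_einf f 0^'+)%E.
Proof.
move=> d0 H; rewrite limf_einfE; apply: ereal_sup_ge.
exists (ereal_inf (f @` [set r | 0 < r < d])).
  by exists [set r | 0 < r < d] => //; apply/at_right0P; exists d.
by apply: le_ereal_inf_tmp => _ [r rd <-]; exact: H.
Qed.

End Liminf.

Section Esum.
Context {R : realType}.
Local Open Scope ereal_scope.

Lemma esum_subset (T : choiceType) (A B : set T) (a : T -> \bar R) :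
  (forall x, 0 <= a x) -> A `<=` B ->
  \esum_(x in A) a x <= \esum_(x in B) a x.
Proof.
move=> a0 AB; apply: ereal_sup_le => _ [F [fF FA] <-].
by exists F => //; split => //; exact: subset_trans AB.
Qed.

(** No injectivity is required: passing to the image only merges terms.  The
    canonical choice operator selects one antecedent of each value. *)
Lemma esum_image_le (T T' : choiceType) (A : set T) (e : T -> T')
    (a : T' -> \bar R) : (forall x, 0 <= a x) ->
  \esum_(y in e @` A) a y <= \esum_(x in A) a (e x).
Proof.
move=> a0; pose P x := fun z => `[< A z /\ e z = e x >].
have eP x y : e x = e y -> P x = P y by move=> exy; rewrite /P exy.
have chP x : A x -> A (choose (P x) x) /\ e (choose (P x) x) = e x.
  by move=> Ax; have /asboolP : P x (choose (P x) x) by apply: chooseP; apply/asboolP.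
pose B := [set x | A x /\ choose (P x) x = x].
have -> : e @` A = e @` B.
  apply/seteqP; split=> [_ [x Ax <-]|_ [x [Ax _] <-]]; last by exists x.
  have [Ac ec] := chP _ Ax; exists (choose (P x) x) => //; split => //.
  rewrite (eP _ _ ec); apply: choose_id => //; apply/asboolP => //.
rewrite esum_image; last first.
  move=> x y; rewrite !inE => -[Ax cx] [Ay cy] exy.
  rewrite -cx -cy (eP _ _ exy); apply: choose_id; apply/asboolP; split => //.
by apply: esum_subset => // x [].
Qed.

Lemma esum_bigcup_le (T : choiceType) (J : nat -> set T) (a : T -> \bar R) :
  (forall x, 0 <= a x) ->
  \esum_(x in \bigcup_i J i) a x <= \sum_(0 <= i <oo) \esum_(x in J i) a x.
Proof.
move=> a0; have -> : \bigcup_i J i = snd @` (setT `*`` J).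
  by apply/seteqP; split=> [x [i _ Jx]|_ [[i x] [_ /= Jx] <-]]; [exists (i, x)|exists i].
apply: le_trans (esum_image_le _ _ a0) _.
rewrite -(@esum_esum _ _ _ setT J (fun _ x => a x))// nneseries_esumT// => i.
exact: esum_ge0.
Qed.

Lemma esum_seq (T : choiceType) (l : seq T) (a : T -> \bar R) : uniq l ->
  (forall y, 0 <= a y) -> \esum_(y in [set` l]) a y = \sum_(y <- l) a y.
Proof.
move=> ul a0; have fl : finite_set [set` l] by exact: finite_seq.
by rewrite fsbig_seq// esum_fset.
Qed.

Lemma nneseries_eq0 (a : nat -> \bar R) : (forall i, a i = 0) ->
  \sum_(0 <= i <oo) a i = 0.
Proof. by move=> a0; rewrite eseries0// => i _ _; exact: a0. Qed.

Lemma le_nneseries_term (a : nat -> \bar R) i : (forall j, 0 <= a j) ->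
  a i <= \sum_(0 <= j <oo) a j.
Proof.
move=> a0; rewrite nneseries_esumT// -(esum_set1 (a0 i)).
exact: esum_subset.
Qed.

End Esum.

(** * Comparison of the dimensions *)

Section Counting.
Context {R : realType}.
Local Open Scope ereal_scope.

Lemma esum_cst (T : choiceType) (C : set T) (c : R) : (0 <= c)%R ->
  \esum_(x in C) c%:E = counting C * c%:E.
Proof.
move=> c0; rewrite /counting; case: asboolP => fC.
  rewrite esum_fset; [|done|by move=> x _; rewrite lee_fin].
  rewrite fsbig_finite//= sumEFin -EFinM; congr EFin.
  by rewrite big_const_seq count_predT iter_addr_0 mulr_natl.
have [->|cn0] := eqVneq c 0%R; first by rewrite mule0 esum1.
have {cn0}c0 : (0 < c)%R by rewrite lt_neqAle eq_sym cn0.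
rewrite gt0_mulye ?lte_fin//; apply/eqyP => A A0.
have [B BC cB] := infinite_set_fset (Num.truncn (A / c)).+1 fC.
apply: esum_ge; exists [set` B]; first by split.
rewrite fsbig_finite//= set_fsetK sumEFin lee_fin big_const_seq count_predT iter_addr_0.
have /andP[_ /ltW] := truncn_itv (divr_ge0 (ltW A0) (ltW c0)).
rewrite ler_pdivrMr// => /le_trans; apply; rewrite -[leRHS]mulr_natl.
by apply: ler_wpM2r; rewrite ?ler_nat ?ltW.
Qed.

End Counting.

Section Powers.
Context {R : realType}.
Implicit Types r s e : R.

Lemma exists_half_expn_lt e : 0 < e -> exists n, ((2 : R) ^+ n)^-1 < e.
Proof.
move=> e0; exists (Num.bound e^-1).
rewrite invf_plt ?posrE ?exprn_gt0//; apply: lt_trans (archi_boundP _) _.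
  by rewrite invr_ge0 ltW.
by rewrite -natrX ltr_nat ltn_expl.
Qed.

Lemma half_expn_le1 n : ((2 : R) ^+ n)^-1 <= 1.
Proof. by rewrite invf_le1 ?exprn_gt0// exprn_ege1// ler1n. Qed.

Lemma exists_half_expn_itv r : 0 < r <= 1 ->
  exists n, ((2 : R) ^+ n.+1)^-1 < r <= (2 ^+ n)^-1.
Proof.
move=> /andP[r0 r1]; have [n nr nmin] := ex_minnP (exists_half_expn_lt r0).
case: n nr nmin => [|n] nr nmin.
  by move: nr; rewrite expr0 invr1 ltNge r1.
exists n; rewrite nr leNgt; apply/negP => /nmin; lia.
Qed.

Lemma powR_lt_near0 s e : 0 < s -> 0 < e ->
  exists2 d : R, 0 < d & forall r, 0 < r < d -> r `^ s < e.
Proof.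
move=> s0 e0; exists (e `^ s^-1); first exact: powR_gt0.
move=> r /andP[r0 rd]; have := gt0_ltr_powR s0 _ _ rd.
by rewrite -powRrM mulVf ?gt_eqF// powRr1 ?ltW//; apply; rewrite nnegrE ?powR_ge0 ?ltW.
Qed.

Lemma powR_le_opp r s e : 0 < r -> r <= s -> e <= 0 -> s `^ e <= r `^ e.
Proof.
move=> r0 rs e0; have s0 := lt_le_trans r0 rs.
rewrite -(opprK e) (powRN s) (powRN r) lef_pV2 ?posrE ?powR_gt0//.
by apply: ge0_ler_powR; rewrite ?oppr_ge0// nnegrE ltW.
Qed.

Lemma nneseries_geometric_le (a z : R) : 0 <= a -> 0 <= z < 1 ->
  (\sum_(0 <= i <oo) (a * z ^+ i)%:E <= (a / (1 - z))%:E)%E.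
Proof.
move=> a0 /andP[z0 z1]; apply: lime_le.
  by apply: is_cvg_nneseries => n _ _; rewrite lee_fin mulr_ge0// exprn_ge0.
apply: nearW => n; rewrite sumEFin lee_fin -mulr_sumr ler_wpM2l//.
rewrite -[leRHS]mul1r ler_pdivlMr ?subr_gt0// big_mkord.
have -> : (\sum_(i < n) z ^+ i) * (1 - z) = 1 - z ^+ n.
  by rewrite -[RHS]opprB subrX1; ring.
by rewrite gerBl exprn_ge0.
Qed.

End Powers.

Section DimensionInequalities.
Context {R : realType}.
Implicit Types (A F C : set R) (s t r delta : R).
Local Open Scope ereal_scope.

Lemma counting_ge0 (T : choiceType) (C : set T) : 0 <= (counting C : \bar R).
Proof. by rewrite /counting; case: ifP => // _; rewrite lee_fin. Qed.

Lemma covering_number_ge0 r A : 0 <= covering_number r A.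
Proof. by apply: le_ereal_inf_tmp => _ [C _ <-]; exact: counting_ge0. Qed.

Lemma packing_number_ge0 r A : 0 <= packing_number r A.
Proof.
apply: ereal_sup_ge; exists (counting (set0 : set R)); last exact: counting_ge0.
by exists set0 => //; split => // x y [].
Qed.

Lemma HS_L_ge0 t A : 0 <= HS_L t A.
Proof.
apply: (limf_einf_ge_near (ltr01)) => r _.
by rewrite mule_ge0 ?covering_number_ge0// lee_fin powR_ge0.
Qed.

Lemma HS_Hbar_ge0 t A : 0 <= HS_Hbar t A.
Proof. by apply: ereal_sup_ge; exists (HS_L t A); [exists A|exact: HS_L_ge0]. Qed.

Lemma HS_Pbar_ge0 t A : 0 <= HS_Pbar t A.
Proof.
apply: limf_esup_ge_frequently => d d0; exists (d / 2)%R; first by lra.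
by rewrite mule_ge0 ?packing_number_ge0// lee_fin powR_ge0.
Qed.

Lemma HS_H_ge0 t A : 0 <= HS_H t A.
Proof.
apply: le_ereal_inf_tmp => _ [F _ <-]; apply: nneseries_ge0 => i _ _.
exact: HS_Hbar_ge0.
Qed.

Lemma HS_P_ge0 t A : 0 <= HS_P t A.
Proof.
apply: le_ereal_inf_tmp => _ [F _ <-]; apply: nneseries_ge0 => i _ _.
exact: HS_Pbar_ge0.
Qed.

Lemma diam_ge0 (U : set R) : 0 <= diam U.
Proof. by rewrite /diam le_max lexx. Qed.

Lemma diam_ball (x r : R) : (0 < r)%R -> diam (ball x r) <= (2 * r)%:E.
Proof.
move=> r0; rewrite /diam ge_max lee_fin mulr_ge0/= ?(ltW r0)//.
apply: ge_ereal_sup => _ [[y z] [/= xy xz] <-]; rewrite lee_fin.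
move: xy xz; rewrite /ball /= => xy xz.
by rewrite (_ : y - z = (x - z) - (x - y))%R; [rewrite (le_trans (ler_normB _ _))//; lra|ring].
Qed.

Lemma hausdorff_premeasure_ge0 s delta A : 0 <= hausdorff_premeasure s delta A.
Proof.
apply: le_ereal_inf_tmp => _ [G _ <-]; apply: esum_ge0 => U _; exact: poweR_ge0.
Qed.

Lemma hausdorff_measure_ge0 s A : 0 <= hausdorff_measure s A.
Proof.
apply: ereal_sup_ge; exists (hausdorff_premeasure s 1 A).
  by exists 1%R => //=.
exact: hausdorff_premeasure_ge0.
Qed.

(** A covering by balls of one small radius is one of the covers that compete in
    the Hausdorff premeasure, and arbitrarily small radii are available. *)
Lemma hausdorff_premeasure_le_HS_L t delta A : (0 <= t)%R -> (0 < delta)%R ->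
  hausdorff_premeasure t delta A <= HS_L t A.
Proof.
move=> t0 d0; apply/lee_addgt0Pr => e e0.
have [->|Ly] := eqVneq (HS_L t A) +oo; first by rewrite addye// leey.
have Lf : HS_L t A \is a fin_num by rewrite ge0_fin_numE ?HS_L_ge0// ltey.
have : HS_L t A < HS_L t A + e%:E by rewrite lteDl// lte_fin.
move=> /limf_einf_lt_frequently/(_ (delta / 2)%R)[|r /andP[r0 rd]].
  by rewrite divr_gt0.
set a := _ + _ => /ltW-/(le_trans _); apply.
have p0 : (0 < (2 * r) `^ t)%R by rewrite powR_gt0// mulr_gt0.
rewrite -lee_pdivrMr//; apply: le_ereal_inf_tmp => _ [C [CA AC] <-].
rewrite lee_pdivrMr// -esum_cst ?powR_ge0//.
have [iC|fC] := pselect (infinite_set C).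
  rewrite esum_cst ?powR_ge0// /counting; case: asboolP => // _.
  by rewrite gt0_mulye ?lte_fin// leey.
apply: (@le_trans _ _ (\esum_(U in (fun x => ball x r) @` C) (diam U `^ t))); last first.
  apply: le_trans (esum_image_le _ _ _) _; first by move=> U; exact: poweR_ge0.
  apply: le_esum => x _; rewrite -poweR_EFin.
  apply: gt0_ler_poweR => //; rewrite ?diam_ball// in_itv/= leey andbT.
    exact: diam_ge0.
  by rewrite lee_fin mulr_ge0// ltW.
apply: ereal_inf_lbound; exists [set ball x r | x in C] => //; split.
- by apply: finite_set_countable; apply: finite_image; apply: contrapT.
- by move=> x /AC[y Cy xy]; exists (ball y r) => //; exists y.
- move=> _ [x _ <-]; apply: le_trans (diam_ball _ r0) _; rewrite lee_fin.
  by rewrite ltr_pdivlMr// in rd; rewrite mulrC ltW.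
Qed.

(** Sigma-subadditivity carries the comparison of the premeasures to the countable
    covers that define [HS_H]. *)
Lemma hausdorff_premeasure_sigma_subadditive s delta (F : (set R)^nat) A :
  A `<=` \bigcup_i F i ->
  hausdorff_premeasure s delta A <=
  \sum_(0 <= i <oo) hausdorff_premeasure s delta (F i).
Proof.
move=> AF; apply/lee_addgt0Pr => e e0.
apply: le_trans (epsilon_trick _ _ (ltW e0)); last first.
  by move=> i; exact: hausdorff_premeasure_ge0.
set b := fun i => hausdorff_premeasure s delta (F i) + (e / (2 ^ i.+1)%:R)%:E.
have [[i biy]|nbiy] := pselect (exists i, b i = +oo).
  rewrite (_ : \sum_(0 <= i <oo) _ = +oo) ?leey//.
  apply: (eseries_pinfty _ _ biy) => // j _.
  by rewrite gt_eqF// (lt_le_trans ltNy0)// adde_ge0 ?hausdorff_premeasure_ge0// lee_fin divr_ge0 ?ltW.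
have Gi i : {G | delta_cover delta (F i) G & \esum_(U in G) (diam U `^ s) <= b i}.
  apply/cid2; have : hausdorff_premeasure s delta (F i) < b i.
    have fb : hausdorff_premeasure s delta (F i) \is a fin_num.
      rewrite ge0_fin_numE ?hausdorff_premeasure_ge0// ltey.
      by apply/eqP => hy; apply: nbiy; exists i; rewrite /b hy addye.
    by rewrite /b lteDl// lte_fin divr_gt0.
  by move=> /ereal_inf_lt[_ [G dG <-] /ltW Gb]; exists G.
apply: (@le_trans _ _ (\esum_(U in \bigcup_i (s2val (Gi i))) (diam U `^ s))).
  apply: ereal_inf_lbound; exists (\bigcup_i s2val (Gi i)) => //; split.
  - by apply: bigcup_countable => // i _; case: (s2valP (Gi i)).
  - move=> x /AF[i _]; have [_ FG _] := s2valP (Gi i).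
    by move=> /FG[U GU Ux]; exists U => //; exists i.
  - by move=> U [i _ GU]; have [_ _] := s2valP (Gi i); apply.
apply: le_trans (esum_bigcup_le _ _) _; first by move=> U; exact: poweR_ge0.
apply: lee_nneseries => [i _ _|i _]; last exact: (s2valP' (Gi i)).
by apply: esum_ge0 => U _; exact: poweR_ge0.
Qed.

Lemma hausdorff_measure_le_HS_H t A : (0 <= t)%R -> hausdorff_measure t A <= HS_H t A.
Proof.
move=> t0; apply: ge_ereal_sup => _ [delta /= d0 <-].
apply: le_ereal_inf_tmp => _ [F AF <-].
apply: le_trans (hausdorff_premeasure_sigma_subadditive _ _ AF) _.
apply: lee_nneseries => [i _ _|i _]; first exact: hausdorff_premeasure_ge0.
apply: le_trans (hausdorff_premeasure_le_HS_L _ t0 d0) _.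
by apply: ereal_sup_ubound; exists (F i).
Qed.

Lemma hausdorff_dim_le_lower_MB_dim A : hausdorff_dim A <= lower_MB_dim A.
Proof.
apply: le_ereal_inf_tmp => _ [t [t0 Ht] <-]; apply: ereal_inf_lbound; exists t => //.
split=> //; apply/eqP; rewrite eq_le hausdorff_measure_ge0 andbT -Ht.
exact: hausdorff_measure_le_HS_H.
Qed.

Lemma packing_premeasure_delta_ge0 s delta A : 0 <= packing_premeasure_delta s delta A.
Proof.
apply: ereal_sup_ge; exists 0 => //; exists set0; last by rewrite esum_set0.
by split => // x y [].
Qed.

Lemma packing_premeasure_ge0 s A : 0 <= packing_premeasure s A.
Proof.
apply: le_ereal_inf_tmp => _ [d _ <-]; exact: packing_premeasure_delta_ge0.
Qed.

Lemma packing_measure_ge0 s A : 0 <= packing_measure s A.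
Proof.
apply: le_ereal_inf_tmp => _ [F _ <-]; apply: nneseries_ge0 => i _ _.
exact: packing_premeasure_ge0.
Qed.

(** Shrinking every ball of a packing whose radius lies in a dyadic range to the
    lower end of the range gives a packing by balls of one radius. *)
Lemma esum_packing_dyadic_le s n A (D : set (R * R)) : (0 <= s)%R ->
  (forall c, D c -> A c.1 /\ ((2 ^+ n.+1)^-1 < c.2 <= (2 ^+ n)^-1)%R) ->
  trivIset D (fun c => ball c.1 c.2) ->
  \esum_(c in D) ((2 * c.2) `^ s)%:E <=
  packing_number (2 ^+ n.+1)^-1 A * ((2 * (2 ^+ n)^-1) `^ s)%:E.
Proof.
move=> s0 DA tD; have p0 : (0 < (2 ^+ n.+1)^-1 :> R)%R by rewrite invr_gt0 exprn_gt0.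
apply: (@le_trans _ _ (\esum_(c in D) ((2 * (2 ^+ n)^-1) `^ s)%:E)).
  apply: le_esum => c /DA[_ /andP[c1 c2]]; rewrite lee_fin ge0_ler_powR// ?nnegrE.
  - by rewrite mulr_ge0// ltW// (lt_trans p0).
  - by rewrite mulr_ge0// invr_ge0 exprn_ge0.
  - by rewrite ler_pM2l.
have inj : set_inj D fst.
  move=> c c' /set_mem Dc /set_mem Dc' cc'; apply: tD => //; exists c.1; split.
    by apply: ballxx; have [_ /andP[h _]] := DA _ Dc; exact: lt_trans h.
  by rewrite cc'; apply: ballxx; have [_ /andP[h _]] := DA _ Dc'; exact: lt_trans h.
rewrite -(esum_image D fst (fun=> ((2 * (2 ^+ n)^-1) `^ s)%:E))//.
rewrite esum_cst ?powR_ge0// lee_wpmul2r ?lee_fin ?powR_ge0//.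
apply: ereal_sup_ubound; exists (fst @` D) => //; split.
  by move=> _ [c /DA[Ac _] <-].
move=> _ _ [c Dc <-] [c' Dc' <-] [y [/= yc yc']].
suff -> : c = c' by [].
apply: tD => //; exists y; split.
  by apply: le_ball yc; have [_ /andP[/ltW]] := DA _ Dc.
by apply: le_ball yc'; have [_ /andP[/ltW]] := DA _ Dc'.
Qed.

(** In a packing by balls of radius at most [2^-N], the balls of each dyadic range of
    radii contribute at most a constant times [2^(n (s - s'))], because [HS_Pbar s]
    bounds the packings by balls of one radius: the sum over the ranges is the tail of
    a geometric series. *)
Lemma packing_premeasure_eq0 s s' A : (0 <= s < s')%R -> HS_Pbar s A < +oo ->
  packing_premeasure s' A = 0.
Proof.
move=> /andP[s0 ss'] PA; apply/eqP; rewrite eq_le packing_premeasure_ge0 andbT.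
have [K K0 PK] : exists2 K : R, (0 < K)%R & HS_Pbar s A < K%:E.
  exists (fine (HS_Pbar s A) + 1)%R.
    by rewrite ltr_wpDl// fine_ge0// HS_Pbar_ge0.
  by rewrite EFinD fineK ?lteDl ?lte01// ge0_fin_numE ?HS_Pbar_ge0.
have [d d0 dP] := limf_esup_lt_near PK.
pose z : R := (2 `^ (s - s'))%R.
have z0 : (0 < z)%R by rewrite powR_gt0.
have z1 : (z < 1)%R.
  rewrite /z -opprB powRN invf_lt1 ?powR_gt0//.
  have h12 : (1 < 2 :> R)%R by rewrite ltr1n.
  have p1 : (1 `^ (s' - s) = 1 :> R)%R by rewrite powR1.
  by rewrite -[ltLHS]p1 gt0_ltr_powR ?nnegrE ?subr_gt0.
have zE n : (z ^+ n = (2 ^+ n)^-1 `^ (s' - s))%R.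
  rewrite -powR_invn// -powRrM mulNr -mulrN opprB mulrC powRrM powR_mulrn// powR_ge0.
have scale n : ((2 ^+ n.+1)^-1 < d)%R ->
  packing_number (2 ^+ n.+1)^-1 A * ((2 * (2 ^+ n)^-1) `^ s')%:E <=
  (K * 2 `^ s' * z ^+ n)%:E.
  move=> nd; have hn : (0 < (2 ^+ n)^-1 :> R)%R by rewrite invr_gt0 exprn_gt0.
  have hn1 : (0 < (2 ^+ n.+1)^-1 :> R)%R by rewrite invr_gt0 exprn_gt0.
  have rn : (0 < (2 ^+ n.+1)^-1 :> R)%R && ((2 ^+ n.+1)^-1 < d)%R by rewrite hn1.
  have /ltW := dP _ rn.
  have -> : (2 * (2 ^+ n.+1)^-1 = (2 ^+ n)^-1 :> R)%R.
    by rewrite exprS invfM mulrA divff ?mul1r.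
  move=> Kn.
  have -> : ((2 * (2 ^+ n)^-1) `^ s' = (2 ^+ n)^-1 `^ s * (2 `^ s' * z ^+ n))%R.
    rewrite powRM// ?ltW// zE mulrCA -powRD ?(gt_eqF hn) ?implybT//.
    by rewrite addrC subrK.
  rewrite EFinM muleA -mulrA [leRHS]EFinM lee_wpmul2r// lee_fin mulr_ge0 ?powR_ge0//.
  by rewrite exprn_ge0// ltW.
apply/lee_addgt0Pr => e e0; rewrite add0e.
have [N N1 Nd] : exists2 N, ((2 ^+ N)^-1 < d)%R &
    (K * 2 `^ s' * z ^+ N / (1 - z) <= e)%R.
  have c0 : (0 < K * 2 `^ s' / (1 - z))%R.
    by rewrite divr_gt0 ?mulr_gt0 ?powR_gt0// subr_gt0.
  have ss0 : (0 < s' - s)%R by rewrite subr_gt0.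
  have [d2 d20 d2P] := powR_lt_near0 ss0 (divr_gt0 e0 c0).
  have dd0 : (0 < Num.min d d2)%R by rewrite lt_min d0.
  have [N] := exists_half_expn_lt dd0.
  rewrite lt_min => /andP[Nd Nd2]; exists N => //.
  rewrite mulrAC zE mulrC -ler_pdivlMr// ltW// d2P// Nd2 andbT.
  by rewrite invr_gt0 exprn_gt0.
apply: (@le_trans _ _ (packing_premeasure_delta s' (2 ^+ N)^-1 A)).
  by apply: ereal_inf_lbound; exists (2 ^+ N)^-1%R => //=.
apply: ge_ereal_sup => _ [D [DA tD] <-].
pose Dn i := [set c | D c /\ ((2 ^+ (N + i).+1)^-1 < c.2 <= (2 ^+ (N + i))^-1)%R].
apply: (@le_trans _ _ (\sum_(0 <= i <oo) \esum_(c in Dn i) ((2 * c.2) `^ s')%:E)).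
  apply: le_trans _ (esum_bigcup_le _ _); last first.
    by move=> c; rewrite lee_fin powR_ge0.
  apply: esum_subset => [c|c Dc]; first by rewrite lee_fin powR_ge0.
  have [_ /andP[c0 cN]] := DA _ Dc.
  have [|n /andP[n1 n2]] := @exists_half_expn_itv _ c.2.
    by rewrite c0 (le_trans cN)// half_expn_le1.
  have Nn : (N <= n)%N.
    rewrite leqNgt; apply/negP => nN; have := lt_le_trans n1 cN.
    rewrite ltf_pV2 ?posrE ?exprn_gt0// ltNge => /negP; apply.
    by rewrite ler_eXn2l// ltr1n.
  by exists (n - N)%N => //; rewrite /Dn /= subnKC// n1 n2.
apply: (@le_trans _ _ (\sum_(0 <= i <oo) ((K * 2 `^ s' * z ^+ N) * z ^+ i)%:E)).
  apply: lee_nneseries => [i _ _|i _].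
    by apply: esum_ge0 => c _; rewrite lee_fin powR_ge0.
  rewrite -mulrA -exprD; apply: le_trans (scale _ _).
    apply: esum_packing_dyadic_le; first exact: le_trans (ltW ss').
      by move=> c [/DA[]].
    by apply: sub_trivIset tD => c [].
  apply: le_lt_trans N1; rewrite lef_pV2 ?posrE ?exprn_gt0// ler_eXn2l ?ltr1n//.
  lia.
apply: le_trans (nneseries_geometric_le _ _) _; last by rewrite lee_fin.
  by rewrite !mulr_ge0 ?powR_ge0 ?exprn_ge0// ltW.
by rewrite z1 ltW.
Qed.

Lemma packing_measure_eq0 s s' A : (0 <= s < s')%R -> HS_P s A < +oo ->
  packing_measure s' A = 0.
Proof.
move=> ss' /ereal_inf_lt[_ [F AF <-] Fy].
apply/eqP; rewrite eq_le packing_measure_ge0 andbT.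
apply: ereal_inf_le; exists (\sum_(0 <= i <oo) packing_premeasure s' (F i)).
  by exists F.
rewrite nneseries_eq0// => i; apply: packing_premeasure_eq0 ss' _.
apply: le_lt_trans Fy.
by apply: (@le_nneseries_term _ (fun i => HS_Pbar s (F i))) => j; exact: HS_Pbar_ge0.
Qed.

Lemma packing_dim_le_upper_MB_dim A : packing_dim A <= upper_MB_dim A.
Proof.
apply: le_ereal_inf_tmp => _ [t [t0 Pt] <-]; apply/lee_addgt0Pr => e e0.
apply: ereal_inf_lbound; exists (t + e)%R => //; split; first by rewrite addr_ge0// ltW.
by apply: (@packing_measure_eq0 t); rewrite ?Pt// t0 ltrDl.
Qed.

End DimensionInequalities.

(** * Level sets and the multifractal functions *)

Section LevelSetBounds.
Context {R : realType} (mu : probability (measurableTypeR R) R).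
Implicit Types (A F G : set R) (q t s r alpha e d : R).
Local Open Scope ereal_scope.

Lemma mu_ballE (x r : R) : mu (ball x r) = (fine (mu (ball x r)))%:E.
Proof. by rewrite fineK// fin_num_measure//; by rewrite ball_itv; exact: measurable_itv. Qed.

Lemma mu_ball_gt0 (x r : R) : supp mu x -> (0 < r)%R -> (0 < fine (mu (ball x r)))%R.
Proof.
move=> sx r0; rewrite -lte_fin -mu_ballE; apply: sx; last exact: ballxx.
exact: ball_open.
Qed.

(** For fixed [e], countably many of these sets cover the level set; they turn its
    defining limit into estimates that are uniform in the point. *)
Definition uniform_level_set alpha e d : set R :=
  [set x | supp mu x /\ forall r, (0 < r < d)%R ->
     (r `^ (alpha + e) <= fine (mu (ball x r)) <= r `^ (alpha - e))%R].

Lemma level_set_sub_bigcup alpha e : (0 < e)%R ->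
  level_set mu alpha `<=` \bigcup_m uniform_level_set alpha e (m.+1%:R^-1).
Proof.
move=> e0 x [sx /cvgrPdist_lt/(_ _ e0)/at_right0P[d d0 dP]].
have [m md] : exists m, (m.+1%:R^-1 < Num.min d 1)%R.
  have dd0 : (0 < Num.min d 1)%R by rewrite lt_min d0 ltr01.
  exists (Num.bound (Num.min d 1)^-1%R).
  rewrite invf_plt ?posrE//; apply: lt_trans (archi_boundP _) _.
    by rewrite invr_ge0 ltW.
  by rewrite ltr_nat.
exists m => //; split => // r /andP[r0 rm].
have := lt_trans rm md; rewrite lt_min => /andP[rd r1].
have m0 := mu_ball_gt0 sx r0; set M := fine _ in m0 *.
have lr : (ln r < 0)%R by rewrite ln_lt0// r0.
have rr : (0 < r < d)%R by rewrite r0.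
have := dP _ rr; rewrite -/M distrC ltr_distl => /andP[h1 h2].
have rE a : (r `^ a = expR (a * ln r))%R by rewrite /powR gt_eqF.
have ME : M = expR (ln M) by rewrite lnK// posrE.
rewrite [M in (_ <= M <= _)%R]ME !rE !ler_expR.
by rewrite -ler_ndivrMr// -[X in _ && X]ler_ndivlMr// !ltW.
Qed.

Lemma powR_le_mu_ball alpha e d q r x :
  (0 < r < Num.min d 1)%R -> uniform_level_set alpha e d x ->
  (r `^ (alpha * q + e * `|q|) <= fine (mu (ball x r)) `^ q)%R.
Proof.
move=> /andP[r0]; rewrite lt_min => /andP[rd r1] [sx /(_ r)].
rewrite r0 rd => /(_ isT)/andP[lo up]; have m0 := mu_ball_gt0 sx r0.
have [q0|q0] := leP 0%R q.
  rewrite ger0_norm// -mulrDl powRrM; apply: ge0_ler_powR => //.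
  by rewrite nnegrE powR_ge0.
  by rewrite nnegrE ltW.
rewrite ltr0_norm// mulrN -mulrBl powRrM.
by apply: powR_le_opp => //; exact: ltW.
Qed.

Lemma powR_scale_small q t s alpha e (K eps : R) : (0 < K)%R -> (0 < eps)%R ->
  (alpha * q + e * `|q| < s - t)%R ->
  exists2 d, (0 < d)%R & forall r, (0 < r < d)%R ->
    (K * (2 * r) `^ (s - t) <= eps * r `^ (alpha * q + e * `|q|))%R.
Proof.
move=> K0 eps0; set a := (alpha * q + _)%R => h.
have st0 : (0 < s - t - a)%R by rewrite subr_gt0.
have c0 : (0 < eps / (K * 2 `^ (s - t)))%R.
  by rewrite divr_gt0// mulr_gt0// powR_gt0.
have [d d0 dP] := powR_lt_near0 st0 c0; exists d => // r rd.
have /andP[r0 _] := rd.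
have -> : ((2 * r) `^ (s - t) = 2 `^ (s - t) * r `^ (s - t - a) * r `^ a)%R.
  by rewrite powRM ?(ltW r0)// -mulrA -powRD ?subrK ?(gt_eqF r0) ?implybT.
rewrite !mulrA ler_pM2r ?powR_gt0// mulrC -ler_pdivlMr ?mulr_gt0 ?powR_gt0//.
exact/ltW/dP.
Qed.

(** On a uniform level set every term [mu (ball x r) `^ q] of a covering sum is at least
    [r] to the power [alpha * q], up to a small error in the exponent: a bound on the
    weighted sums is a bound on the number of balls.  The strict inequality between
    the exponents absorbs that error and leaves a positive power of [r]. *)
Lemma HS_Hbar_uniform_level_set_eq0 q t s alpha e d F G : (0 < d)%R ->
  (alpha * q + e * `|q| < s - t)%R -> mu_Hbar mu q t F < +oo ->
  G `<=` F `&` uniform_level_set alpha e d -> HS_Hbar s G = 0.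
Proof.
move=> d0 h Fy GF; apply/eqP; rewrite eq_le HS_Hbar_ge0 andbT.
apply: ge_ereal_sup => _ [H HG <-]; apply/lee_addgt0Pr => eps eps0; rewrite add0e.
have LH : mu_L mu q t H < +oo.
  apply: le_lt_trans Fy; apply: ereal_sup_ubound; exists H => //.
  by move=> x /HG/GF[].
have [K K0 HK] : exists2 K : R, (0 < K)%R & mu_L mu q t H < K%:E.
  have [x|x|x] := ltgtP (mu_L mu q t H) 0.
  - by exists 1%R => //; apply: lt_trans x _.
  - exists (fine (mu_L mu q t H) + 1)%R; first by rewrite ltr_wpDl// fine_ge0// ltW.
    have fL : mu_L mu q t H \is a fin_num by rewrite ge0_fin_numE// ltW.
    by rewrite EFinD fineK ?lteDl ?lte01.
  - by exists 1%R => //; rewrite x.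
have [d' d'0 d'P] := powR_scale_small K0 eps0 h.
apply: limf_einf_le_frequently => d2 d20.
have dd0 : (0 < Num.min (Num.min d 1) (Num.min d' d2))%R by rewrite !lt_min d0 d'0 d20 ltr01.
have [r /andP[r0 rd] Kr] := limf_einf_lt_frequently HK dd0.
move: rd; rewrite lt_min [X in _ && X]lt_min => /andP[rd /andP[rd' rd2]].
exists r; first by rewrite r0.
have p0 a : (0 < r `^ a)%R by exact: powR_gt0.
have p2 a : (0 < (2 * r) `^ a)%R by rewrite powR_gt0// mulr_gt0.
have cov : covering_number r H * (r `^ (alpha * q + e * `|q|))%:E <= mu_covering_sum mu q r H.
  apply: le_ereal_inf_tmp => _ [C [CH HC] <-].
  apply: (@le_trans _ _ (counting C * (r `^ (alpha * q + e * `|q|))%:E)).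
    rewrite lee_wpmul2r ?lee_fin ?(ltW (p0 _))//.
    by apply: ereal_inf_lbound; exists C.
  rewrite -esum_cst ?(ltW (p0 _))//; apply: le_esum => x /CH/HG/GF[_ ux].
  by rewrite mu_ballE poweR_EFin lee_fin; apply: powR_le_mu_ball ux; rewrite r0.
have : covering_number r H * (r `^ (alpha * q + e * `|q|) * (2 * r) `^ t)%:E <= K%:E.
  rewrite EFinM muleA; apply: le_trans (ltW Kr).
  by rewrite lee_wpmul2r// lee_fin ltW.
rewrite -lee_pdivlMr ?mulr_gt0// -EFinM => cK.
apply: (@le_trans _ _ ((K / (r `^ (alpha * q + e * `|q|) * (2 * r) `^ t))%:E * ((2 * r) `^ s)%:E)).
  by rewrite lee_wpmul2r// lee_fin ltW.
rewrite -EFinM lee_fin mulrAC ler_pdivrMr ?mulr_gt0//.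
rewrite -(subrK t s) powRD ?(gt_eqF (mulr_gt0 _ r0)) ?implybT//.
rewrite !mulrA ler_pM2r//; apply: d'P; rewrite r0//.
Qed.

Lemma HS_Pbar_uniform_level_set_eq0 q t s alpha e d F G : (0 < d)%R ->
  (alpha * q + e * `|q| < s - t)%R -> mu_Pbar mu q t F < +oo ->
  G `<=` F `&` uniform_level_set alpha e d -> HS_Pbar s G = 0.
Proof.
move=> d0 h Fy GF; apply/eqP; rewrite eq_le HS_Pbar_ge0 andbT.
apply/lee_addgt0Pr => eps eps0; rewrite add0e.
have [K K0 HK] : exists2 K : R, (0 < K)%R & mu_Pbar mu q t F < K%:E.
  have [x|x|x] := ltgtP (mu_Pbar mu q t F) 0.
  - by exists 1%R => //; apply: lt_trans x _.
  - exists (fine (mu_Pbar mu q t F) + 1)%R; first by rewrite ltr_wpDl// fine_ge0// ltW.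
    have fL : mu_Pbar mu q t F \is a fin_num by rewrite ge0_fin_numE// ltW.
    by rewrite EFinD fineK ?lteDl ?lte01.
  - by exists 1%R => //; rewrite x.
have [d' d'0 d'P] := powR_scale_small K0 eps0 h.
have [d2 d20 d2P] := limf_esup_lt_near HK.
have dd0 : (0 < Num.min (Num.min d 1) (Num.min d' d2))%R by rewrite !lt_min d0 d'0 d20 ltr01.
apply: (limf_esup_le_near dd0) => r /andP[r0].
rewrite lt_min [X in _ && X]lt_min => /andP[rd /andP[rd' rd2]].
have p0 a : (0 < r `^ a)%R by exact: powR_gt0.
have p2 a : (0 < (2 * r) `^ a)%R by rewrite powR_gt0// mulr_gt0.
have rd2' : (0 < r < d2)%R by rewrite r0.
have /ltW Kr := d2P _ rd2'.
rewrite -lee_pdivlMr//; apply: ge_ereal_sup => _ [C [CG tC] <-].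
have : counting C * (r `^ (alpha * q + e * `|q|) * (2 * r) `^ t)%:E <= K%:E.
  rewrite EFinM muleA; apply: le_trans Kr; rewrite lee_wpmul2r ?lee_fin ?(ltW (p2 _))//.
  apply: (@le_trans _ _ (\esum_(x in C) (mu (ball x r) `^ q))); last first.
    apply: ereal_sup_ubound; exists C => //; split => //.
    by move=> x /CG/GF[].
  rewrite -esum_cst ?(ltW (p0 _))//; apply: le_esum => x /CG/GF[_ ux].
  by rewrite mu_ballE poweR_EFin lee_fin; apply: powR_le_mu_ball ux; rewrite r0.
rewrite -lee_pdivlMr ?mulr_gt0// -EFinM => cK.
apply: le_trans cK _; rewrite -EFinM lee_fin ler_pdivlMr// mulrAC ler_pdivrMr ?mulr_gt0//.
rewrite -(subrK t s) powRD ?(gt_eqF (mulr_gt0 _ r0)) ?implybT//.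
rewrite !mulrA ler_pM2r//; apply: d'P; rewrite r0//.
Qed.

Lemma mu_L_ge0 q t A : 0 <= mu_L mu q t A.
Proof.
apply: (limf_einf_ge_near ltr01) => r _; rewrite mule_ge0 ?lee_fin ?powR_ge0//.
apply: le_ereal_inf_tmp => _ [C _ <-]; apply: esum_ge0 => x _; exact: poweR_ge0.
Qed.

Lemma mu_Hbar_ge0 q t A : 0 <= mu_Hbar mu q t A.
Proof. by apply: ereal_sup_ge; exists (mu_L mu q t A); [exists A|exact: mu_L_ge0]. Qed.

Lemma mu_Pbar_ge0 q t A : 0 <= mu_Pbar mu q t A.
Proof.
apply: limf_esup_ge_frequently => d d0; exists (d / 2)%R; first by lra.
rewrite mule_ge0 ?lee_fin ?powR_ge0//; apply: ereal_sup_ge; exists 0 => //.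
by exists set0; [split => // x y []|rewrite esum_set0].
Qed.

Lemma exists_slack q t s alpha : (alpha * q + t < s)%R ->
  exists2 e, (0 < e)%R & (alpha * q + e * `|q| < s - t)%R.
Proof.
move=> h; have b0 : (0 < 2 * (`|q| + 1))%R by rewrite mulr_gt0// ltr_wpDl.
exists ((s - t - alpha * q) / (2 * (`|q| + 1)))%R.
  by rewrite divr_gt0//; lra.
have a0 : (0 < s - t - alpha * q)%R by lra.
have : ((s - t - alpha * q) / (2 * (`|q| + 1)) * `|q| <= (s - t - alpha * q) / 2)%R.
  rewrite invfM mulrA -mulrA ler_piMr//; first by rewrite divr_ge0// ltW.
  by rewrite mulrC ler_pdivrMr ?mul1r ?ltr_wpDl// lerDl.
lra.
Qed.

(** The pieces of a countable cover of the support, cut by the countably many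
    uniform level sets. *)
Definition level_pieces alpha e (F : (set R)^nat) : (set R)^nat :=
  fun k => if choice.unpickle k is Some (i, m) then
    F i `&` uniform_level_set alpha e (m.+1%:R^-1) else set0.

Lemma level_pieces_sub alpha e (F : (set R)^nat) k : exists i m,
  level_pieces alpha e F k `<=` F i `&` uniform_level_set alpha e (m.+1%:R^-1).
Proof.
rewrite /level_pieces; case: choice.unpickle => [[i m]|]; first by exists i, m.
by exists 0%N, 0%N => x.
Qed.

Lemma level_set_sub_pieces alpha e (F : (set R)^nat) : (0 < e)%R ->
  supp mu `<=` \bigcup_i F i -> level_set mu alpha `<=` \bigcup_k level_pieces alpha e F k.
Proof.
move=> e0 sF x Ex; have [i _ Fx] := sF x (proj1 Ex).
have [m _ mx] := level_set_sub_bigcup e0 Ex.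
by exists (choice.pickle (i, m)) => //; rewrite /level_pieces choice.pickleK.
Qed.

Lemma HS_H_level_set_eq0 q t s alpha : (alpha * q + t < s)%R ->
  mu_H mu q t (supp mu) < +oo -> HS_H s (level_set mu alpha) = 0.
Proof.
move=> /exists_slack[e e0 he] /ereal_inf_lt[_ [F [_ sF] <-] Fy].
apply/eqP; rewrite eq_le HS_H_ge0 andbT; apply: ereal_inf_le.
exists (\sum_(0 <= k <oo) HS_Hbar s (level_pieces alpha e F k)).
  by exists (level_pieces alpha e F) => //; exact: level_set_sub_pieces.
rewrite nneseries_eq0// => k; have [i [m sub]] := level_pieces_sub alpha e F k.
apply: HS_Hbar_uniform_level_set_eq0 he _ sub => //.
apply: le_lt_trans Fy.
by apply: (@le_nneseries_term _ (fun i => mu_Hbar mu q t (F i))) => j; exact: mu_Hbar_ge0.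
Qed.

Lemma HS_P_level_set_eq0 q t s alpha : (alpha * q + t < s)%R ->
  mu_P mu q t (supp mu) < +oo -> HS_P s (level_set mu alpha) = 0.
Proof.
move=> /exists_slack[e e0 he] /ereal_inf_lt[_ [F [_ sF] <-] Fy].
apply/eqP; rewrite eq_le HS_P_ge0 andbT; apply: ereal_inf_le.
exists (\sum_(0 <= k <oo) HS_Pbar s (level_pieces alpha e F k)).
  by exists (level_pieces alpha e F) => //; exact: level_set_sub_pieces.
rewrite nneseries_eq0// => k; have [i [m sub]] := level_pieces_sub alpha e F k.
apply: HS_Pbar_uniform_level_set_eq0 he _ sub => //.
apply: le_lt_trans Fy.
by apply: (@le_nneseries_term _ (fun i => mu_Pbar mu q t (F i))) => j; exact: mu_Pbar_ge0.
Qed.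

(** When [alpha * q + t] is negative the exponent 0 is admissible instead, and
    then the dimension is 0: hence the hypothesis of positivity. *)
Lemma lower_MB_dim_level_set_le alpha : 0 < lower_MB_dim (level_set mu alpha) ->
  lower_MB_dim (level_set mu alpha) <= legendre (b_fun mu) alpha.
Proof.
move=> L0; apply: le_ereal_inf_tmp => _ [q _ <-].
rewrite -leeBlDl//; apply: le_ereal_inf_tmp => _ [t Ht <-].
rewrite leeBlDl// -EFinD; move: Ht => /= Ht.
apply/lee_addgt0Pr => eps eps0.
have [s0|s0] := leP 0%R (alpha * q + t + eps)%R.
  rewrite -EFinD; apply: ereal_inf_lbound; exists (alpha * q + t + eps)%R; last by [].
  split; first exact: s0.
  by apply: (@HS_H_level_set_eq0 q t); rewrite ?ltrDl ?Ht.
suff : lower_MB_dim (level_set mu alpha) <= 0 by rewrite leNgt L0.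
apply: ereal_inf_lbound; exists 0%R; last by [].
split; first exact: lexx.
by apply: (@HS_H_level_set_eq0 q t); rewrite ?Ht//; lra.
Qed.

Lemma upper_MB_dim_level_set_le alpha : 0 < upper_MB_dim (level_set mu alpha) ->
  upper_MB_dim (level_set mu alpha) <= legendre (B_fun mu) alpha.
Proof.
move=> L0; apply: le_ereal_inf_tmp => _ [q _ <-].
rewrite -leeBlDl//; apply: le_ereal_inf_tmp => _ [t Ht <-].
rewrite leeBlDl// -EFinD; move: Ht => /= Ht.
apply/lee_addgt0Pr => eps eps0.
have [s0|s0] := leP 0%R (alpha * q + t + eps)%R.
  rewrite -EFinD; apply: ereal_inf_lbound; exists (alpha * q + t + eps)%R; last by [].
  split; first exact: s0.
  by apply: (@HS_P_level_set_eq0 q t); rewrite ?ltrDl ?Ht.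
suff : upper_MB_dim (level_set mu alpha) <= 0 by rewrite leNgt L0.
apply: ereal_inf_lbound; exists 0%R; last by [].
split; first exact: lexx.
by apply: (@HS_P_level_set_eq0 q t); rewrite ?Ht//; lra.
Qed.

End LevelSetBounds.

(** * Trees of codes *)

Section Codes.
Variable N : nat -> nat.
Implicit Types (u v w : nat -> nat) (m l : nat).

(** A code chooses one of [N i] branches at each level [i]; the codes are the
    infinite branches of a homogeneous tree. *)
Definition code u := forall i, (u i < N i)%N.

Definition agree m u v := forall i, (i < m)%N -> u i = v i.

Definition node_count m := (\prod_(0 <= i < m) N i)%N.

Lemma agree_trans m u v w : agree m u v -> agree m v w -> agree m u w.
Proof. by move=> uv vw i im; rewrite uv// vw. Qed.

Lemma agree_sym m u v : agree m u v -> agree m v u.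
Proof. by move=> uv i im; rewrite uv. Qed.

Lemma agree_le m m' u v : (m' <= m)%N -> agree m u v -> agree m' u v.
Proof. by move=> mm' uv i im; apply: uv; exact: leq_trans mm'. Qed.

Lemma node_countS m : node_count m.+1 = (node_count m * N m)%N.
Proof. by rewrite /node_count big_nat_recr. Qed.

Hypothesis N_gt0 : forall i, (0 < N i)%N.

Lemma node_count_gt0 m : (0 < node_count m)%N.
Proof. by rewrite /node_count prodn_cond_gt0. Qed.

Definition extend u l k : nat -> nat := fun j => if j == l then k else u j.

Lemma agree_extend u l k : agree l u (extend u l k).
Proof. by move=> i il; rewrite /extend ltn_eqF. Qed.

Section Kraft.
Context {R : realType}.
Variables (lev : nat -> nat) (w : nat -> nat -> nat).

(** The conditional probability, given the first [l] choices of [u], that a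
    uniformly random code follows [w i] up to level [lev i]. *)
Definition load i l u : R :=
  if `[< agree (minn l (lev i)) u (w i) >] then
    if (lev i <= l)%N then 1 else (node_count l)%:R / (node_count (lev i))%:R
  else 0.

Lemma node_count_gt0_R m : 0 < (node_count m)%:R :> R.
Proof. by rewrite ltr0n node_count_gt0. Qed.

Lemma load_ge0 i l u : 0 <= load i l u.
Proof.
by rewrite /load; case: ifP => // _; case: ifP.
Qed.

Lemma load_agree i l u v : agree l u v -> load i l u = load i l v.
Proof.
move=> uv; rewrite /load; congr (if _ then _ else _); apply/asboolP/asboolP.
  by apply: agree_trans; apply: agree_sym; apply: agree_le uv; exact: geq_minl.
by apply: agree_trans; apply: agree_le uv; exact: geq_minl.
Qed.

Lemma sum_load_extend i l u :
  \sum_(k < N l) load i l.+1 (extend u l k) <= (N l)%:R * load i l u.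
Proof.
have [il|li] := leqP (lev i) l.
  rewrite (eq_bigr (fun=> load i l u)).
    by rewrite sumr_const card_ord mulr_natl.
  move=> k _; rewrite /load (minn_idPr il) (minn_idPr (leqW il)) il (leqW il).
  congr (if _ then _ else _); apply/asboolP/asboolP => h.
    by apply: agree_trans h; apply: agree_le il _; exact: agree_extend.
  by apply: agree_trans h; apply: agree_sym; apply: agree_le il _; exact: agree_extend.
have [a|na] := pselect (agree l u (w i)); last first.
  rewrite big1; first by rewrite mulr_ge0// load_ge0.
  move=> k _; rewrite /load (minn_idPl li).
  case: asboolP => // a'; case: na => j jl; rewrite -a'; last exact: ltnW.
  by rewrite /extend ltn_eqF.
have -> : load i l u = (node_count l)%:R / (node_count (lev i))%:R.
  by rewrite /load (minn_idPl (ltnW li)) leqNgt li/= asboolT.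
set c : R := (node_count l.+1)%:R / (node_count (lev i))%:R.
have -> : (N l)%:R * ((node_count l)%:R / (node_count (lev i))%:R) = c.
  by rewrite /c node_countS mulrA -natrM mulnC.
have c0 : 0 <= c by rewrite divr_ge0.
apply: (@le_trans _ _ (\sum_(k < N l) (if val k == w i l then c else 0))).
  apply: ler_sum => k _; rewrite /load (minn_idPl li).
  case: asboolP => [h|_]; last by case: ifP.
  rewrite -(h l)// /extend eqxx eqxx; case: ifP => // le.
  have li1 : lev i = l.+1 by apply/eqP; rewrite eqn_leq le.
  by rewrite /c li1 divff// gt_eqF// node_count_gt0_R.
rewrite -big_mkcond/=; have [wl|wl] := ltnP (w i l) (N l).
  by rewrite (big_pred1 (Ordinal wl))// => k.
rewrite big_pred0// => k; apply/negP => /eqP kw.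
by have := ltn_ord k; rewrite kw ltnNge wl.
Qed.

Definition total_load l u : \bar R := (\sum_(0 <= i <oo) (load i l u)%:E)%E.

Lemma total_load_extend l u : (total_load l u < 1)%E ->
  exists k, (k < N l)%N /\ (total_load l.+1 (extend u l k) < 1)%E.
Proof.
move=> tu; apply: contrapT => H.
have : ((N l)%:R%:E <= (N l)%:R%:E * total_load l u)%E.
  apply: (@le_trans _ _ (\sum_(k < N l) total_load l.+1 (extend u l k))%E).
    rewrite (_ : (N l)%:R%:E = \sum_(k < N l) 1%:E :> \bar R)%E; last first.
      by rewrite sumEFin sumr_const card_ord.
    by apply: lee_sum => k _; rewrite leNgt; apply/negP => tk; apply: H; exists k.
  rewrite /total_load -nneseries_sum; last by move=> *; rewrite lee_fin load_ge0.
  rewrite -nneseriesZl; last by move=> *; rewrite lee_fin load_ge0.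
  apply: lee_nneseries => [i _ _|i _].
    by apply: sume_ge0 => k _; rewrite lee_fin load_ge0.
  by rewrite sumEFin -EFinM lee_fin sum_load_extend.
apply/negP; rewrite -ltNge -[ltRHS]mule1 lte_pmul2l// lte_fin ltr0n.
exact: N_gt0.
Qed.

(** Kraft's inequality in the form that bounds Hausdorff measures from below: if
    the total load were less than 1, one could keep it so while descending the
    tree, and the branch obtained would avoid every node of the family. *)
Lemma kraft_cover : (forall u, code u -> exists i, agree (lev i) u (w i)) ->
  (1 <= \sum_(0 <= i <oo) ((node_count (lev i))%:R^-1)%:E :> \bar R)%E.
Proof.
move=> cov; rewrite leNgt; apply/negP => lt1.
have t0 : (total_load 0 (fun=> 0%N) < 1)%E.
  apply: le_lt_trans lt1; apply: lee_nneseries => [i _ _|i _]; first by rewrite lee_fin load_ge0.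
  rewrite lee_fin /load min0n asboolT// leqn0; case: eqP => [->|_].
    by rewrite /node_count big_geq// invr1.
  by rewrite [node_count 0]/node_count big_geq// mul1r.
pose st l := {u : nat -> nat | (total_load l u < 1)%E}.
have next l (s : st l) : {s' : st l.+1 | exists2 k, (k < N l)%N & sval s' = extend (sval s) l k}.
  case: s => u tu; have /cid[k [kN tk]] := total_load_extend tu.
  by exists (exist _ (extend u l k) tk); exists k.
pose fix pre l : st l := if l is l'.+1 then sval (next l' (pre l')) else exist _ (fun=> 0%N) t0.
pose v l := sval (pre l.+1) l.
have preS l : exists2 k, (k < N l)%N & sval (pre l.+1) = extend (sval (pre l)) l k.
  by rewrite /=; case: (next l (pre l)).
have codev : code v.
  by move=> l; rewrite /v; have [k kN ->] := preS l; rewrite /extend eqxx.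
have agv l : agree l (sval (pre l)) v.
  elim: l => // l IH i; rewrite ltnS leq_eqVlt => /predU1P[->//|il].
  by have [k _ ->] := preS l; rewrite -(IH _ il) -(agree_extend _ _ il).
have [i vi] := cov _ codev.
have := svalP (pre (lev i)); apply/negP; rewrite -leNgt.
apply: le_trans (@le_nneseries_term R (fun j => (load j (lev i) (sval (pre (lev i))))%:E) i _).
  rewrite (load_agree _ (agv _)) /load minnn leqnn asboolT//.
by move=> j; rewrite lee_fin load_ge0.
Qed.

End Kraft.

(** Baire's theorem for the space of codes: packing dimensions are defined through
    countable covers, and one member of such a cover is dense above some node. *)
Lemma code_baire (F : nat -> set (nat -> nat)) :
  (forall u, code u -> exists i, F i u) ->
  exists i u0 m0, code u0 /\ forall v m, code v -> agree m0 u0 v ->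
    exists w, [/\ code w, agree m v w & F i w].
Proof.
move=> cov; apply: contrapT => H.
have step i u m : code u -> exists vm : (nat -> nat) * nat,
    [/\ code vm.1, (m < vm.2)%N, agree m u vm.1 &
        forall w, code w -> agree vm.2 vm.1 w -> ~ F i w].
  move=> cu; apply: contrapT => K; apply: H; exists i, u, m; split => // v m' cv uv.
  apply: contrapT => L; apply: K; exists (v, maxn m.+1 m'); split => //=.
    by rewrite leq_max ltnSn.
  move=> w cw vw Fw; apply: L; exists w; split => //.
  by apply: agree_le vw; exact: leq_maxr.
pose st := {um : (nat -> nat) * nat | code um.1}.
have next i (s : st) : {s' : st | [/\ ((sval s).2 < (sval s').2)%N,
    agree (sval s).2 (sval s).1 (sval s').1 &
    forall w, code w -> agree (sval s').2 (sval s').1 w -> ~ F i w]}.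
  case: s => -[u m] cu; have /cid[vm [cv mv uv Fv]] := step i u m cu.
  by exists (exist _ vm cv).
have code0 : code ((fun=> 0%N) : nat -> nat) by move=> i; exact: N_gt0.
pose fix pre l : st :=
  if l is l'.+1 then sval (next l' (pre l')) else exist _ ((fun=> 0%N), 0%N) code0.
have preS l : [/\ ((sval (pre l)).2 < (sval (pre l.+1)).2)%N,
    agree (sval (pre l)).2 (sval (pre l)).1 (sval (pre l.+1)).1 &
    forall w, code w -> agree (sval (pre l.+1)).2 (sval (pre l.+1)).1 w -> ~ F l w].
  by rewrite /=; case: (next l (pre l)).
have lem l : (l <= (sval (pre l)).2)%N.
  by elim: l => // l IH; have [h _ _] := preS l; exact: leq_ltn_trans h.
have mono l k : ((sval (pre l)).2 <= (sval (pre (l + k)%N)).2)%N.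
  elim: k => [|k IH]; first by rewrite addn0.
  by rewrite addnS; have [/ltnW h _ _] := preS (l + k)%N; exact: leq_trans h.
have ag l k : agree (sval (pre l)).2 (sval (pre l)).1 (sval (pre (l + k)%N)).1.
  elim: k => [|k IH]; first by rewrite addn0.
  rewrite addnS; apply: agree_trans IH _; have [_ h _] := preS (l + k)%N.
  exact: agree_le (mono _ _) h.
pose v j := (sval (pre j.+1)).1 j.
have agv l : agree (sval (pre l)).2 (sval (pre l)).1 v.
  move=> j jl; rewrite /v; have [lj|jl'] := leqP l j.+1.
    by have := ag l (j.+1 - l)%N j jl; rewrite subnKC.
  by have := ag j.+1 (l - j.+1)%N j (lem _); rewrite subnKC// ltnW.
have codev : code v by move=> j; exact: (svalP (pre j.+1)).
have [i Fv] := cov _ codev; have [_ _ /(_ v codev (agv _))] := preS i.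
exact.
Qed.

(** The listed codes are the centers of a packing that is as large as the density of [F]
    allows; a node is represented by its sequence of choices. *)
Lemma dense_code_list (F : set (nat -> nat)) u0 m0 m : code u0 -> (m0 <= m)%N ->
  (forall v m, code v -> agree m0 u0 v -> exists w, [/\ code w, agree m v w & F w]) ->
  exists (s : seq (seq nat)) (W : seq nat -> nat -> nat),
  [/\ uniq s, (node_count m0 * size s)%N = node_count m &
      forall x, x \in s -> [/\ size x = m, code (W x), F (W x) & agree m (W x) (nth 0%N x)]].
Proof.
move=> cu0 m0m dense.
have [s [us ss sP]] : exists s : seq (seq nat), [/\ uniq s,
    (node_count m0 * size s)%N = node_count m & forall x, x \in s ->
    [/\ size x = m, (forall i, (i < m)%N -> (nth 0 x i < N i)%N) & agree m0 u0 (nth 0%N x)]].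
  rewrite -(subnKC m0m); elim: (m - m0)%N => [|k [s [us ss sP]]].
    rewrite addn0; exists [:: mkseq u0 m0]; split => //; first by rewrite muln1.
    move=> x; rewrite inE => /eqP ->; rewrite size_mkseq; split => // i im.
      by rewrite nth_mkseq.
    by rewrite nth_mkseq.
  exists [seq rcons x j | x <- s, j <- iota 0 (N (m0 + k))]; split.
  - apply: allpairs_uniq => //; first exact: iota_uniq.
    by move=> [x j] [x' j'] _ _ /= /rcons_inj[-> ->].
  - by rewrite size_allpairs size_iota addnS node_countS mulnA ss.
  move=> _ /allpairsP[[x j] [/= /sP[sl lN lu] jN ->]].
  rewrite size_rcons sl addnS; split => // i im; rewrite nth_rcons sl.
    move: im; rewrite ltnS leq_eqVlt => /predU1P[->|im]; last by rewrite im lN.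
    by rewrite ltnn eqxx; move: jN; rewrite mem_iota.
  by rewrite (leq_trans im) ?leq_addr// lu.
have W x : {w | x \in s -> [/\ code w, F w & agree m w (nth 0%N x)]}.
  apply/cid; have [ls|nls] := boolP (x \in s); last by exists u0.
  have [sl lN lu] := sP _ ls.
  pose v i := if (i < m)%N then nth 0%N x i else u0 i.
  have cv : code v by move=> i; rewrite /v; case: ifPn => [/lN|].
  have uv : agree m0 u0 v by move=> i im; rewrite /v (leq_trans im m0m) lu.
  have [w [cw vw Fw]] := dense _ m cv uv; exists w => _; split => // i im.
  by rewrite -vw// /v im.
exists s, (fun x => sval (W x)); split => // x ls.
by have [? ? ?] := svalP (W x) ls; have [? _ _] := sP _ ls.
Qed.

End Codes.

(** * Points given by their binary digits *)

Section BinaryDigits.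
Context {R : realType}.
Implicit Types (e : nat -> bool) (n m : nat).

Lemma half_expn_gt0 n : 0 < ((2 : R) ^+ n)^-1.
Proof. by rewrite invr_gt0 exprn_gt0. Qed.

Lemma half_expnS n : ((2 : R) ^+ n)^-1 = 2 * (2 ^+ n.+1)^-1.
Proof. by rewrite exprS invfM mulrA divff ?mul1r. Qed.

Lemma ler_half_expn n m : (n <= m)%N -> ((2 : R) ^+ m)^-1 <= (2 ^+ n)^-1.
Proof. by move=> nm; rewrite lef_pV2 ?posrE ?exprn_gt0// ler_eXn2l// ltr1n. Qed.

Lemma dyadic_left0 e : dyadic_left 0 e = 0 :> R.
Proof. by rewrite /dyadic_left big_geq. Qed.

Lemma dyadic_leftS n e :
  dyadic_left n.+1 e = dyadic_left n e + (e n.+1)%:R * (2 ^+ n.+1)^-1 :> R.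
Proof. by rewrite /dyadic_left big_nat_recr. Qed.

Definition same_digits n e e' := forall j, (0 < j <= n)%N -> e j = e' j.

Lemma same_digits_dyadic_left n e e' :
  same_digits n e e' -> dyadic_left n e = dyadic_left n e' :> R.
Proof.
move=> ee; rewrite /dyadic_left; apply: eq_big_nat => j /andP[j1 jn].
by rewrite ee// j1 -ltnS.
Qed.

Lemma dyadic_left_nested n m e : (n <= m)%N ->
  (dyadic_left n e : R) <= dyadic_left m e /\
  dyadic_left m e + (2 ^+ m)^-1 <= dyadic_left n e + (2 ^+ n)^-1 :> R.
Proof.
move=> nm; rewrite -(subnKC nm); elim: (m - n)%N => [|k [IH1 IH2]].
  by rewrite addn0.
rewrite addnS dyadic_leftS; have := half_expn_gt0 (n + k).+1.
have := half_expnS (n + k); case: (e _) => /=; rewrite ?mul1r ?mul0r; lra.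
Qed.

Lemma dyadic_left_separated n e e' : [\/ same_digits n e e',
  dyadic_left n e + (2 ^+ n)^-1 <= dyadic_left n e' :> R |
  dyadic_left n e' + (2 ^+ n)^-1 <= dyadic_left n e :> R].
Proof.
elim: n => [|n [IH|IH|IH]]; first by apply: Or31 => j; case: j.
- have [en|en] := eqVneq (e n.+1) (e' n.+1).
    apply: Or31 => j /andP[j0]; rewrite leq_eqVlt => /predU1P[->//|jn].
    by rewrite IH// j0 -ltnS.
  rewrite !dyadic_leftS (same_digits_dyadic_left IH).
  case: (e n.+1) (e' n.+1) en => -[]//= _; rewrite mul1r mul0r addr0.
    exact: Or33.
  exact: Or32.
- have [_ h] := @dyadic_left_nested n n.+1 e (leqnSn _).
  have [h' _] := @dyadic_left_nested n n.+1 e' (leqnSn _).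
  by apply: Or32; lra.
- have [_ h] := @dyadic_left_nested n n.+1 e' (leqnSn _).
  have [h' _] := @dyadic_left_nested n n.+1 e (leqnSn _).
  by apply: Or33; lra.
Qed.

Definition binary_point e : R := sup [set dyadic_left n e | n in [set: nat]].

Lemma binary_point_bounds n e :
  dyadic_left n e <= binary_point e <= dyadic_left n e + (2 ^+ n)^-1.
Proof.
have ub k m : (dyadic_left m e : R) <= dyadic_left k e + (2 ^+ k)^-1.
  have [km|/ltnW mk] := leqP k m.
    have [_] := dyadic_left_nested e km; have := half_expn_gt0 m; lra.
  have [+ _] := dyadic_left_nested e mk; have := half_expn_gt0 k; lra.
apply/andP; split.
  apply: ub_le_sup; last by exists n.
  by exists (dyadic_left 0 e + (2 ^+ 0)^-1) => _ [m _ <-].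
apply: ge_sup; first by exists (dyadic_left 0 e); exists 0%N.
by move=> _ [m _ <-].
Qed.

(** A point whose digits number [n.+1] and [n.+2] are 0 and 1 lies in the second
    quarter of its dyadic interval of generation [n], away from both ends. *)
Lemma binary_point_second_quarter n e : e n.+1 = false -> e n.+2 = true ->
  dyadic_left n e + (2 ^+ n.+2)^-1 <= binary_point e <=
  dyadic_left n e + 2 * (2 ^+ n.+2)^-1.
Proof.
move=> e1 e2; have := binary_point_bounds n.+2 e.
rewrite !dyadic_leftS e1 e2 mul0r addr0 mul1r => /andP[-> h] /=; lra.
Qed.

Lemma ball_sub_dyadic n e : e n.+1 = false -> e n.+2 = true ->
  ball (binary_point e) (2 ^+ n.+2)^-1 `<=` dyadic n e.
Proof.
move=> e1 e2 y; have /andP[h1 h2] := binary_point_second_quarter e1 e2.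
rewrite /ball /= ltr_norml /dyadic/= in_itv/= => /andP[y1 y2].
have := half_expnS n; have := half_expnS n.+1; have := half_expn_gt0 n.+2; lra.
Qed.

Lemma dyadic_sub_ball n m e : e n.+1 = false -> e n.+2 = true -> (m <= n)%N ->
  dyadic n e `<=` ball (binary_point e) (2 ^+ m)^-1.
Proof.
move=> e1 e2 mn y; have /andP[h1 h2] := binary_point_second_quarter e1 e2.
rewrite /ball /= ltr_norml /dyadic/= in_itv/= => /andP[y1 y2].
have := half_expnS n; have := half_expnS n.+1; have := half_expn_gt0 n.+2.
have := ler_half_expn mn; lra.
Qed.

Lemma dyadic_overlap n e e' (y : R) : dyadic n e y -> dyadic n e' y ->
  same_digits n e e'.
Proof.
rewrite /dyadic/= !in_itv/= => /andP[a b] /andP[c d].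
by case: (dyadic_left_separated n e e') => // h; exfalso; lra.
Qed.

End BinaryDigits.

(** * A Cantor set with prescribed frequencies of digits *)

Section BlockDigits.
Implicit Types (u v : nat -> nat) (i j l : nat).

(** Block [i] consists of the digits number [block_pos i + 1] to
    [block_pos i.+1]: two separators 0 and 1, then a word of length [i].  The
    separators keep the points away from the ends of their dyadic intervals, so that
    balls and dyadic intervals of comparable sizes contain one another; as the words
    get longer, the separators do not affect the frequencies. *)
Definition block_pos i : nat := (\sum_(0 <= j < i) j.+2)%N.

Lemma block_posS i : block_pos i.+1 = (block_pos i + i.+2)%N.
Proof. by rewrite /block_pos big_nat_recr. Qed.

Lemma block_pos0 : block_pos 0 = 0%N.
Proof. by rewrite /block_pos big_geq. Qed.

Lemma block_pos_double i : (2 * block_pos i = i * (i + 3))%N.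
Proof.
elim: i => [|i IH]; first by rewrite block_pos0.
by rewrite block_posS mulnDr IH; lia.
Qed.

Lemma leq_block_pos i j : (i <= j)%N -> (block_pos i <= block_pos j)%N.
Proof.
move=> ij; rewrite -(subnKC ij); elim: (j - i)%N => [|k IH]; first by rewrite addn0.
by rewrite addnS block_posS (leq_trans IH)// leq_addr.
Qed.

Lemma leq_block_pos_self i : (i <= block_pos i)%N.
Proof. by have := block_pos_double i; nia. Qed.

Variable zeros : nat -> nat.
Hypothesis zeros_le : forall i, (zeros i <= i)%N.

Definition branching i := 'C(i, zeros i).

Lemma branching_gt0 i : (0 < branching i)%N.
Proof. by rewrite bin_gt0. Qed.

(** The choice made in block [i] is the set of the positions of the zeros of its word;
    all the words of one block have the same number of zeros. *)
Definition zero_set i c : {set 'I_i} :=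
  nth finset.set0 (enum [set A : {set 'I_i} | #|A| == zeros i]%SET) c.

Lemma size_zero_sets i :
  size (enum [set A : {set 'I_i} | #|A| == zeros i]%SET) = branching i.
Proof. by rewrite -cardE card_draws card_ord. Qed.

Lemma card_zero_set i c : (c < branching i)%N -> #|zero_set i c| = zeros i.
Proof.
rewrite -size_zero_sets => ci; apply/eqP.
by have := mem_nth finset.set0 ci; rewrite mem_enum finset.inE.
Qed.

Lemma zero_set_inj i c c' : (c < branching i)%N -> (c' < branching i)%N ->
  zero_set i c = zero_set i c' -> c = c'.
Proof.
rewrite -size_zero_sets => ci ci' /eqP.
by rewrite nth_uniq ?enum_uniq// => /eqP.
Qed.

Definition block_digit i c l : bool :=
  match l with
  | 0 | 1 => false
  | 2 => true
  | l'.+3 => if insub l' is Some a then a \notin zero_set i c else false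
  end.

Definition digits u j : bool :=
  [exists i : 'I_j, (block_pos i < j <= block_pos i.+1)%N &&
                    block_digit i (u i) (j - block_pos i)].

Lemma digitsE u i l : (0 < l <= i.+2)%N ->
  digits u (block_pos i + l) = block_digit i (u i) l.
Proof.
move=> /andP[l0 li]; have ij : (i < block_pos i + l)%N.
  by have := leq_block_pos_self i; lia.
apply/existsP/idP => [[[i' i'j] /= /andP[/andP[h1 h2]]]|bd].
  suff -> : i' = i by rewrite addKn.
  apply/eqP; rewrite eqn_leq; apply/andP; split; rewrite leqNgt; apply/negP => ii.
    have := leq_block_pos ii; rewrite block_posS; lia.
  have := leq_block_pos ii; lia.
by exists (Ordinal ij) => /=; rewrite addKn bd block_posS; lia.
Qed.

Lemma digits_separators u m :
  digits u (block_pos m).+1 = false /\ digits u (block_pos m).+2 = true.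
Proof.
have h1 := @digitsE u m 1 isT; have h2 := @digitsE u m 2 isT.
by rewrite addn1 in h1; rewrite addn2 in h2.
Qed.

Lemma digits_agree m u v : code branching u -> code branching v ->
  same_digits (block_pos m) (digits u) (digits v) -> agree m u v.
Proof.
move=> cu cv uv i im; apply: zero_set_inj => //; apply/setP => a.
have ai := ltn_ord a; have := leq_block_pos im; rewrite block_posS => h.
have l1 : (0 < (val a).+3 <= i.+2)%N by rewrite /=; lia.
have : (0 < block_pos i + (val a).+3 <= block_pos m)%N by lia.
move=> /uv; rewrite !digitsE//= valK => /negb_inj; exact.
Qed.

End BlockDigits.

Section CantorPoints.
Context {R : realType}.
Variable zeros : nat -> nat.
Implicit Types (u v : nat -> nat) (m : nat).

Local Notation N := (branching zeros).
Local Notation dig := (digits zeros).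

Definition cantor_point u : R := binary_point (dig u).

(** Balls of this radius around the points of the Cantor set see exactly the
    first [m] blocks. *)
Definition cantor_radius m : R := (2 ^+ (block_pos m).+2)^-1.

Lemma cantor_radius_gt0 m : 0 < cantor_radius m.
Proof. exact: half_expn_gt0. Qed.

Lemma cantor_ball_sub m u :
  ball (cantor_point u) (cantor_radius m) `<=` dyadic (block_pos m) (dig u).
Proof. by have [? ?] := digits_separators zeros u m; exact: ball_sub_dyadic. Qed.

Lemma sub_cantor_ball m u :
  dyadic (block_pos m.+1) (dig u) `<=` ball (cantor_point u) (cantor_radius m).
Proof.
have [? ?] := digits_separators zeros u m.+1; apply: dyadic_sub_ball => //.
by rewrite block_posS -addn2 leq_add2l.
Qed.

(** Two points closer than twice the radius share their first [m] blocks: their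
    balls meet inside the two dyadic intervals that contain them. *)
Lemma cantor_point_close m u v : code N u -> code N v ->
  `|cantor_point u - cantor_point v| < 2 * cantor_radius m -> agree m u v.
Proof.
move=> cu cv uv; apply: digits_agree => //.
pose y := (cantor_point u + cantor_point v) / 2.
have r0 := cantor_radius_gt0 m; move: uv; rewrite ltr_norml => /andP[h1 h2].
apply: (@dyadic_overlap R _ _ _ y); apply: cantor_ball_sub; rewrite /ball/= ltr_norml /y;
  apply/andP; split; lra.
Qed.

Lemma cantor_ball_disjoint m u v : code N u -> code N v ->
  ball (cantor_point u) (cantor_radius m) `&` ball (cantor_point v) (cantor_radius m) !=set0 ->
  agree m u v.
Proof.
move=> cu cv [y []]; rewrite /ball/= !ltr_norml => /andP[? ?] /andP[? ?].
by apply: cantor_point_close => //; rewrite ltr_norml; apply/andP; split; lra.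
Qed.

End CantorPoints.

(** * The measure of the dyadic intervals *)

Section Weights.
Context {R : realType} (p ph : R) (t : nat -> nat).
Implicit Types (e : nat -> bool) (n j : nat) (b : bool).
Hypotheses (p_gt0 : 0 < p) (p_lt_ph : p < ph) (ph_le : ph <= 2^-1).

(** The type of a digit is [true] in the runs of [odd_block], where 0 has weight [p], and [false]
    elsewhere. *)
Definition zero_weight b : R := if b then p else ph.

Lemma zero_weight_bounds b : p <= zero_weight b <= 2^-1.
Proof. by have [[] ] := (p_gt0, p_lt_ph, ph_le); rewrite /zero_weight; case: b; lra. Qed.

Lemma digit_weight_bounds e j : p <= digit_weight p ph t e j <= 1 - p.
Proof.
have [[] ] := (p_gt0, p_lt_ph, ph_le).
by rewrite /digit_weight; case: (e j); case: ifP => _; lra.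
Qed.

Lemma digit_weight_gt0 e j : 0 < digit_weight p ph t e j.
Proof. by have /andP[h _] := digit_weight_bounds e j; exact: lt_le_trans h. Qed.

(** The additive form of the measure: minus the logarithm of the mass of the dyadic
    interval of generation [n]. *)
Definition info n e : R := \sum_(1 <= j < n.+1) - ln (digit_weight p ph t e j).

Lemma info0 e : info 0 e = 0.
Proof. by rewrite /info big_geq. Qed.

Lemma infoS n e : info n.+1 e = info n e - ln (digit_weight p ph t e n.+1).
Proof. by rewrite /info big_nat_recr. Qed.

Lemma info_same_digits n e e' : same_digits n e e' -> info n e = info n e'.
Proof.
move=> ee; rewrite /info; apply: eq_big_nat => j /andP[j1 jn].
by rewrite /digit_weight ee// j1 -ltnS.
Qed.

Lemma prod_digit_weight n e :
  \prod_(1 <= j < n.+1) digit_weight p ph t e j = expR (- info n e).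
Proof.
elim: n => [|n IH]; first by rewrite big_geq// info0 oppr0 expR0.
rewrite big_nat_recr//= IH infoS opprB addrC expRD lnK ?posrE ?digit_weight_gt0//.
Qed.

Lemma ln_digit_weight_bounds e j : 0 <= - ln (digit_weight p ph t e j) <= - ln p.
Proof.
have /andP[h1 h2] := digit_weight_bounds e j.
rewrite lerN2 ler_ln ?posrE// ?digit_weight_gt0// h1 andbT oppr_ge0.
by apply: ln_le0; have := p_gt0; lra.
Qed.

Lemma info_increment_bounds n k e :
  0 <= info (n + k) e - info n e <= k%:R * - ln p.
Proof.
elim: k => [|k IH]; first by rewrite addn0 subrr mul0r lexx.
have /andP[h1 h2] := ln_digit_weight_bounds e (n + k).+1.
rewrite addnS infoS -natr1 mulrDl mul1r; move: IH => /andP[]; lra.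
Qed.

Context (mu : probability (measurableTypeR R) R).
Hypothesis mu_assoc : associated_measure p ph t mu.

Lemma mu_dyadic n e : mu (dyadic n e) = (expR (- info n e))%:E.
Proof. by rewrite mu_assoc prod_digit_weight. Qed.

Lemma measurable_dyadic n e : measurable (dyadic n e : set (measurableTypeR R)).
Proof. exact: measurable_itv. Qed.

Lemma ln_mu_ball_le n e x r :
  ball x r `<=` dyadic n e -> 0 < fine (mu (ball x r)) ->
  info n e <= - ln (fine (mu (ball x r))).
Proof.
move=> sub m0; rewrite lerNr -[leRHS]expRK ler_ln ?posrE ?expR_gt0//.
rewrite -lee_fin -mu_ballE -mu_dyadic; apply: le_measure => //; rewrite inE.
  by rewrite ball_itv; exact: measurable_itv.
exact: measurable_dyadic.
Qed.

Lemma ln_mu_ball_ge n e x r : dyadic n e `<=` ball x r ->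
  0 < fine (mu (ball x r)) /\ - ln (fine (mu (ball x r))) <= info n e.
Proof.
move=> sub; have h : expR (- info n e) <= fine (mu (ball x r)).
  rewrite -lee_fin -mu_ballE -mu_dyadic; apply: le_measure => //; rewrite inE.
    exact: measurable_dyadic.
  by rewrite ball_itv; exact: measurable_itv.
have m0 := lt_le_trans (expR_gt0 _) h; split => //.
by rewrite lerNl -[leLHS]expRK ler_ln ?posrE ?expR_gt0.
Qed.

Variable zeros : nat -> nat.
Implicit Type u : nat -> nat.

Local Notation N := (branching zeros).
Local Notation dig := (digits zeros).
Local Notation cantor_point := (@cantor_point R zeros).
Local Notation cantor_radius := (@cantor_radius R).

Lemma cantor_ball_mu m u : 0 < fine (mu (ball (cantor_point u) (cantor_radius m))) /\
  info (block_pos m) (dig u) <= - ln (fine (mu (ball (cantor_point u) (cantor_radius m))))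
    <= info (block_pos m.+1) (dig u).
Proof.
have [m0 h] := ln_mu_ball_ge (@sub_cantor_ball R zeros m u); split => //.
by rewrite h andbT; apply: ln_mu_ball_le => //; exact: cantor_ball_sub.
Qed.

Lemma cantor_point_supp u : supp mu (cantor_point u).
Proof.
move=> U oU Ux; have := open_nbhs_nbhs (conj oU Ux).
move=> /nbhs_ballP[d /= d0 dU]; have [n nd] := exists_half_expn_lt d0.
have sub : ball (cantor_point u) (cantor_radius n) `<=` U.
  apply: subset_trans dU; apply: le_ball; apply: le_trans (ltW nd).
  by apply: ler_half_expn; have := leq_block_pos_self n; lia.
have [m0 _] := cantor_ball_mu n u.
apply: (@lt_le_trans _ _ (mu (ball (cantor_point u) (cantor_radius n)))).
  by rewrite mu_ballE lte_fin.
apply: le_measure => //; rewrite inE; last exact: open_measurable.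
by rewrite ball_itv; exact: measurable_itv.
Qed.

Hypothesis zeros_le : forall i, (zeros i <= i)%N.

(** The successors count the two separators. *)
Definition block_info b i : R :=
  - ((zeros i).+1)%:R * ln (zero_weight b) -
  ((i - zeros i).+1)%:R * ln (1 - zero_weight b).

Definition run_in b i := forall j, (block_pos i < j <= block_pos i.+1)%N ->
  `[< odd_block t j >] = b.

Lemma info_block b i u : code N u -> run_in b i ->
  info (block_pos i.+1) (dig u) - info (block_pos i) (dig u) = block_info b i.
Proof.
move=> cu ib.
have dw l : (0 < l <= i.+2)%N -> digit_weight p ph t (dig u) (block_pos i + l) =
    if block_digit zeros i (u i) l then 1 - zero_weight b else zero_weight b.
  move=> li; rewrite /digit_weight digitsE// ib//.
  by rewrite block_posS; lia.
have telescope n : info (block_pos i + n)%N (dig u) - info (block_pos i) (dig u) =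
    \sum_(0 <= l < n) - ln (digit_weight p ph t (dig u) (block_pos i + l.+1)).
  elim: n => [|n IH]; first by rewrite addn0 subrr big_geq.
  by rewrite addnS infoS big_nat_recr//= -IH addnS; ring.
rewrite block_posS telescope big_nat_recl// big_nat_recl// !dw//=.
rewrite (@eq_big_nat _ _ _ _ _ _ (fun l => - ln (if block_digit zeros i (u i) l.+3
   then 1 - zero_weight b else zero_weight b))); last first.
  by move=> l /andP[_ li]; rewrite dw//; lia.
rewrite big_mkord (eq_bigr (fun a : 'I_i => if a \in zero_set zeros i (u i)
    then - ln (zero_weight b) else - ln (1 - zero_weight b))); last first.
  by move=> a _ /=; rewrite valK; case: (a \in _).
rewrite (bigID (fun a => a \in zero_set zeros i (u i)))/=.
rewrite (eq_bigr (fun=> - ln (zero_weight b))); last by move=> a ->.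
rewrite [X in _ + (_ + (_ + X))](eq_bigr (fun=> - ln (1 - zero_weight b))); last first.
  by move=> a /negbTE ->.
rewrite !sumr_const card_zero_set//.
have -> : #|[pred a | a \notin zero_set zeros i (u i)]| = (i - zeros i)%N.
  have <- : #|finset.setC (zero_set zeros i (u i))| = (i - zeros i)%N.
    by rewrite cardsCs finset.setCK card_ord card_zero_set.
  by apply: eq_card => a; rewrite !finset.inE.
rewrite /block_info -(natr1 (zeros i)) -(natr1 (i - zeros i)).
rewrite -(mulr_natl _ (zeros i)) -(mulr_natl _ (i - zeros i)); ring.
Qed.

Lemma block_info_bounds i u :
  0 <= info (block_pos i.+1) (dig u) - info (block_pos i) (dig u) <= i.+2%:R * - ln p.
Proof. by rewrite block_posS info_increment_bounds. Qed.

End Weights.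

(** * Asymptotic counting along the runs *)

Section Binomial.
Context {R : realType} (f : R) (n : nat).
Hypothesis f01 : 0 < f < 1.

Let B k : R := 'C(n, k)%:R * f ^+ k * (1 - f) ^+ (n - k).

Lemma binomial_mode_step k : (k < n)%N ->
  B k.+1 * (k.+1%:R * (1 - f)) = B k * ((n - k)%:R * f).
Proof.
move=> kn; have : (k.+1%:R * 'C(n, k.+1)%:R = (n - k)%:R * 'C(n, k)%:R :> R).
  by rewrite -!natrM mul_bin_left.
rewrite /B exprS (_ : n - k = (n - k.+1).+1)%N; last by lia.
rewrite [(1 - f) ^+ (_.+1)]exprS => h.
transitivity ((k.+1%:R * 'C(n, k.+1)%:R) * (f * f ^+ k * (1 - f) ^+ (n - k.+1) * (1 - f))).
  by ring.
by rewrite h; ring.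
Qed.

(** The largest of the [n.+1] weights of the binomial law of parameter [f] is at
    least their average. *)
Lemma binomial_mode_ge : (n.+1%:R)^-1 <=
  'C(n, Num.truncn (n.+1%:R * f))%:R * f ^+ Num.truncn (n.+1%:R * f) *
  (1 - f) ^+ (n - Num.truncn (n.+1%:R * f)).
Proof.
have /andP[f0 f1] := f01; have f1' : 0 < 1 - f by rewrite subr_gt0.
have B0 k : 0 <= B k by rewrite !mulr_ge0 ?exprn_ge0// ltW.
have n10 : 0 <= n.+1%:R * f by rewrite mulr_ge0// ltW.
have /andP[k1 k2] := truncn_itv n10; set k0 := Num.truncn _ in k1 k2 *.
have k0n : (k0 <= n)%N.
  rewrite -ltnS -(ltr_nat R); apply: le_lt_trans k1 _.
  by rewrite -[ltRHS]mulr1 ltr_pM2l.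
have up k : (k < k0)%N -> B k <= B k.+1.
  move=> kk; have kn := leq_trans kk k0n.
  have c0 : 0 < k.+1%:R * (1 - f) by rewrite mulr_gt0.
  rewrite -(ler_pM2r c0) binomial_mode_step// ler_wpM2l//.
  have : k.+1%:R <= n.+1%:R * f :> R by apply: le_trans k1; rewrite ler_nat.
  rewrite natrB ?(ltnW kn)// -!natr1; lra.
have down k : (k0 <= k)%N -> (k < n)%N -> B k.+1 <= B k.
  move=> kk kn; have c0 : 0 < k.+1%:R * (1 - f) by rewrite mulr_gt0.
  rewrite -(ler_pM2r c0) binomial_mode_step// ler_wpM2l//.
  have : n.+1%:R * f <= k.+1%:R :> R by apply: le_trans (ltW k2) _; rewrite ler_nat.
  rewrite natrB ?(ltnW kn)// -!natr1; lra.
have max k : (k <= n)%N -> B k <= B k0.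
  move=> kn; have [kk|kk] := leqP k k0.
    have : forall d, (k + d <= k0)%N -> B k <= B (k + d)%N.
      elim=> [|d IH]; first by rewrite addn0.
      by rewrite addnS => h; apply: le_trans (up _ h); apply: IH; exact: ltnW.
    by move=> /(_ (k0 - k)%N); rewrite subnKC//; exact.
  have : forall d, (k0 + d <= n)%N -> B (k0 + d)%N <= B k0.
    elim=> [|d IH]; first by rewrite addn0.
    rewrite addnS => h; apply: le_trans (down _ _ h) _; first exact: leq_addr.
    by apply: IH; exact: ltnW.
  by move=> /(_ (k - k0)%N); rewrite subnKC ?(ltnW kk)//; exact.
have : \sum_(k < n.+1) B k = 1.
  transitivity ((1 - f + f) ^+ n); last by rewrite subrK expr1n.
  rewrite exprDn; apply: eq_bigr => k _; rewrite -mulr_natl /B; ring.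
move=> S1; rewrite -[leLHS]mul1r ler_pdivrMr// -[leLHS]S1.
apply: (@le_trans _ _ (\sum_(k < n.+1) B k0)).
  by apply: ler_sum => k _; apply: max; rewrite -ltnS.
by rewrite sumr_const card_ord -[leLHS]mulr_natr.
Qed.

Lemma ln_binomial_mode_ge (k := Num.truncn (n.+1%:R * f)) :
  - k%:R * ln f - (n - k)%:R * ln (1 - f) - ln n.+1%:R <= ln 'C(n, k)%:R.
Proof.
have /andP[f0 f1] := f01; have f1' : 0 < 1 - f by rewrite subr_gt0.
have n0 : 0 < (n.+1%:R : R)^-1 by rewrite invr_gt0.
have h := binomial_mode_ge; have h0 := lt_le_trans n0 h.
have C0 : 0 < 'C(n, k)%:R :> R.
  move: h0; rewrite -/k pmulr_lgt0 ?exprn_gt0// pmulr_lgt0 ?exprn_gt0//.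
move: h; rewrite -/k -ler_ln ?posrE//.
rewrite lnM ?posrE ?mulr_gt0 ?exprn_gt0// lnM ?posrE ?exprn_gt0// lnV ?posrE//.
rewrite !lnXn// -(mulr_natl (ln f)) -(mulr_natl (ln (1 - f))); lra.
Qed.

End Binomial.

Section BlockGrowth.
Context {R : realType}.
Implicit Types (i m : nat) (eps C : R).

Lemma bracket (g : nat -> nat) j : (forall n, (g n < g n.+1)%N) -> (g 0 <= j)%N ->
  exists K, (g K <= j < g K.+1)%N.
Proof.
move=> gl; elim: j => [|j IH] g0; first by exists 0%N; have := gl 0%N; lia.
move: g0; rewrite leq_eqVlt => /predU1P[g0|g0].
  by exists 0%N; rewrite -g0 leqnn /=.
have [K /andP[K1 K2]] := IH g0; have [h|h] := ltnP j.+1 (g K.+1).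
  by exists K; rewrite h andbT; lia.
by exists K.+1; rewrite h /=; have := gl K.+1; lia.
Qed.

Lemma linear_o_block_pos C eps : 0 < eps ->
  exists m0, forall m, (m0 <= m)%N -> C * m.+2%:R <= eps * (block_pos m)%:R.
Proof.
move=> e0; have [C0|C0] := leP C 0.
  exists 0%N => m _; apply: (@le_trans _ _ 0); last by rewrite mulr_ge0// ltW.
  by rewrite mulr_le0_ge0.
exists (Num.bound (2 * C / eps)) => m mm.
have : 2 * C / eps <= m%:R.
  by apply: (@le_trans _ _ (Num.bound (2 * C / eps))%:R);
    [apply: ltW; apply: archi_boundP; rewrite divr_ge0 ?mulr_ge0// ltW|rewrite ler_nat].
rewrite ler_pdivrMr// => h.
have := block_pos_double m => /(congr1 (fun k => k%:R : R)); rewrite !natrM natrD => P2.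
have m0 : 0 <= m%:R :> R by [].
rewrite -addn2 natrD.
have : C * (m%:R + 2) * 2 <= m%:R * eps * (m%:R + 3).
  rewrite (_ : C * (m%:R + 2) * 2 = 2 * C * (m%:R + 2)); last by ring.
  apply: ler_pM => //; first by rewrite mulr_ge0// ltW.
  by rewrite lerD2l ler_nat.
have -> : m%:R * eps * (m%:R + 3) = eps * (m%:R * (m%:R + 3)) by ring.
rewrite -P2; lra.
Qed.

Lemma sum_block_length m : \sum_(0 <= i < m) i.+2%:R = (block_pos m)%:R :> R.
Proof. by rewrite /block_pos natr_sum. Qed.

Lemma ln_small eps : 0 < eps -> exists C, forall i, ln i.+1%:R <= eps * i.+2%:R + C.
Proof.
move=> e0; exists (- ln eps) => i; have i0 : 0 < i.+1%:R :> R by rewrite ltr0n.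
have := @ln_sublinear R (eps * i.+1%:R) (mulr_gt0 e0 i0).
rewrite lnM ?posrE// -[i.+2%:R]natr1 => h.
suff : eps * i.+1%:R <= eps * (i.+1%:R + 1) by lra.
by rewrite ler_pM2l// lerDl.
Qed.

Lemma leq_square_block_pos m : (1 < m)%N -> (m.+2 ^ 2 <= 4 * block_pos m)%N.
Proof.
have -> : (4 * block_pos m = 2 * (m * (m + 3)))%N by rewrite -block_pos_double mulnA.
by rewrite -mulnn; case: m => [|[|k]]// _; nia.
Qed.

End BlockGrowth.

Section Runs.
Context {R : realType} (t : nat -> nat).
Hypotheses (t0 : t 0%N = 1%N) (t_lt : forall n, (t n < t n.+1)%N).
Implicit Types (i j K m : nat) (eps C : R).

Lemma leq_run K K' : (K <= K')%N -> (t K <= t K')%N.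
Proof.
move=> KK; rewrite -(subnKC KK); elim: (K' - K)%N => [|k IH]; first by rewrite addn0.
by rewrite addnS; apply: leq_trans IH (ltnW (t_lt _)).
Qed.

Lemma run_gt_self K : (K < t K)%N.
Proof. by elim: K => [|K IH]; rewrite ?t0//; exact: leq_ltn_trans IH (t_lt _). Qed.

Lemma odd_block_run j K : (t K <= j < t K.+1)%N -> `[< odd_block t j >] = odd K.
Proof.
move=> /andP[Kj jK]; apply/asboolP/idP => [[k /andP[k1 k2]]|oK].
  have : (k.*2.+1 < K.+1)%N.
    by rewrite ltnNge; apply/negP => /leq_run; lia.
  have : (K < k.*2.+2)%N by rewrite ltnNge; apply/negP => /leq_run; lia.
  move=> h1 h2; have -> : K = k.*2.+1 by lia.
  by rewrite /= odd_double.
have KE : K = (K./2).*2.+1 by rewrite -[LHS]odd_double_half oK.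
by exists K./2; rewrite -KE Kj.
Qed.

(** Whole blocks are counted, so that this may exceed [t K], by less than one block. *)
Definition early_length K m : R :=
  \sum_(0 <= i < m) (if ((block_pos i).+1 < t K)%N then i.+2%:R else 0).

Lemma early_length_le K m : early_length K m <= (t K)%:R + m.+2%:R.
Proof.
have : early_length K m <= (block_pos m)%:R /\ early_length K m <= (t K)%:R + m.+1%:R.
  rewrite /early_length; elim: m => [|m [IH1 IH2]]; first by rewrite big_geq.
  rewrite big_nat_recr//= block_posS natrD; case: ifPn => [h|h].
    split; first by rewrite lerD2r.
    by rewrite lerD// (le_trans IH1)// ler_nat; lia.
  rewrite addr0; split; first by rewrite (le_trans IH1)// lerDl.
  by rewrite (le_trans IH2)// lerD2l ler_nat.
by move=> [_ /le_trans]; apply; rewrite lerD2l ler_nat.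
Qed.

Definition block_type i := `[< odd_block t (block_pos i).+1 >].

(** A block that straddles two runs has digits of both types, and nothing is known about
    their frequencies. *)
Definition mixed_length m : R :=
  \sum_(0 <= i < m) (if `[< run_in t (block_type i) i >] then 0 else i.+2%:R).

Definition mixed_count m : nat :=
  \sum_(0 <= i < m) ~~ `[< run_in t (block_type i) i >].

Lemma mixed_length_le m : mixed_length m <= (mixed_count m)%:R * m.+2%:R.
Proof.
rewrite /mixed_count natr_sum mulr_suml; apply: ler_sum_nat => i /andP[_ im].
case: asboolP => _ /=; first by rewrite mul0r.
by rewrite mul1r ler_nat; lia.
Qed.

Lemma mixed_straddles i : ~ run_in t (block_type i) i ->
  exists K, ((block_pos i).+1 < t K <= block_pos i.+1)%N.
Proof.
move=> ni; have [|K /andP[K1 K2]] := @bracket t (block_pos i).+1 t_lt; first by rewrite t0.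
exists K.+1; rewrite K2 leqNgt; apply/negP => h; apply: ni => j /andP[j1 j2].
rewrite /block_type (@odd_block_run j K) ?(@odd_block_run _ K) ?K1 ?K2//.
by apply/andP; split; lia.
Qed.

(** Each straddling block contains the start of a run, so there are few of them. *)
Lemma mixed_count_le m : mixed_count m = 0%N \/
  exists K, (mixed_count m <= K.+1)%N /\ (t K <= block_pos m)%N.
Proof.
rewrite /mixed_count; elim: m => [|m IH]; first by left; rewrite big_geq.
rewrite big_nat_recr//=; case: asboolP => [_|/mixed_straddles[K /andP[K1 K2]]].
  rewrite addn0; case: IH => [->|[K [K1 K2]]]; first by left.
  by right; exists K; split => //; rewrite block_posS; lia.
right; exists K; split => //; case: IH => [->//|[K' [h1 h2]]].
suff : (K' < K)%N by move=> /= h; lia.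
by rewrite ltnNge; apply/negP => /leq_run; lia.
Qed.

Hypothesis t_lim : ((t n.+1)%:R / (t n)%:R : R) @[n --> \oo] --> +oo.

Lemma run_growth B : exists K0, forall K, (K0 <= K)%N -> (B * t K <= t K.+1)%N.
Proof.
have /cvgryPge/(_ B%:R)[K0 _ H] := t_lim; exists K0 => K /H /=.
have tK : (0 < t K)%N by apply: leq_ltn_trans (run_gt_self K).
by rewrite ler_pdivlMr ?ltr0n// -natrM ler_nat.
Qed.

(** The number of runs that have started before a digit [j] is eventually less than any
    given multiple of the square root of [j], which is the order of the length of a block. *)
Lemma run_gt_square B : exists c, forall K, (B * K.+1 ^ 2 <= t K + c)%N.
Proof.
have [K0 H] := run_growth (3 * B).+1; exists (B * K0.+1 ^ 2)%N => K.
have [KK|KK] := leqP K K0.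
  by rewrite (leq_trans _ (leq_addl _ _))// leq_mul2l leq_exp2r// ltnS KK orbT.
rewrite -(subnKC (ltnW KK)); elim: (K - K0)%N => [|k IH].
  by rewrite addn0 leq_addl.
rewrite addnS; have := H (K0 + k)%N (leq_addr _ _); have := run_gt_self (K0 + k).
move: IH; set n := (K0 + k)%N; rewrite !expnS !expn0 !muln1; nia.
Qed.

(** The quotients of successive times tend to infinity, so that the digits written
    before a late run are a negligible part of the digits written at its end. *)
Lemma late_run b C eps m1 : 0 <= C -> 0 < eps -> exists m K,
  [/\ (m1 <= m)%N,
      forall i, (i < m)%N -> (t K <= (block_pos i).+1)%N -> run_in t b i &
      C * m.+2%:R + C * early_length K m <= eps * (block_pos m)%:R].
Proof.
move=> C0 e0; pose B := (Num.bound (2 * C / eps)).+1.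
have BC : 2 * C <= B%:R * eps.
  rewrite -ler_pdivrMr// ltW// (lt_le_trans (archi_boundP _))//; last by rewrite ler_nat.
  by rewrite divr_ge0 ?mulr_ge0// ltW.
have e20 : 0 < eps / 2 by rewrite divr_gt0.
have [K0 KB] := run_growth B; have [m0 small] := linear_o_block_pos (3 * C + eps) e20.
pose K := ((K0 + block_pos (m0 + m1)).*2 + b)%N.
have bK : odd K = b by rewrite /K oddD odd_double; case: b {K}.
have KK0 : (K0 + block_pos (m0 + m1) <= K)%N by rewrite /K -addnn; lia.
clearbody K; have T0 : (0 < t K.+1)%N by exact: leq_ltn_trans (run_gt_self _).
have pos_lt n : (block_pos n < block_pos n.+1)%N by rewrite block_posS; lia.
have pos_le : (block_pos 0 <= (t K.+1).-1)%N by rewrite block_pos0.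
have [m /andP[m2 m3]] := bracket pos_lt pos_le.
have mm : (m0 + m1 <= m)%N.
  rewrite leqNgt; apply/negP => /leq_block_pos h; have := run_gt_self K.+1.
  by lia.
exists m, K; split; first by lia.
  move=> i im Ki j /andP[j1 j2]; rewrite -bK; apply: odd_block_run.
  by have := leq_block_pos im; lia.
have := early_length_le K m; have : (B * t K <= block_pos m + m.+2)%N.
  by rewrite (leq_trans (KB _ _))//; [lia|rewrite -block_posS; lia].
rewrite -(ler_nat R) natrM natrD => h1 h2.
have := small m (leq_trans (leq_addr _ _) mm).
have B1 : 1 <= B%:R :> R by rewrite ler1n.
have h3 : C * early_length K m <= C * ((t K)%:R + m.+2%:R) by rewrite ler_wpM2l.
have h4 : 2 * C * (t K)%:R <= B%:R * eps * (t K)%:R by rewrite ler_wpM2r.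
have h5 : eps * (B%:R * (t K)%:R) <= eps * ((block_pos m)%:R + m.+2%:R) by rewrite ler_pM2l.
have h6 : 0 <= C * m.+2%:R by rewrite mulr_ge0.
have h7 : 0 <= eps * m.+2%:R by rewrite mulr_ge0// ltW.
lra.
Qed.

(** Among the first [m] blocks at most [n] are mixed, where [n^2] is small compared with
    [block_pos m], and each has length at most of order [m], where [m^2] is of the order
    of [block_pos m]: the product [n * m] is negligible. *)
Lemma mixed_negligible C eps : 0 <= C -> 0 < eps -> exists m0, forall m, (m0 <= m)%N ->
  C * m.+2%:R + C * mixed_length m <= eps * (block_pos m)%:R.
Proof.
move=> C0 e0; pose d := eps / (8 * (C + 1)).
have C1 : 0 < C + 1 by rewrite ltr_wpDl.
have d0 : 0 < d by rewrite divr_gt0// mulr_gt0.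
have Cd : C * d <= eps / 8.
  rewrite /d invfM !mulrA ler_pdivrMr// (mulrC C) -!mulrA ler_pM2l//.
  by lra.
pose B := Num.bound (C / (2 * d * (eps / 4))).
have e40 : 0 < eps / 4 by rewrite divr_gt0.
have g0 : 0 < 2 * d * (eps / 4) by rewrite (mulr_gt0 _ e40)// mulr_gt0.
have BC : C <= 2 * d * (eps / 4) * B%:R.
  have Cg : 0 <= C / (2 * d * (eps / 4)) by rewrite divr_ge0// ltW.
  by have /ltW := archi_boundP Cg; rewrite -/B ler_pdivrMr// mulrC.
have [c cP] := run_gt_square B.
have [m0 small] := linear_o_block_pos (C + eps * c%:R) e40.
exists (maxn 2 m0) => m; rewrite geq_max => /andP[m2 mm].
have {mm} := small _ mm; set L : R := m.+2%:R; set P : R := (block_pos m)%:R => smallm.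
have L1 : 1 <= L by rewrite ler1n.
have ec0 : 0 <= eps * c%:R by rewrite mulr_ge0// ltW.
have ec : eps * c%:R <= eps * c%:R * L by rewrite ler_peMr.
have LP : L ^+ 2 <= 4 * P.
  by rewrite /L /P -natrX -natrM ler_nat leq_square_block_pos.
have P0 : 0 <= P by [].
have epsP : 0 <= eps * P by rewrite mulr_ge0// ltW.
have := mixed_length_le m; set n : R := (mixed_count m)%:R => lenm.
have n0 : 0 <= n by [].
have : C * mixed_length m <= C * (n * L) by rewrite ler_wpM2l.
suff : C * (n * L) <= eps / 4 * (P + c%:R) + eps / 4 * P by lra.
have Bn : B%:R * n ^+ 2 <= P + c%:R.
  rewrite /n -natrX -natrM -natrD ler_nat.
  have [->|[K [K1 K2]]] := mixed_count_le m; first by rewrite exp0n// muln0.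
  apply: leq_trans (leq_trans (cP K) _); last by rewrite leq_add2r.
  by rewrite leq_mul2l leq_exp2r// K1 orbT.
have amgm : 2 * d * (n * L) <= n ^+ 2 + d ^+ 2 * L ^+ 2.
  by have := sqr_ge0 (n - d * L); rewrite !expr2; lra.
have d20 : 0 < 2 * d by rewrite mulr_gt0.
rewrite -(ler_pM2l d20) mulrCA.
have h1 : C * (2 * d * (n * L)) <= C * (n ^+ 2 + d ^+ 2 * L ^+ 2) by rewrite ler_wpM2l.
have h2 : C * n ^+ 2 <= 2 * d * (eps / 4) * B%:R * n ^+ 2 by rewrite ler_wpM2r// sqr_ge0.
have h3 : 2 * d * (eps / 4) * (B%:R * n ^+ 2) <= 2 * d * (eps / 4) * (P + c%:R).
  by rewrite ler_pM2l// mulr_gt0.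
have h4 : C * d * (d * L ^+ 2) <= eps / 8 * (d * L ^+ 2).
  by rewrite ler_wpM2r// mulr_ge0 ?sqr_ge0// ltW.
have h5 : eps / 8 * d * L ^+ 2 <= eps / 8 * d * (4 * P).
  by rewrite ler_wpM2l// mulr_ge0 ?ltW// divr_gt0.
move: h1 h2 h3 h4 h5; rewrite !expr2; lra.
Qed.

End Runs.

Section Entropy.
Context {R : realType}.

Definition entropy (x : R) : R := - x * ln x - (1 - x) * ln (1 - x).

(** The mean information of a digit which is 0 with frequency [x], for the weights
    [a] and [1 - a]. *)
Definition cross_entropy (x a : R) : R := - x * ln a - (1 - x) * ln (1 - a).

Lemma entropy_gt0 x : 0 < x < 1 -> 0 < entropy x.
Proof.
move=> /andP[x0 x1]; have lx : ln x < 0 by rewrite ln_lt0// x0.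
have ly : ln (1 - x) < 0 by rewrite ln_lt0// subr_gt0 x1 gtrBl.
rewrite /entropy !mulNr -[X in _ - X]opprK -!mulrN opprK.
by rewrite addr_gt0// mulr_gt0// ?oppr_gt0// subr_gt0.
Qed.

End Entropy.

Section CantorAsymptotics.
Context {R : realType} (p ph : R) (t : nat -> nat).
Hypotheses (p_gt0 : 0 < p) (p_lt_ph : p < ph) (ph_le : ph <= 2^-1).
Hypotheses (t0 : t 0%N = 1%N) (t_lt : forall n, (t n < t n.+1)%N).
Hypothesis t_lim : ((t n.+1)%:R / (t n)%:R : R) @[n --> \oo] --> +oo.
Variable f : bool -> R.
Hypothesis f01 : forall b, 0 < f b < 1.
Implicit Types (i m : nat) (b : bool) (u : nat -> nat) (eps : R).

(** The number of zeros written in the word of block [i]: the mode of the binomial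
    law of parameter [f b], where [b] is the type of the run. *)
Definition frequency_zeros i : nat := Num.truncn (i.+1%:R * f (block_type t i)).

Local Notation zeros := frequency_zeros.
Local Notation N := (branching frequency_zeros).
Local Notation dig := (digits frequency_zeros).
Local Notation A b := (cross_entropy (f b) (zero_weight p ph b)).
Local Notation H b := (entropy (f b)).
Local Notation Lp := (- ln p).

Lemma frequency_zeros_bounds i : let x := i.+1%:R * f (block_type t i) in
  (zeros i)%:R <= x < (zeros i).+1%:R.
Proof. by have /andP[f0 _] := f01 (block_type t i); rewrite /= truncn_itv// mulr_ge0// ltW. Qed.

Lemma frequency_zeros_le i : (zeros i <= i)%N.
Proof.
have /andP[h _] := frequency_zeros_bounds i; have /andP[_ f1] := f01 (block_type t i).
by rewrite -ltnS -(ltr_nat R); apply: le_lt_trans h _; rewrite -[ltRHS]mulr1 ltr_pM2l.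
Qed.

Lemma max_information_gt0 : 0 < Lp.
Proof.
have p1 : p < 1 by have := p_lt_ph; have := ph_le; lra.
by rewrite oppr_gt0 ln_lt0// p_gt0 p1.
Qed.

Lemma block_info_dev i (b := block_type t i) :
  `|block_info p ph zeros b i - i.+2%:R * A b| <= Lp.
Proof.
have /andP[k1 k2] := frequency_zeros_bounds i; have ki := frequency_zeros_le i.
have /andP[f0 f1] := f01 (block_type t i).
have /andP[a1 a2] := zero_weight_bounds p_gt0 p_lt_ph ph_le b.
set a := zero_weight _ _ _ in a1 a2; have a0 : 0 < a := lt_le_trans p_gt0 a1.
pose d := (zeros i).+1%:R - i.+2%:R * f b.
have -> : block_info p ph zeros b i - i.+2%:R * A b = d * (ln (1 - a) - ln a).
  rewrite /block_info /cross_entropy -/a /d -[(i - _).+1%:R]natr1 natrB//.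
  rewrite -[(zeros i).+1%:R]natr1 -[i.+2%:R]natr1 -[i.+1%:R]natr1; ring.
have d1 : `|d| <= 1.
  move: k1 k2; rewrite ler_norml /d -/b -[i.+2%:R]natr1 -[(zeros i).+1%:R]natr1.
  by move: f0 f1; rewrite -/b; lra.
have la : ln a <= ln (1 - a) by rewrite ler_ln ?posrE//; lra.
rewrite normrM (ger0_norm (_ : 0 <= ln (1 - a) - ln a)) ?subr_ge0//.
have lp : ln p <= ln a by rewrite ler_ln ?posrE.
have l1 : ln (1 - a) <= 0 by apply: ln_le0; lra.
apply: (@le_trans _ _ (1 * (ln (1 - a) - ln a))); last by lra.
by rewrite ler_wpM2r// subr_ge0.
Qed.

Lemma run_in_type b i : run_in t b i -> block_type t i = b.
Proof. by move=> ib; apply: ib; rewrite block_posS; lia. Qed.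

Definition block_deviation (a : R) u i : R :=
  info p ph t (block_pos i.+1) (dig u) - info p ph t (block_pos i) (dig u) - i.+2%:R * a.

Lemma info_sum a u m : info p ph t (block_pos m) (dig u) - a * (block_pos m)%:R =
  \sum_(0 <= i < m) block_deviation a u i.
Proof.
elim: m => [|m IH]; first by rewrite big_geq// block_pos0 info0 mulr0 subr0.
by rewrite big_nat_recr//= -IH /block_deviation block_posS natrD; ring.
Qed.

Lemma block_deviation_run b u i : code N u -> run_in t b i ->
  `|block_deviation (A b) u i| <= Lp.
Proof.
move=> cu ib; have zl := frequency_zeros_le.
rewrite /block_deviation (info_block _ _ _ cu ib)//.
by have := block_info_dev i; rewrite (run_in_type ib).
Qed.

Lemma block_deviation_any a u i : `|block_deviation a u i| <= i.+2%:R * (Lp + `|a|).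
Proof.
have /andP[h1 h2] := block_info_bounds t p_gt0 p_lt_ph ph_le zeros i u.
rewrite mulrDr (le_trans (ler_normB _ _))// lerD// ?(ger0_norm h1)//.
by rewrite normrM ger0_norm.
Qed.

Lemma branching_freq_gt0 i : (0 < N i)%N.
Proof. by apply: branching_gt0 => j; exact: frequency_zeros_le. Qed.

Definition word_loss : R := - 2 * (ln (f true) + ln (1 - f true) + ln (f false) + ln (1 - f false)).

(** The word of block [i] realises the frequency [f b] up to one digit, so that the number
    of choices is, up to a polynomial factor, the exponential of [i] times the entropy. *)
Lemma ln_branching_ge i :
  i.+2%:R * H (block_type t i) - word_loss - ln i.+1%:R <= ln (N i)%:R.
Proof.
have := ln_binomial_mode_ge i (f01 (block_type t i)); rewrite -/(zeros i).
move=> /= /(le_trans _); apply.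
have /andP[k1 k2] := frequency_zeros_bounds i; have ki := frequency_zeros_le i.
have lf b : ln (f b) <= 0 /\ ln (1 - f b) <= 0.
  by have /andP[? ?] := f01 b; split; apply: ln_le0; lra.
have /andP[f0 f1] := f01 (block_type t i).
set b := block_type t i in k1 k2 f0 f1 *.
have [l1 l2] := lf b.
have h1 : 0 <= ((zeros i)%:R - (i.+2%:R * f b - 2)) * - ln (f b).
  rewrite mulr_ge0 ?oppr_ge0//; move: k1 k2.
  by rewrite -/b -[i.+2%:R]natr1 -[(zeros i).+1%:R]natr1; lra.
have h2 : 0 <= ((i - zeros i)%:R - (i.+2%:R * (1 - f b) - 2)) * - ln (1 - f b).
  rewrite mulr_ge0 ?oppr_ge0// natrB//; move: k1 k2.
  by rewrite -/b -[i.+2%:R]natr1 -[(zeros i).+1%:R]natr1 -[i.+1%:R]natr1; lra.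
have c1b : - 2 * (ln (f b) + ln (1 - f b)) <= word_loss.
  by have [? ?] := lf true; have [? ?] := lf false; rewrite /word_loss; case: (b); lra.
move: h1 h2; rewrite /entropy; lra.
Qed.

Lemma ln_node_count m : ln (node_count N m)%:R = \sum_(0 <= i < m) ln (N i)%:R :> R.
Proof.
elim: m => [|m IH]; first by rewrite big_geq// /node_count big_geq// ln1.
rewrite node_countS natrM lnM ?posrE ?ltr0n ?branching_freq_gt0//.
  by rewrite big_nat_recr//= IH.
by apply: node_count_gt0; exact: branching_freq_gt0.
Qed.

Local Notation hmin := (Num.min (H true) (H false)).

Lemma min_entropy_gt0 : 0 < hmin.
Proof. by rewrite lt_min !entropy_gt0. Qed.

Lemma ln_node_count_lower eps : 0 < eps -> exists m0, forall m, (m0 <= m)%N ->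
  (hmin - eps) * (block_pos m.+1)%:R <= ln (node_count N m)%:R.
Proof.
move=> e0; have e20 : 0 < eps / 2 by rewrite divr_gt0.
have [C0 lnC] := ln_small e20; pose C : R := `|word_loss + C0|; have C_ge0 : 0 <= C by exact: normr_ge0.
have [m0 small] := linear_o_block_pos (C + hmin) e20.
exists m0 => m /small sm; rewrite ln_node_count.
have : \sum_(0 <= i < m) ((hmin - eps / 2) * i.+2%:R - C) <= \sum_(0 <= i < m) ln (N i)%:R :> R.
  apply: ler_sum => i _; apply: le_trans (ln_branching_ge i).
  have hb : hmin <= H (block_type t i).
    by rewrite ge_min; case: (block_type t i); rewrite lexx ?orbT.
  have : hmin * i.+2%:R <= H (block_type t i) * i.+2%:R by rewrite ler_wpM2r.
  have := lnC i; have := ler_norm (word_loss + C0); rewrite -/C; lra.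
move=> /(le_trans _); apply.
rewrite sumrB -mulr_sumr sum_block_length sumr_const_nat subn0 -(mulr_natr C).
have Cm : C * m%:R <= C * m.+2%:R by rewrite ler_wpM2l ?normr_ge0// ler_nat -addn2 leq_addr.
have := min_entropy_gt0 => h0; have em : 0 <= eps * m.+2%:R by rewrite mulr_ge0// ltW.
rewrite block_posS natrD; lra.
Qed.

(** At the ends of the late runs of type [b] the counting and the information are those of
    a Cantor set all of whose digits have type [b]. *)
Lemma late_run_estimates b eps m1 : 0 < eps -> exists m, [/\ (m1 <= m)%N,
  (H b - eps) * (block_pos m)%:R <= ln (node_count N m)%:R &
  forall u, code N u ->
    `|info p ph t (block_pos m) (dig u) - A b * (block_pos m)%:R| <= eps * (block_pos m)%:R].
Proof.
move=> e0; have e20 : 0 < eps / 2 by rewrite divr_gt0.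
have [C0 lnC] := ln_small e20; have h0 : 0 < H b by exact: entropy_gt0.
have L0 := max_information_gt0; pose C : R := `|word_loss + C0| + Lp + `|A b| + H b.
have Cc : `|word_loss + C0| <= C by rewrite /C; have := normr_ge0 (A b); lra.
have CL : Lp <= C by rewrite /C; have := normr_ge0 (word_loss + C0); have := normr_ge0 (A b); lra.
have CA : Lp + `|A b| <= C by rewrite /C; have := normr_ge0 (word_loss + C0); lra.
have CH : H b <= C by rewrite /C; have := normr_ge0 (word_loss + C0); have := normr_ge0 (A b); lra.
have Cge0 : 0 <= C by apply: le_trans CL; exact: ltW.
have [m [K [mm1 mK small]]] := late_run t0 t_lt t_lim b m1 Cge0 e20.
have Cm : C * m%:R <= C * m.+2%:R by rewrite ler_wpM2l ?normr_ge0// ler_nat -addn2 leq_addr.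
have ePos : 0 <= eps * (block_pos m)%:R by rewrite mulr_ge0// ltW.
have sumC : \sum_(0 <= i < m) (C + C * (if ((block_pos i).+1 < t K)%N then i.+2%:R else 0))
    <= eps / 2 * (block_pos m)%:R.
  rewrite big_split/= -mulr_sumr sumr_const_nat subn0 -(mulr_natr C).
  by apply: le_trans small; rewrite lerD2r.
exists m; split => //.
  rewrite ln_node_count.
  apply: (@le_trans _ _ (\sum_(0 <= i < m) ((H b - eps / 2) * i.+2%:R -
      (C + C * (if ((block_pos i).+1 < t K)%N then i.+2%:R else 0))))).
    by rewrite sumrB -mulr_sumr sum_block_length; lra.
  apply: ler_sum_nat => i /andP[_ im]; have := lnC i; have := ler_norm (word_loss + C0).
  have ei : 0 <= eps * i.+2%:R by rewrite mulr_ge0// ltW.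
  have := ln_branching_ge i; case: ltnP => iK.
    have : 0 <= ln (N i)%:R :> R by rewrite ln_ge0// ler1n branching_freq_gt0.
    have : H b * i.+2%:R <= C * i.+2%:R by rewrite ler_wpM2r.
    by lra.
  by rewrite (run_in_type (mK _ im iK)) mulr0; lra.
move=> u cu; rewrite info_sum; apply: le_trans (ler_norm_sum _ _ _) _.
apply: (@le_trans _ _ (\sum_(0 <= i < m)
    (C + C * (if ((block_pos i).+1 < t K)%N then i.+2%:R else 0)))); last by lra.
apply: ler_sum_nat => i /andP[_ im]; case: ltnP => iK.
  apply: le_trans (block_deviation_any _ _ _) _.
  rewrite mulrC; have : (Lp + `|A b|) * i.+2%:R <= C * i.+2%:R by rewrite ler_wpM2r.
  by lra.
by rewrite mulr0 addr0; apply: le_trans (block_deviation_run cu (mK _ im iK)) CL.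
Qed.

(** When the two types have the same mean information the changes of run do not matter,
    and the information grows linearly along all the blocks. *)
Lemma info_limit a eps : A true = a -> A false = a -> 0 < eps ->
  exists m0, forall m u, (m0 <= m)%N -> code N u ->
  `|info p ph t (block_pos m) (dig u) - a * (block_pos m)%:R| <= eps * (block_pos m)%:R.
Proof.
move=> At Af e0; have Aa b : A b = a by case: b.
have L0 := max_information_gt0; pose C : R := Lp + `|a|.
have Cge0 : 0 <= C by rewrite addr_ge0 ?normr_ge0// ltW.
have CL : Lp <= C by rewrite lerDl normr_ge0.
have [m0 small] := mixed_negligible t0 t_lt t_lim Cge0 e0.
exists m0 => m u /small sm cu; rewrite info_sum.
apply: le_trans (ler_norm_sum _ _ _) _.
apply: (@le_trans _ _ (\sum_(0 <= i < m)
    (C + C * (if `[< run_in t (block_type t i) i >] then 0 else i.+2%:R)))).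
  apply: ler_sum => i _; case: asboolP => [ir|_].
    by rewrite mulr0 addr0 (le_trans _ CL)// -(Aa (block_type t i)) block_deviation_run.
  apply: le_trans (block_deviation_any _ _ _) _; rewrite mulrC -/C; lra.
rewrite big_split/= -mulr_sumr sumr_const_nat subn0 -(mulr_natr C).
by apply: le_trans sm; rewrite lerD2r ler_wpM2l// ler_nat -[X in (_ <= X)%N]addn2 leq_addr.
Qed.

End CantorAsymptotics.

(** * Lower bounds given by the Cantor sets *)

Section CantorLowerBounds.
Context {R : realType} (p ph : R) (t : nat -> nat).
Context (mu : probability (measurableTypeR R) R).
Hypotheses (p_gt0 : 0 < p) (p_lt_ph : p < ph) (ph_le : ph <= 2^-1).
Hypothesis mu_assoc : associated_measure p ph t mu.
Hypotheses (t0 : t 0%N = 1%N) (t_lt : forall n, (t n < t n.+1)%N).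
Hypothesis t_lim : ((t n.+1)%:R / (t n)%:R : R) @[n --> \oo] --> +oo.
Variable f : bool -> R.
Hypothesis f01 : forall b, 0 < f b < 1.
Implicit Types (i m : nat) (b : bool) (u : nat -> nat) (eps : R).

Local Notation zeros := (frequency_zeros t f).
Local Notation N := (branching zeros).
Local Notation dig := (digits zeros).
Local Notation x := (@cantor_point R zeros).
Local Notation r := (@cantor_radius R).
Local Notation A b := (cross_entropy (f b) (zero_weight p ph b)).
Local Notation H b := (entropy (f b)).

Let N_gt0 i : (0 < N i)%N := branching_freq_gt0 t f01 i.

Definition cantor_set : set R := [set x u | u in code N].

Lemma half_expnE n : ((2 : R) ^+ n)^-1 = expR (- (n%:R * ln 2)).
Proof. by rewrite expRN expRM_natl lnK ?posrE. Qed.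

Lemma ln2_gt0 : 0 < ln 2 :> R.
Proof. by rewrite ln_gt0// ltr1n. Qed.

Lemma node_count_gt0R m : 0 < (node_count N m)%:R :> R.
Proof. by rewrite ltr0n node_count_gt0. Qed.

Lemma cantor_radius_lt_near eps : 0 < eps -> exists m0, forall m, (m0 <= m)%N -> r m < eps.
Proof.
move=> e0; have [n ne] := exists_half_expn_lt e0; exists n => m nm.
apply: le_lt_trans ne; apply: ler_half_expn; have := leq_block_pos_self m; lia.
Qed.

Lemma inv_node_count_lt_near eps : 0 < eps ->
  exists m0, forall m, (m0 <= m)%N -> (node_count N m)%:R^-1 <= eps.
Proof.
move=> e0; set h := Num.min (H true) (H false).
have h0 : 0 < h by exact: min_entropy_gt0.
have h20 : 0 < h / 2 by rewrite divr_gt0.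
have [m1 P1] := ln_node_count_lower t f01 h20.
have [m2 P2] := linear_o_block_pos `|ln eps| h20.
exists (maxn m1 m2) => m; rewrite geq_max => /andP[/P1 cntM /P2 leps].
rewrite -ler_ln ?posrE ?invr_gt0 ?node_count_gt0R// lnV ?posrE ?node_count_gt0R//.
have h3 : `|ln eps| * 1 <= `|ln eps| * m.+2%:R by rewrite ler_wpM2l ?normr_ge0 ?ler1n.
have h4 : (h / 2) * (block_pos m)%:R <= (h / 2) * (block_pos m.+1)%:R.
  by rewrite ler_pM2l// ler_nat leq_block_pos.
have h5 := ler_norm (- ln eps); rewrite normrN in h5.
move: cntM; rewrite -/h; lra.
Qed.

(** Points of the Cantor set at a distance less than [2 * cantor_radius m] share their
    first [m] choices, and the number of nodes of level [m] is at least
    [cantor_radius m.+1] to the power [- s], up to a constant factor.  The term [eps]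
    serves the sets of diameter 0 and those that miss the Cantor set. *)
Lemma small_set_one_node (s : R) : 0 <= s -> s * ln 2 < Num.min (H true) (H false) ->
  exists2 delta, 0 < delta & forall (U : set R) eps, (diam U <= delta%:E)%E -> 0 < eps ->
    exists m v, (forall u, code N u -> U (x u) -> agree m u v) /\
    (((node_count N m)%:R^-1)%:E <= (2 `^ s)%:E * diam U `^ s + eps%:E)%E.
Proof.
move=> s0 sh; set h := Num.min _ _ in sh; have e0 : 0 < h - s * ln 2 by lra.
have [m0 cntM] := ln_node_count_lower t f01 e0.
exists (r m0); first exact: cantor_radius_gt0.
move=> U eps dU eps0; have dU0 : (0 <= diam U)%E by exact: diam_ge0.
have [d dE] : exists d, diam U = d%:E.
  exists (fine (diam U)); rewrite fineK// ge0_fin_numE//.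
  by apply: le_lt_trans dU _; exact: ltry.
move: dU dU0; rewrite dE !lee_fin poweR_EFin -EFinM -EFinD => dU dU0.
have [[v [cv Uv]]|nv] := pselect (exists v, code N v /\ U (x v)); last first.
  have [m1 small] := inv_node_count_lt_near eps0.
  exists m1, (fun=> 0%N); split.
    by move=> u cu Uu; exfalso; apply: nv; exists u.
  by rewrite lee_fin (le_trans (small _ (leqnn _)))// lerDr mulr_ge0// powR_ge0.
have close u m : code N u -> U (x u) -> d < 2 * r m -> agree m u v.
  move=> cu Uu dr; apply: (@cantor_point_close R zeros) => //.
  apply: le_lt_trans dr; rewrite -lee_fin -dE /diam le_max; apply/orP; right.
  by apply: ereal_sup_ubound; exists (x u, x v).
have [d0|d0] := eqVneq d 0.
  have [m1 small] := inv_node_count_lt_near eps0.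
  exists m1, v; split.
    by move=> u cu Uu; apply: close => //; rewrite d0 mulr_gt0// cantor_radius_gt0.
  by rewrite lee_fin (le_trans (small _ (leqnn _)))// lerDr mulr_ge0// powR_ge0.
have {d0}d0 : 0 < d by rewrite lt_neqAle eq_sym d0.
have [M rM Mmin] : exists2 M, 2 * r M <= d & forall m, 2 * r m <= d -> (M <= m)%N.
  have ex : exists M, 2 * r M <= d.
    have d20 : 0 < d / 2 by rewrite divr_gt0.
    have [M] := cantor_radius_lt_near d20; move=> /(_ M (leqnn _)) rMd.
    by exists M; rewrite mulrC -ler_pdivlMr// ltW.
  by have [M rM Mmin] := ex_minnP ex; exists M.
have Mm0 : (m0 < M)%N.
  rewrite ltnNge; apply/negP => Mm; have := le_trans rM dU; apply/negP; rewrite -ltNge.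
  have : r m0 <= r M by apply: ler_half_expn; rewrite !ltnS leq_block_pos.
  by have := @cantor_radius_gt0 R M; lra.
case: M rM Mmin Mm0 => // m rM Mmin m0m.
exists m, v; split.
  by move=> u cu Uu; apply: close => //; rewrite ltNge; apply/negP => /Mmin; rewrite ltnn.
rewrite lee_fin; apply: ler_wpDr; first exact: ltW.
have rs : (2 * r m.+1) `^ s <= d `^ s.
  by rewrite ge0_ler_powR// nnegrE ?mulr_ge0 ?ltW// cantor_radius_gt0.
apply: (@le_trans _ _ (2 `^ s * (2 * r m.+1) `^ s)); last by rewrite ler_wpM2l// powR_ge0.
rewrite -powRM ?mulr_ge0 ?(ltW (@cantor_radius_gt0 R _))//.
have -> : 2 * (2 * r m.+1) = expR (- ((block_pos m.+1)%:R * ln 2)).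
  by rewrite /cantor_radius -half_expnS -half_expnS half_expnE.
rewrite -ler_ln ?posrE ?invr_gt0 ?node_count_gt0R ?powR_gt0 ?expR_gt0//.
rewrite lnV ?posrE ?node_count_gt0R// ln_powR expRK.
have := cntM m m0m; rewrite subKr mulrN lerN2.
by congr (_ <= _); ring.
Qed.

(** At every scale the number of nodes is at least given by the smaller of the two
    entropies; Kraft's inequality then bounds every cover from below. *)
Lemma hausdorff_dim_cantor (E : set R) : cantor_set `<=` E ->
  ((Num.min (H true) (H false) / ln 2)%:E <= hausdorff_dim E)%E.
Proof.
move=> CE; apply: le_ereal_inf_tmp => _ [s [s0 Es0] <-]; rewrite lee_fin leNgt.
apply/negP; rewrite ltr_pdivlMr ?ln2_gt0// => sh.
have [delta d0 dP] := small_set_one_node s0 sh.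
have p2 : 0 < (2 `^ s : R) by rewrite powR_gt0.
have : (hausdorff_premeasure s delta E < (4^-1 / 2 `^ s)%:E)%E.
  apply: (@le_lt_trans _ _ 0%E); last by rewrite lte_fin divr_gt0.
  by rewrite -Es0; apply: ereal_sup_ubound; exists delta.
move=> /ereal_inf_lt[_ [G [cG EG dG] <-] Glt].
have [g gi] := countable_injP _ cG.
pose U i := xget set0 [set V | G V /\ g V = i].
have UE V : G V -> U (g V) = V.
  move=> GV; rewrite /U; case: xgetP => [W _ [GW gW]|/(_ V)]; last by case.
  by apply: gi => //; rewrite inE.
pose c i := (if `[< (g @` G) i >] then diam (U i) `^ s else 0)%E.
have c0 i : (0 <= c i)%E by rewrite /c; case: ifP => // _; exact: poweR_ge0.
pose a i := ((2 `^ s)%:E * c i)%E.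
have a0 i : (0 <= a i)%E by rewrite mule_ge0// lee_fin ltW.
have node i : {mv : nat * (nat -> nat) |
    ((g @` G) i -> forall u, code N u -> U i (x u) -> agree mv.1 u mv.2) /\
    (((node_count N mv.1)%:R^-1)%:E <= a i + (2^-1 / (2 ^ i.+1)%:R)%:E)%E}.
  have e0 : 0 < 2^-1 / (2 ^ i.+1)%:R :> R by rewrite divr_gt0 ?invr_gt0 ?ltr0n ?expn_gt0.
  apply/cid; rewrite /a /c; case: asboolP => [[V GV gV]|ni]; [subst i|].
    have dV : (diam (U (g V)) <= delta%:E)%E by rewrite UE//; exact: dG.
    by have [m [v [mv1 mv2]]] := dP _ _ dV e0; exists (m, v).
  have [m0 small] := inv_node_count_lt_near e0.
  by exists (m0, fun=> 0%N); split => //=; rewrite mule0 add0e lee_fin small.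
have cover u : code N u -> exists i, agree (sval (node i)).1 u (sval (node i)).2.
  move=> cu; have [V GV Vx] := EG (x u) (CE _ (ex_intro2 _ _ u cu erefl)).
  exists (g V); have [agr _] := svalP (node (g V)); apply: agr => //.
  by rewrite UE.
have := @kraft_cover N N_gt0 R (fun i => (sval (node i)).1) (fun i => (sval (node i)).2) cover.
apply/negP; rewrite -ltNge.
apply: (@le_lt_trans _ _ (\sum_(0 <= i <oo) (a i + (2^-1 / (2 ^ i.+1)%:R)%:E))%E).
  apply: lee_nneseries => [i _ _|i _]; first by rewrite lee_fin.
  by have [_] := svalP (node i).
apply: le_lt_trans (epsilon_trick _ a0 _) _; first by rewrite invr_ge0.
rewrite /a nneseriesZl// nneseries_esumT//.
have -> : (\esum_(i in [set: nat]) c i = \esum_(V in G) (diam V `^ s))%E.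
  rewrite (_ : \esum_(i in [set: nat]) c i = \esum_(i in g @` G) (diam (U i) `^ s))%E; last first.
    rewrite [RHS]esum_mkcond; apply: eq_esum => i _; rewrite /c.
    by case: asboolP => h; [rewrite mem_set|rewrite memNset].
  rewrite esum_image; last by move=> V W GV GW; exact: gi.
  by apply: eq_esum => V GV; rewrite UE.
have : ((2 `^ s)%:E * (\esum_(V in G) (diam V `^ s)) < 4^-1%:E)%E.
  by rewrite -lte_pdivlMl// muleC -EFinM.
move=> h; apply: (@lt_trans _ _ (4^-1 + 2^-1)%:E); last by rewrite lte_fin; lra.
by rewrite EFinD lteD2rE.
Qed.

(** The packing of a set that is dense in the Cantor set above the node
    [(u0, m0)]: one ball for each node of level [m]. *)
Lemma cantor_packing (F : set R) u0 m0 m : code N u0 -> (m0 <= m)%N ->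
  (forall v k, code N v -> agree m0 u0 v ->
     exists w, [/\ code N w, agree k v w & F (x w)]) ->
  exists C : set R, centered_packing F (r m) C /\
    forall (a : R -> \bar R) (k : R), 0 <= k -> (forall y, (0 <= a y)%E) ->
      (forall u, code N u -> (k%:E <= a (x u))%E) ->
      (((node_count N m)%:R / (node_count N m0)%:R * k)%:E <= \esum_(y in C) a y)%E.
Proof.
move=> cu0 m0m dense.
have [l [W [ul sl lP]]] := @dense_code_list N [set u | F (x u)] u0 m0 m cu0 m0m dense.
have inj l1 l2 : l1 \in l -> l2 \in l ->
    ball (x (W l1)) (r m) `&` ball (x (W l2)) (r m) !=set0 -> l1 = l2.
  move=> /lP[s1 c1 _ a1] /lP[s2 c2 _ a2] /(cantor_ball_disjoint c1 c2) a12.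
  apply: (@eq_from_nth _ 0%N); rewrite s1 ?s2// => i im.
  by rewrite -a1// -a2// a12.
have r0 := @cantor_radius_gt0 R m.
exists [set x (W i) | i in [set` l]]; split; first split.
- by move=> _ [i /= /lP[_ _ Fi _] <-].
- move=> _ _ [i /= il <-] [j /= jl <-] h; congr (x (W _)); exact: inj.
move=> a k k0 a0 ka; rewrite esum_image; last first.
  move=> i j; rewrite !inE/= => il jl ij; apply: inj => //; exists (x (W i)).
  by split; [exact: ballxx|rewrite /= ij; exact: ballxx].
rewrite esum_seq//.
apply: (@le_trans _ _ (\sum_(i <- l) k%:E)%E); last first.
  rewrite big_seq [leRHS]big_seq; apply: lee_sum => i /lP[_ ci _ _]; exact: ka.
rewrite sumEFin lee_fin big_const_seq count_predT iter_addr_0 -(mulr_natl k).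
by rewrite ler_wpM2r// ler_pdivrMr ?node_count_gt0R// -natrM ler_nat -sl mulnC leqnn.
Qed.

Lemma cantor_baire (F : nat -> set R) : cantor_set `<=` \bigcup_i F i ->
  exists i u0 m0, code N u0 /\ forall v k, code N v -> agree m0 u0 v ->
     exists w, [/\ code N w, agree k v w & F i (x w)].
Proof.
move=> CF; have [u cu|i [u0 [m0 h]]] := code_baire N_gt0 (F := fun i => [set u | F i (x u)]).
  by have [i _ Fi] := CF (x u) (ex_intro2 _ _ u cu erefl); exists i.
by exists i, u0, m0.
Qed.

(** At the ends of the runs of type [b], the level [m] has about [exp (H b * n)] nodes, and
    the balls have measures about [exp (- A b * n)], where [n = block_pos m]. *)
Lemma cantor_packing_large b (F : set R) u0 m0 (q s : R) : code N u0 ->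
  (forall v k, code N v -> agree m0 u0 v ->
     exists w, [/\ code N w, agree k v w & F (x w)]) ->
  s * ln 2 < H b - q * A b -> forall m1, exists m C,
  [/\ (m1 <= m)%N, centered_packing F (r m) C &
      (1 <= (\esum_(y in C) (mu (ball y (r m)) `^ q)) * ((2 * r m) `^ s)%:E)%E].
Proof.
move=> cu0 dense sHA m1; set L : R := - ln p.
have L0 : 0 < L by exact: max_information_gt0 p_gt0 p_lt_ph ph_le.
pose g := H b - q * A b - s * ln 2; have g0 : 0 < g by rewrite subr_gt0.
pose eps := g / (2 * (1 + `|q|)).
have q1 : 0 < 1 + `|q| by rewrite ltr_wpDr.
have e0 : 0 < eps by rewrite divr_gt0// mulr_gt0.
have epsg : eps * (1 + `|q|) = g / 2 by rewrite /eps; field; rewrite gt_eqF.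
have g20 : 0 < g / 2 by rewrite divr_gt0.
pose K := `|q| * L + `|s * ln 2| + `|ln ((node_count N m0)%:R : R)|.
have [m2 small] := linear_o_block_pos K g20.
have [m [mm cntM infom]] := late_run_estimates p_gt0 p_lt_ph ph_le t0 t_lt t_lim f01 b (m0 + m1 + m2) e0.
have {small} := small m (leq_trans (leq_addl _ _) mm).
have m0m := leq_trans (leq_trans (leq_addr m1 m0) (leq_addr m2 _)) mm.
have [C [pC CP]] := cantor_packing cu0 m0m dense.
set P : R := (block_pos m)%:R in cntM infom *; have P0 : 0 <= P by exact: ler0n.
have Lm1 : 1 <= m.+2%:R :> R by rewrite ler1n.
move=> smallm.
pose k := expR (- (q * A b) * P - `|q| * (eps * P + m.+2%:R * L)).
exists m, C; split => //.
  by apply: leq_trans mm; rewrite addnAC leq_addl.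
have ka u : code N u -> (k%:E <= mu (ball (x u) (r m)) `^ q)%E.
  move=> cu; have [mu0 /andP[i1 i2]] := cantor_ball_mu p_gt0 p_lt_ph ph_le mu_assoc zeros m u.
  rewrite mu_ballE poweR_EFin lee_fin; set M := fine _ in mu0 i1 i2 *.
  rewrite /powR gt_eqF// ler_expR.
  have /ler_normlP[j1 j2] := infom u cu.
  have /andP[h1 h2] := block_info_bounds t p_gt0 p_lt_ph ph_le zeros m u.
  have d1 : `|- ln M - A b * P| <= eps * P + m.+2%:R * L.
    rewrite ler_norml /L; apply/andP; split; last by lra.
    have := mulr_ge0 (ler0n R m.+2) (ltW L0); rewrite /L; lra.
  have d2 : `|q| * `|- ln M - A b * P| <= `|q| * (eps * P + m.+2%:R * L) by rewrite ler_wpM2l.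
  have := ler_norm (q * (- ln M - A b * P)); rewrite normrM; lra.
have k0 : 0 <= k by exact: expR_ge0.
apply: (@le_trans _ _ (((node_count N m)%:R / (node_count N m0)%:R * k) * (2 * r m) `^ s)%:E); last first.
  rewrite EFinM lee_wpmul2r ?lee_fin ?powR_ge0//; apply: (CP _ k) => // y.
  exact: poweR_ge0.
have r0 := @cantor_radius_gt0 R m.
rewrite lee_fin -ler_ln ?posrE ?mulr_gt0 ?invr_gt0 ?node_count_gt0R ?expR_gt0 ?powR_gt0 ?mulr_gt0//.
have -> : 2 * r m = expR (- ((block_pos m).+1%:R * ln 2)).
  by rewrite /cantor_radius -half_expnS half_expnE.
rewrite ln1 lnM ?posrE ?powR_gt0 ?expR_gt0 ?mulr_gt0 ?invr_gt0 ?node_count_gt0R ?expR_gt0//.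
rewrite lnM ?posrE ?mulr_gt0 ?invr_gt0 ?node_count_gt0R ?expR_gt0//.
rewrite lnM ?posrE ?invr_gt0 ?node_count_gt0R// lnV ?posrE ?node_count_gt0R//.
rewrite ln_powR !expRK -[(block_pos m).+1%:R]natr1 -/P.
have h1 := ler_norm (s * ln 2); have h2 := ler_norm (ln ((node_count N m0)%:R : R)).
have h3 : (`|s * ln 2| + `|ln ((node_count N m0)%:R : R)|) * 1 <=
    (`|s * ln 2| + `|ln ((node_count N m0)%:R : R)|) * m.+2%:R.
  by rewrite ler_wpM2l// addr_ge0.
have h4 : eps * (1 + `|q|) * P = g / 2 * P by rewrite epsg.
move: smallm cntM; rewrite /K /g in h4 *; lra.
Qed.

(** Packings are only required at some small scales, which can be taken at the ends of the
    runs of the more favourable type. *)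
Lemma packing_dim_cantor b (E : set R) : cantor_set `<=` E ->
  ((H b / ln 2)%:E <= packing_dim E)%E.
Proof.
move=> CE; apply: le_ereal_inf_tmp => _ [s [s0 Es0] <-]; rewrite lee_fin leNgt.
apply/negP; rewrite ltr_pdivlMr ?ln2_gt0// => sh.
have : (packing_measure s E < 1)%E by rewrite Es0.
move=> /ereal_inf_lt[_ [F EF <-]]; apply/negP; rewrite -leNgt.
have [i [u0 [m0 [cu0 dense]]]] := cantor_baire (subset_trans CE EF).
apply: le_trans (@le_nneseries_term R (fun j => packing_premeasure s (F j)) i _); last first.
  by move=> j; exact: packing_premeasure_ge0.
apply: le_ereal_inf_tmp => _ [delta /= d0 <-].
have [m1 rm1] := cantor_radius_lt_near d0.
have sh' : s * ln 2 < H b - 0 * A b by rewrite mul0r subr0.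
have [m [C [m1m [CF tC] large]]] := cantor_packing_large cu0 dense sh' m1.
apply: le_trans large _.
rewrite (_ : \esum_(y in C) (mu (ball y (r m)) `^ 0) = counting C)%E; last first.
  rewrite (eq_esum (b := fun=> 1%:E)); last by move=> y _; rewrite poweRe0.
  by rewrite esum_cst// mule1.
rewrite -esum_cst ?powR_ge0//.
rewrite -(esum_image C (fun y => (y, r m)) (fun c => ((2 * c.2) `^ s)%:E)); last first.
  by move=> y z _ _ [].
apply: ereal_sup_ubound; exists [set (y, r m) | y in C] => //; split.
  move=> _ [y Cy <-] /=; split; first exact: CF.
  by rewrite cantor_radius_gt0 ltW// rm1.
move=> _ _ [y Cy <-] [z Cz <-] /= h; congr (_, _); exact: tC.
Qed.

Lemma B_fun_cantor b (q : R) : (((H b - q * A b) / ln 2)%:E <= B_fun mu q)%E.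
Proof.
apply: le_ereal_inf_tmp => _ [s Es0 <-]; rewrite lee_fin leNgt.
apply/negP; rewrite ltr_pdivlMr ?ln2_gt0// => sh.
have : (mu_P mu q s (supp mu) < 1)%E by rewrite Es0.
move=> /ereal_inf_lt[_ [F [_ EF] <-]]; apply/negP; rewrite -leNgt.
have CE : cantor_set `<=` supp mu.
  by move=> _ [u _ <-]; exact: (cantor_point_supp p_gt0 p_lt_ph ph_le mu_assoc).
have [i [u0 [m0 [cu0 dense]]]] := cantor_baire (subset_trans CE EF).
apply: le_trans (@le_nneseries_term R (fun j => mu_Pbar mu q s (F j)) i _); last first.
  by move=> j; exact: mu_Pbar_ge0.
apply: limf_esup_ge_frequently => delta d0.
have [m1 rm1] := cantor_radius_lt_near d0.
have [m [C [m1m pC large]]] := cantor_packing_large cu0 dense sh m1.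
exists (r m); first by rewrite cantor_radius_gt0 rm1.
apply: le_trans large _; rewrite lee_wpmul2r ?lee_fin ?powR_ge0//.
by apply: ereal_sup_ubound; exists C.
Qed.

(** The information of the digits is known up to the ends of the blocks.  Any radius lies between two consecutive [cantor_radius], whose logarithms differ by
    the length of one block, which is negligible. *)
Lemma cantor_set_sub_level_set a : 0 <= a -> A true = a -> A false = a ->
  cantor_set `<=` level_set mu (a / ln 2).
Proof.
move=> a0 At Af _ [u cu <-]; split.
  exact: (cantor_point_supp p_gt0 p_lt_ph ph_le mu_assoc).
apply/cvgrPdist_lt => eps eps0; apply/at_right0P.
have l2 := ln2_gt0; have e0 : 0 < eps * ln 2 / 4 by rewrite divr_gt0// mulr_gt0.
have [m1 infom] := info_limit p_gt0 p_lt_ph ph_le t0 t_lt t_lim f01 At Af e0.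
have [m2 small] := linear_o_block_pos (2 * a + eps * ln 2) e0.
exists (Num.min 1 (r (m1 + m2))); first by rewrite lt_min ltr01 cantor_radius_gt0.
move=> rho /andP[rho0]; rewrite lt_min => /andP[rho1 rhom].
have [m [mm rm1 rm]] : exists m, [/\ (m1 + m2 <= m)%N, r m.+1 <= rho & rho < r m].
  have ex : exists M, r M <= rho.
    by have [M] := cantor_radius_lt_near rho0; move=> /(_ M (leqnn _)) /ltW h; exists M.
  have [[|M] rM Mmin] := ex_minnP ex.
    exfalso; have : r (m1 + m2) <= r 0 by apply: ler_half_expn; rewrite !ltnS leq_block_pos.
    lra.
  exists M; split => //; last by rewrite ltNge; apply/negP => /Mmin; rewrite ltnn.
  rewrite -ltnS ltnNge; apply/negP => Mm; have : r (m1 + m2) <= r M.+1.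
    by apply: ler_half_expn; rewrite !ltnS leq_block_pos.
  lra.
have [mu1 lnge] : 0 < fine (mu (ball (x u) rho)) /\
    - ln (fine (mu (ball (x u) rho))) <= info p ph t (block_pos m.+2) (dig u).
  apply: (ln_mu_ball_ge p_gt0 p_lt_ph ph_le mu_assoc).
  by move=> y /(@sub_cantor_ball R zeros m.+1 u); exact: le_ball.
have lnle : info p ph t (block_pos m) (dig u) <= - ln (fine (mu (ball (x u) rho))).
  apply: (ln_mu_ball_le p_gt0 p_lt_ph ph_le mu_assoc) mu1.
  by move=> y yb; apply: cantor_ball_sub; apply: le_ball yb; exact: ltW.
set M := fine _ in mu1 lnge lnle *.
have rE k : r k = expR (- ((block_pos k).+2%:R * ln 2)) by rewrite /cantor_radius half_expnE.
have L1 : (block_pos m).+2%:R * ln 2 < - ln rho.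
  by rewrite ltrNr -[ltRHS]expRK -rE ltr_ln ?posrE// cantor_radius_gt0.
have L2 : - ln rho <= (block_pos m.+1).+2%:R * ln 2.
  by rewrite lerNl -[leLHS]expRK -rE ler_ln ?posrE// cantor_radius_gt0.
have /ler_normlP[i1 _] := infom m u (leq_trans (leq_addr _ _) mm) cu.
have mm2 : (m1 <= m.+2)%N := leqW (leqW (leq_trans (leq_addr _ _) mm)).
have /ler_normlP[_ i2] := infom m.+2 u mm2 cu.
have := small m (leq_trans (leq_addl _ _) mm).
pose lam := - ln rho / ln 2; have rholam : ln rho = - (lam * ln 2).
  by rewrite /lam divfK ?gt_eqF// opprK.
move: i1 i2 L1 L2; rewrite rholam opprK ltr_pM2r// ler_pM2r//.
have -> : (block_pos m.+1).+2%:R = (block_pos m)%:R + m.+2%:R + 2 :> R.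
  by rewrite block_posS -addn2 !natrD.
have -> : (block_pos m.+2)%:R = (block_pos m)%:R + m.+2%:R + (m.+2%:R + 1) :> R.
  by rewrite !block_posS !natrD natr1.
rewrite -[(block_pos m).+2]addn2 natrD.
set P : R := (block_pos m)%:R; set L : R := m.+2%:R; move: (ln (fine _)) lnge lnle => lnM.
set I0 := info _ _ _ _ _; set I2 := info _ _ _ _ _ => I2lnM lnMI0 i1 i2 L1 L2 sm.
have P0 : 0 <= P by exact: ler0n.
have L2' : 2 <= L by rewrite ler_nat.
have lam0 : 0 < lam by lra.
have wl0 : 0 < lam * ln 2 by rewrite mulr_gt0.
have -> : a / ln 2 - lnM / - (lam * ln 2) = (a * lam + lnM) / (lam * ln 2).
  by field; rewrite !gt_eqF.
have h1 : a * (P + 2) <= a * lam by rewrite ler_wpM2l// ltW.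
have h2 : a * lam <= a * (P + L + 2) by rewrite ler_wpM2l.
have h3 : (eps * ln 2) * (P + 2) < (eps * ln 2) * lam by rewrite ltr_pM2l// mulr_gt0.
have h4 : a * 2 <= a * L by rewrite ler_wpM2l.
have h5 : 0 <= eps * ln 2 * P by rewrite !mulr_ge0// ltW.
have h6 : eps * ln 2 * 2 <= eps * ln 2 * L by rewrite ler_wpM2l// mulr_ge0// ltW.
have h7 : 0 < eps * ln 2 by rewrite mulr_gt0.
rewrite normrM (gtr0_norm (_ : 0 < (lam * ln 2)^-1)) ?invr_gt0// ltr_pdivrMr//.
by rewrite ltr_norml; apply/andP; split; lra.
Qed.

End CantorLowerBounds.

(** * Upper bounds for the multifractal functions *)

Section DyadicIndices.
Context {R : realType}.
Implicit Types (n k j : nat) (x r q : R).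

(** Digit number 1 is the most significant: these are the digits of the dyadic interval
    of generation [n] that begins at [k / 2^n]. *)
Definition index_digits n k j : bool := odd (k %/ 2 ^ (n - j)).

Lemma index_digits_half n k :
  same_digits n (index_digits n.+1 k) (index_digits n k./2).
Proof.
move=> j /andP[j0 jn]; rewrite /index_digits subSn// expnS -divn2.
by rewrite divnMA.
Qed.

Lemma index_digits_last n k : index_digits n.+1 k n.+1 = odd k.
Proof. by rewrite /index_digits subnn expn0 divn1. Qed.

Lemma dyadic_left_index n k : (k < 2 ^ n)%N ->
  dyadic_left n (index_digits n k) = k%:R * (2 ^+ n)^-1 :> R.
Proof.
elim: n k => [|n IH] k; first by rewrite expn0 ltnS leqn0 => /eqP ->; rewrite dyadic_left0 mul0r.
move=> kn; rewrite dyadic_leftS (same_digits_dyadic_left (@index_digits_half n k)).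
rewrite index_digits_last IH; last by rewrite -divn2 ltn_divLR// -expnSr.
rewrite -[in RHS](odd_double_half k) natrD -muln2 natrM half_expnS; ring.
Qed.

Lemma exists_index n x : 0 <= x <= 1 -> exists k,
  (k < 2 ^ n)%N /\ k%:R * (2 ^+ n)^-1 <= x <= (k%:R + 1) * (2 ^+ n)^-1.
Proof.
move=> /andP[x0 x1]; have h0 : 0 < 2 ^+ n :> R by rewrite exprn_gt0.
have xn0 : 0 <= x * 2 ^+ n by rewrite mulr_ge0// ltW.
have /andP[k1 k2] := truncn_itv xn0; set k := Num.truncn _ in k1 k2.
have [kn|kn] := ltnP k (2 ^ n).
  exists k; split => //; rewrite ler_pdivrMr// k1 ler_pdivlMr//= natr1.
  exact: ltW.
have x1E : x = 1.
  apply/eqP; rewrite eq_le x1 /= -(ler_pM2r h0) mul1r (le_trans _ k1)//.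
  by rewrite -natrX ler_nat.
exists (2 ^ n).-1; have e0 : (0 < 2 ^ n)%N by rewrite expn_gt0.
split; first by rewrite prednK.
rewrite x1E ler_pdivrMr// ler_pdivlMr// !mul1r natr1 prednK// natrX lexx andbT.
by rewrite -natrX ler_nat leq_pred.
Qed.

Lemma sum_even_odd n (F : nat -> R) :
  \sum_(0 <= k < 2 * n) F k = \sum_(0 <= k < n) (F k.*2 + F k.*2.+1).
Proof.
elim: n => [|n IH]; first by rewrite !big_geq.
by rewrite mulnS !addSn !big_nat_recr//= IH -mul2n addrA.
Qed.

Lemma powR_sum_le n (a : 'I_n -> R) q : 0 < q -> (forall i, 0 <= a i) ->
  (\sum_(i < n) a i) `^ q <= n%:R `^ q * \sum_(i < n) a i `^ q.
Proof.
case: n a => [|n] a q0 a0; first by rewrite !big_ord0 powR0 ?gt_eqF// mulr0.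
have [i _ imax] := @Order.TotalTheory.arg_maxP _ _ _ ord0 xpredT a isT.
have s0 : 0 <= \sum_(i < n.+1) a i by apply: sumr_ge0.
apply: (@le_trans _ _ ((n.+1%:R * a i) `^ q)).
  apply: (ge0_ler_powR (ltW q0)); rewrite ?nnegrE ?mulr_ge0//.
  apply: (@le_trans _ _ (\sum_(j < n.+1) a i)); first by apply: ler_sum => j _; exact: imax.
  by rewrite sumr_const card_ord mulr_natl.
rewrite powRM// ler_wpM2l ?powR_ge0// (bigD1 i)//= lerDl sumr_ge0// => j _.
exact: powR_ge0.
Qed.

End DyadicIndices.

Section PartitionSums.
Context {R : realType} (p ph : R) (t : nat -> nat).
Hypotheses (p_gt0 : 0 < p) (p_lt_ph : p < ph) (ph_le : ph <= 2^-1).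
Context (mu : probability (measurableTypeR R) R).
Hypothesis mu_assoc : associated_measure p ph t mu.
Implicit Types (n k j : nat) (x r q s : R) (C F : set R) (b : bool).

Definition index_mass n k : R := expR (- info p ph t n (index_digits n k)).

Definition index_itv n (a : R) : set R :=
  `[a * (2 ^+ n)^-1, (a + 1) * (2 ^+ n)^-1[%classic.

Lemma index_itvP n (a y : R) :
  index_itv n a y <-> a * (2 ^+ n)^-1 <= y /\ y < (a + 1) * (2 ^+ n)^-1.
Proof. by rewrite /index_itv /= in_itv /=; split=> [/andP[]|[-> ->]]. Qed.

Lemma mu_index_itv n k : (k < 2 ^ n)%N -> mu (index_itv n k%:R) = (index_mass n k)%:E.
Proof.
move=> kn; rewrite /index_mass -(mu_dyadic p_gt0 p_lt_ph ph_le mu_assoc) /dyadic.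
by rewrite (dyadic_left_index kn) /index_itv mulrDl mul1r.
Qed.

Lemma mu_unit_itv : mu `[0%R, 1%R[%classic = 1%E.
Proof.
have := @mu_index_itv 0 0 isT; rewrite /index_itv mul0r add0r mul1r expr0 invr1 => ->.
by rewrite /index_mass info0 oppr0 expR0.
Qed.

Lemma mu_disjoint_unit (A : set R) : measurable (A : set (measurableTypeR R)) ->
  A `&` `[0%R, 1%R[%classic = set0 -> mu A = 0%E.
Proof.
move=> mA A01; apply/eqP; rewrite eq_le measure_ge0 andbT.
have mI : measurable (`[0%R, 1%R[%classic : set (measurableTypeR R)) by exact: measurable_itv.
have : (mu (~` `[0%R, 1%R[%classic) = 0)%E.
  by rewrite probability_setC// mu_unit_itv subee.
move=> <-; apply: le_measure; rewrite ?inE//; first exact: measurableC.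
by apply/disjoints_subset.
Qed.

Lemma supp_unit x : supp mu x -> 0 <= x <= 1.
Proof.
move=> sx; apply: contrapT => nx.
have oU : open (~` `[0%R, 1%R]%classic : set R).
  by apply: closed_openC; exact: itv_closed.
have := sx _ oU nx; rewrite mu_disjoint_unit ?ltxx//.
  by apply: measurableC; exact: measurable_itv.
rewrite -subset0 => y [/= ny]; rewrite in_itv/= => /andP[y0 y1]; apply: ny.
by rewrite /= in_itv/= y0 ltW.
Qed.

Definition partition_sum n q : R := \sum_(0 <= k < 2 ^ n) index_mass n k `^ q.

Definition log_moment b q : R :=
  ln (zero_weight p ph b `^ q + (1 - zero_weight p ph b) `^ q).

Definition digit_type j := `[< odd_block t j >].

(** The digits are independent, so that the partition sum is a product. *)
Lemma partition_sumE n q :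
  partition_sum n q = expR (\sum_(1 <= j < n.+1) log_moment (digit_type j) q).
Proof.
elim: n => [|n IH].
  by rewrite /partition_sum big_nat1 big_geq// /index_mass info0 oppr0 expR0 powR1.
rewrite big_nat_recr//= expRD -IH /partition_sum expnS sum_even_odd mulr_suml.
apply: eq_bigr => k _; set b := digit_type n.+1.
have /andP[a1 a2] := zero_weight_bounds p_gt0 p_lt_ph ph_le b.
have a0 : 0 < zero_weight p ph b := lt_le_trans p_gt0 a1.
have a0' : 0 < 1 - zero_weight p ph b by lra.
rewrite /log_moment lnK; last by rewrite posrE addr_gt0// powR_gt0.
have step l : index_mass n.+1 l = index_mass n l./2 *
    (if odd l then 1 - zero_weight p ph b else zero_weight p ph b).
  rewrite /index_mass infoS opprB addrC expRD.
  rewrite lnK ?posrE ?(digit_weight_gt0 _ p_gt0 p_lt_ph ph_le)//.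
  rewrite (info_same_digits p ph t (@index_digits_half n l)).
  by rewrite /digit_weight index_digits_last.
rewrite !step /= odd_double/= doubleK uphalf_double.
by rewrite !powRM ?expR_ge0 ?(ltW a0) ?(ltW a0')// mulrDr.
Qed.

(** A ball of radius at most [2 * 2^-n] is covered by five consecutive intervals of
    generation [n].  The first factor compares the power of a sum of five terms with the
    sum of their powers; the second one is there because an interval is used for at
    most five centers. *)
Definition ball_constant q : R := 5%:R `^ `|q| * 5%:R.

(** The shift by 2 gives natural indices to the two neighbours on the left of an interval
    of generation [n]; those outside the unit interval have mass 0. *)
Definition shifted_mass n i : R :=
  if (2 <= i < 2 ^ n + 2)%N then index_mass n (i - 2) else 0.

Lemma mu_shifted n i : mu (index_itv n (i%:R - 2)) = (shifted_mass n i)%:E.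
Proof.
rewrite /shifted_mass; case: ifPn => [/andP[i2 ni]|].
  have km : (i - 2 < 2 ^ n)%N by rewrite ltn_subLR// addnC.
  by rewrite -(mu_index_itv km) natrB.
have hn : 0 < (2 ^+ n)^-1 :> R by exact: half_expn_gt0.
rewrite negb_and -ltnNge -leqNgt => h; apply: mu_disjoint_unit; first exact: measurable_itv.
rewrite -subset0 => y [/index_itvP[y1 y2]]; rewrite /= in_itv/= => /andP[y3 y4].
case/orP: h => h.
  have i2 : i%:R + 1 <= 2 :> R by rewrite natr1 ler_nat.
  have := le_lt_trans y3 y2; rewrite pmulr_lgt0// => i1; lra.
have ni : 2 ^+ n + 2 <= i%:R :> R by rewrite -natrX -natrD ler_nat.
have := le_lt_trans y1 y4; rewrite ltr_pdivrMr ?exprn_gt0// mul1r => i1; lra.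
Qed.

Lemma mu_ball_le_shifted n k x r : k%:R * (2 ^+ n)^-1 <= x <= (k%:R + 1) * (2 ^+ n)^-1 ->
  r <= 2 * (2 ^+ n)^-1 -> fine (mu (ball x r)) <= \sum_(d < 5) shifted_mass n (k + d).
Proof.
move=> /andP[kx xk] rn; have hn : 0 < (2 ^+ n)^-1 :> R by exact: half_expn_gt0.
rewrite -lee_fin -mu_ballE -sumEFin.
pose J d : set (measurableTypeR R) := index_itv n ((k + d)%:R - 2).
have mJ d : measurable (J d) by exact: measurable_itv.
apply: (@le_trans _ _ (mu (\big[setU/set0]_(d < 5) J d))).
  apply: le_measure; rewrite ?inE.
  - by rewrite ball_itv; exact: measurable_itv.
  - by apply: bigsetU_measurable => d _; exact: mJ.
  move=> y0; move: (y0 : R) => y; rewrite /ball/= ltr_norml => /andP[y1 y2].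
  pose z := y * 2 ^+ n - k%:R + 2; have h0 : 0 < 2 ^+ n :> R by rewrite exprn_gt0.
  have yE : y = (z + k%:R - 2) * (2 ^+ n)^-1 by rewrite /z; field; rewrite gt_eqF.
  have z0 : 0 <= z.
    have : (k%:R - 2) * (2 ^+ n)^-1 <= y by lra.
    by rewrite ler_pdivrMr// /z; lra.
  have z5 : z < 5.
    have : y < (k%:R + 3) * (2 ^+ n)^-1 by lra.
    by rewrite ltr_pdivlMr// /z; lra.
  have /andP[d1 d2] := truncn_itv z0; set d := Num.truncn z in d1 d2.
  have d5 : (d < 5)%N by rewrite -(ltr_nat R); exact: le_lt_trans z5.
  rewrite -(bigcup_mkord 5 J); exists d => //; apply/index_itvP.
  rewrite natrD yE ler_pM2r// ltr_pM2r//.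
  by move: d2; rewrite -natr1 => d2; split; lra.
apply: le_trans (Boole_inequality mu (fun d _ => mJ d)) _.
by apply: lee_sum => d _; rewrite -(mu_shifted n (k + d)).
Qed.

Lemma index_mass_ge0 n k : 0 <= index_mass n k.
Proof. exact: expR_ge0. Qed.

Lemma shifted_mass_ge0 n i : 0 <= shifted_mass n i.
Proof. by rewrite /shifted_mass; case: ifP => // _; exact: index_mass_ge0. Qed.

Lemma sum_shifted n q d : 0 < q -> (d < 5)%N ->
  \sum_(0 <= k < 2 ^ n) shifted_mass n (k + d) `^ q <= partition_sum n q.
Proof.
move=> q0 d5.
apply: (@le_trans _ _ (\sum_(0 <= i < 2 ^ n + 5) shifted_mass n i `^ q)).
  have h1 : (d <= 2 ^ n + 5)%N by rewrite (leq_trans (ltnW d5))// leq_addl.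
  have h2 : (d <= 2 ^ n + d)%N by rewrite leq_addl.
  have h3 : (2 ^ n + d <= 2 ^ n + 5)%N by rewrite leq_add2l ltnW.
  rewrite (big_cat_nat (leq0n d) h1)/= (big_cat_nat h2 h3)/=.
  have -> : \sum_(d <= i < 2 ^ n + d) shifted_mass n i `^ q =
      \sum_(0 <= k < 2 ^ n) shifted_mass n (k + d) `^ q.
    by rewrite -{1}[d]add0n big_addn addnK.
  rewrite addrCA lerDl addr_ge0// sumr_ge0// => i _; exact: powR_ge0.
have h1 : (2 <= 2 ^ n + 5)%N by exact: leq_trans (leq_addl _ 5).
have h2 : (2 <= 2 ^ n + 2)%N by rewrite leq_addl.
have h3 : (2 ^ n + 2 <= 2 ^ n + 5)%N by rewrite leq_add2l.
rewrite (big_cat_nat (leq0n 2) h1)/= (big_cat_nat h2 h3)/=.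
rewrite [X in X + (_ + _)]big1_seq; last first.
  move=> i /andP[_]; rewrite mem_index_iota => h.
  by rewrite /shifted_mass leqNgt (andP h).2 powR0 ?gt_eqF.
rewrite [X in _ + (_ + X)]big1_seq; last first.
  move=> i /andP[_]; rewrite mem_index_iota => h.
  by rewrite /shifted_mass andbC ltnNge (andP h).1 powR0 ?gt_eqF.
rewrite add0r addr0.
have -> : \sum_(2 <= i < 2 ^ n + 2) shifted_mass n i `^ q =
    \sum_(0 <= k < 2 ^ n) shifted_mass n (k + 2) `^ q.
  by rewrite -{1}[2%N]add0n big_addn addnK.
apply: ler_sum_nat => i /andP[_ ii]; by rewrite /shifted_mass addnK leq_addl ltn_add2r ii.
Qed.

(** For [q <= 0] the measure of a ball is bounded below by that of the interval of its
    center; for [q > 0] it is bounded above by that of five consecutive intervals. *)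
Lemma mu_ball_index_le n C (kappa : R -> nat) r q :
  (2 ^+ n)^-1 < r <= 2 * (2 ^+ n)^-1 -> {in C &, injective kappa} ->
  (forall x, C x -> (kappa x < 2 ^ n)%N /\
     (kappa x)%:R * (2 ^+ n)^-1 <= x <= ((kappa x)%:R + 1) * (2 ^+ n)^-1) ->
  (\esum_(x in C) (mu (ball x r) `^ q) <= (ball_constant q * partition_sum n q)%:E)%E.
Proof.
move=> /andP[nr rn] kinj kP; have hn : 0 < (2 ^+ n)^-1 :> R by exact: half_expn_gt0.
have cst1 : 1 <= ball_constant q.
  rewrite /ball_constant; have : 1 <= 5%:R `^ `|q| :> R.
    by rewrite -[leLHS](powRr0 5%:R) ler_powR// ler1n.
  lra.
pose g k : R := if q <= 0 then index_mass n k `^ q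
                else 5%:R `^ q * \sum_(d < 5) shifted_mass n (k + d) `^ q.
have g0 k : 0 <= g k.
  rewrite /g; case: ifP => _; first exact: powR_ge0.
  by rewrite mulr_ge0 ?powR_ge0// sumr_ge0// => d _; exact: powR_ge0.
apply: (@le_trans _ _ (\esum_(x in C) (g (kappa x))%:E)%E).
  apply: le_esum => x /kP[kn kx]; rewrite mu_ballE poweR_EFin lee_fin /g.
  case: (leP q 0) => q0.
    apply: powR_le_opp => //; first exact: expR_gt0.
    rewrite -lee_fin -mu_index_itv// -mu_ballE; apply: le_measure; rewrite ?inE.
    - exact: measurable_itv.
    - by rewrite ball_itv; exact: measurable_itv.
    move=> y /index_itvP[y1 y2]; rewrite /ball/= ltr_norml.
    by move: kx => /andP[x1 x2]; apply/andP; split; lra.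
  apply: le_trans (powR_sum_le (a := fun d : 'I_5 => shifted_mass n (kappa x + d)) q0 _).
    apply: (ge0_ler_powR (ltW q0)); rewrite ?nnegrE ?fine_ge0//.
      by apply: sumr_ge0 => d _; exact: shifted_mass_ge0.
    exact: mu_ball_le_shifted.
  by move=> d; exact: shifted_mass_ge0.
rewrite -(esum_image C kappa (fun k => (g k)%:E))//; last first.
apply: (@le_trans _ _ (\esum_(k in [set` iota 0 (2 ^ n)]) (g k)%:E)%E).
  apply: esum_subset => [k|_ [x /kP[kn _] <-]]; first by rewrite lee_fin.
  by rewrite /= mem_iota.
rewrite esum_seq ?iota_uniq//.
have -> : iota 0 (2 ^ n) = index_iota 0 (2 ^ n) by rewrite /index_iota subn0.
rewrite sumEFin lee_fin /g; case: (leP q 0) => q0.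
  rewrite -[leLHS]mul1r ler_wpM2r// sumr_ge0// => k _; exact: powR_ge0.
rewrite -mulr_sumr /ball_constant gtr0_norm// -mulrA ler_wpM2l ?powR_ge0//.
rewrite exchange_big/=; apply: (@le_trans _ _ (\sum_(d < 5) partition_sum n q)).
  by apply: ler_sum => d _; exact: sum_shifted.
by rewrite sumr_const card_ord mulr_natl.
Qed.

Lemma index_choice n F : F `<=` supp mu -> exists kappa : R -> nat, forall x, F x ->
  (kappa x < 2 ^ n)%N /\
  (kappa x)%:R * (2 ^+ n)^-1 <= x <= ((kappa x)%:R + 1) * (2 ^+ n)^-1.
Proof.
move=> Fs; have h x : exists k, F x ->
    (k < 2 ^ n)%N /\ k%:R * (2 ^+ n)^-1 <= x <= (k%:R + 1) * (2 ^+ n)^-1.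
  have [Fx|nF] := pselect (F x); last by exists 0%N.
  by have [k kP] := exists_index n (supp_unit (Fs _ Fx)); exists k.
by exists (fun x => projT1 (cid (h x))) => x; exact: (projT2 (cid (h x))).
Qed.

Lemma mu_packing_sum_le n F r q : F `<=` supp mu -> (2 ^+ n)^-1 < r <= 2 * (2 ^+ n)^-1 ->
  (mu_packing_sum mu q r F <= (ball_constant q * partition_sum n q)%:E)%E.
Proof.
move=> Fs nr; have [kappa kP] := index_choice n Fs.
apply: ge_ereal_sup => _ [C [CF tC] <-]; apply: (mu_ball_index_le (kappa := kappa) _ nr); last first.
  by move=> x /CF/kP.
move=> x y; rewrite !inE => Cx Cy kxy; apply: tC => //; exists x.
have /andP[nr1 _] := nr; have hn : 0 < (2 ^+ n)^-1 :> R by exact: half_expn_gt0.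
split; first by apply: ballxx; lra.
have [_ /andP[x1 x2]] := kP _ (CF _ Cx); have [_ /andP[y1 y2]] := kP _ (CF _ Cy).
by rewrite /ball/= ltr_norml; rewrite kxy in x1 x2; apply/andP; split; lra.
Qed.

(** One center in each dyadic interval that meets [F] suffices, the radius being larger
    than the length of the interval. *)
Lemma mu_covering_sum_le n F r q : F `<=` supp mu -> (2 ^+ n)^-1 < r <= 2 * (2 ^+ n)^-1 ->
  (mu_covering_sum mu q r F <= (ball_constant q * partition_sum n q)%:E)%E.
Proof.
move=> Fs nr; have [kappa kP] := index_choice n Fs.
have /andP[nr1 _] := nr; have hn : 0 < (2 ^+ n)^-1 :> R by exact: half_expn_gt0.
pose rep (x : R) : R := xget (0 : R) [set y | F y /\ kappa y = kappa x].
have repP x : F x -> F (rep x) /\ kappa (rep x) = kappa x.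
  by move=> Fx; rewrite /rep; case: xgetP => [y _ []//|/(_ x)]; case.
apply: (@le_trans _ _ (\esum_(x in rep @` F) (mu (ball x r) `^ q))%E).
  apply: ereal_inf_lbound; exists (rep @` F) => //; split.
    by move=> _ [x Fx <-]; have [] := repP x Fx.
  move=> x Fx; exists (rep x); first by exists x.
  have [Fr kr] := repP x Fx.
  have [_ /andP[x1 x2]] := kP _ Fx; have [_ /andP[y1 y2]] := kP _ Fr.
  by rewrite /ball/= ltr_norml; rewrite kr in y1 y2; apply/andP; split; lra.
apply: (mu_ball_index_le (kappa := kappa) _ nr); last first.
  by move=> _ [x Fx <-]; have [/kP] := repP x Fx.
move=> x y; rewrite !inE => -[x' Fx' <-] [y' Fy' <-].
by have [_ ->] := repP x' Fx'; have [_ ->] := repP y' Fy' => kxy; rewrite /rep kxy.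
Qed.

Lemma powR_scale_le n r s : (2 ^+ n)^-1 < r <= 2 * (2 ^+ n)^-1 ->
  (2 * r) `^ s <= 4 `^ `|s| * expR (- (n%:R * (s * ln 2))).
Proof.
move=> /andP[r1 r2]; have hn : 0 < (2 ^+ n)^-1 :> R by exact: half_expn_gt0.
have r0 : 0 < r := lt_trans hn r1.
have hE : (2 ^+ n)^-1 `^ s = expR (- (n%:R * (s * ln 2))) :> R.
  by rewrite /powR gt_eqF// half_expnE expRK; congr expR; ring.
have -> : 2 * r = (2 * (r / (2 ^+ n)^-1)) * (2 ^+ n)^-1 by field; rewrite gt_eqF.
have c1 : 1 <= r / (2 ^+ n)^-1 by rewrite ler_pdivlMr// mul1r ltW.
have c2 : r / (2 ^+ n)^-1 <= 2 by rewrite ler_pdivrMr.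
rewrite powRM ?(ltW hn) ?mulr_ge0//; last by lra.
rewrite -hE ler_wpM2r ?powR_ge0//.
have l14 : 1 <= 4 :> R by rewrite ler1n.
apply: (@le_trans _ _ ((2 * (r / (2 ^+ n)^-1)) `^ `|s|)).
  by rewrite ler_powR ?ler_norm//; lra.
by rewrite ge0_ler_powR ?nnegrE//; lra.
Qed.

Definition upper_constant q s : R := ball_constant q * 4 `^ `|s|.

Lemma upper_constant_gt0 q s : 0 < upper_constant q s.
Proof. by rewrite /upper_constant /ball_constant !mulr_gt0 ?powR_gt0. Qed.

Lemma scaled_partition_sum_le n r q s : (2 ^+ n)^-1 < r <= 2 * (2 ^+ n)^-1 ->
  ball_constant q * partition_sum n q * (2 * r) `^ s <= upper_constant q s *
  expR (\sum_(1 <= j < n.+1) log_moment (digit_type j) q - n%:R * (s * ln 2)).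
Proof.
move=> nr; rewrite partition_sumE expRD /upper_constant.
have := powR_scale_le s nr; set W := expR (\sum_(_ <= _ < _) _) => h.
have W0 : 0 <= ball_constant q * W by rewrite !mulr_ge0 ?powR_ge0 ?expR_ge0.
have := ler_wpM2l W0 h; congr (_ <= _); ring.
Qed.

Lemma log_moment_sum_le n q (M : R) : (forall b, log_moment b q <= M) ->
  \sum_(1 <= j < n.+1) log_moment (digit_type j) q <= n%:R * M.
Proof.
move=> lM; apply: (@le_trans _ _ (\sum_(1 <= j < n.+1) M)).
  by apply: ler_sum => j _; exact: lM.
by rewrite sumr_const_nat subn1 -(mulr_natl M).
Qed.

Lemma mu_P_supp_eq0 q s (M : R) : (forall b, log_moment b q <= M) -> M < s * ln 2 ->
  mu_P mu q s (supp mu) = 0%E.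
Proof.
move=> lM Ms; set g := s * ln 2 - M; have g0 : 0 < g by rewrite subr_gt0.
have bar0 : mu_Pbar mu q s (supp mu) = 0%E.
  apply/eqP; rewrite eq_le mu_Pbar_ge0 andbT.
  apply/lee_addgt0Pr => eps e0; rewrite add0e.
  have g20 : 0 < g / ln 2 by rewrite divr_gt0// ln2_gt0.
  have [d d0 dP] := powR_lt_near0 g20 (divr_gt0 e0 (upper_constant_gt0 q s)).
  have d1 : 0 < Num.min d 1 by rewrite lt_min d0 ltr01.
  apply: (limf_esup_le_near d1) => r /andP[r0]; rewrite lt_min => /andP[rd r1].
  have r01 : 0 < r <= 1 by rewrite r0 ltW.
  have [n] := exists_half_expn_itv r01; rewrite [X in _ <= X]half_expnS => nr.
  apply: (@le_trans _ _ ((ball_constant q * partition_sum n.+1 q)%:E * ((2 * r) `^ s)%:E)%E).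
    by rewrite lee_wpmul2r ?lee_fin ?powR_ge0//; apply: mu_packing_sum_le.
  rewrite -EFinM lee_fin; apply: le_trans (scaled_partition_sum_le _ _ nr) _.
  rewrite mulrC -ler_pdivlMr ?upper_constant_gt0//.
  have rdP : 0 < r < d by rewrite r0.
  apply: le_trans (ltW (dP _ rdP)); rewrite /powR gt_eqF// ler_expR.
  have := log_moment_sum_le n.+1 lM; have /andP[n1 _] := nr.
  have : - (n.+1%:R * ln 2) <= ln r.
    by rewrite -[leLHS]expRK -half_expnE ler_ln ?posrE// ltW.
  rewrite -(ler_pM2l g20) mulrN mulrCA divfK ?gt_eqF ?ln2_gt0// /g; lra.
apply/eqP; rewrite eq_le; apply/andP; split; last first.
  apply: le_ereal_inf_tmp => _ [F _ <-]; apply: nneseries_ge0 => i _ _; exact: mu_Pbar_ge0.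
apply: ereal_inf_lbound; exists (fun=> supp mu); last exact: nneseries_eq0.
by split; [move=> i|move=> x sx; exists 0%N].
Qed.

Hypotheses (t0 : t 0%N = 1%N) (t_lt : forall n, (t n < t n.+1)%N).
Hypothesis t_lim : ((t n.+1)%:R / (t n)%:R : R) @[n --> \oo] --> +oo.

(** The digits written before the last run are at most [e / D] times all the digits,
    where [D] is the difference between the two logarithmic moments. *)
Lemma log_moment_sum_late b q (e : R) m0 : 0 < e -> exists n, (m0 <= n)%N /\
  \sum_(1 <= j < n.+1) log_moment (digit_type j) q <= n%:R * (log_moment b q + e) + e.
Proof.
move=> e0; pose D : R := `|log_moment true q - log_moment false q|.
pose B := Num.bound (D / e).
have BD : D <= B%:R * e.
  have De : 0 <= D / e by rewrite divr_ge0 ?normr_ge0// ltW.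
  by have /ltW := archi_boundP De; rewrite -/B ler_pdivrMr.
have [K0 KB] := run_growth t0 t_lt t_lim B.
pose K := ((K0 + m0).*2 + b)%N.
have bK : odd K = b by rewrite /K oddD odd_double; case: b {K}.
have KK0 : (K0 <= K)%N by rewrite /K -addnn; lia.
have Km0 : (m0 <= K)%N by rewrite /K -addnn; lia.
have tK1 := run_gt_self t0 t_lt K.+1.
have tK : ((t K.+1).-1.+1 = t K.+1)%N by rewrite prednK//; exact: leq_ltn_trans tK1.
exists (t K.+1).-1; split; first by rewrite -ltnS tK; exact: leq_ltn_trans (ltnW tK1).
rewrite tK; apply: (@le_trans _ _ (\sum_(1 <= j < t K.+1)
    (log_moment b q + (if (j < t K)%N then D else 0)))).
  apply: ler_sum_nat => j /andP[j1 jK]; case: ltnP => jt.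
    have h1 := ler_norm (log_moment true q - log_moment false q).
    have h2 := ler_norm (- (log_moment true q - log_moment false q)).
    rewrite normrN in h2; rewrite /D; case: (digit_type j); case: (b); lra.
  have jj : (t K <= j < t K.+1)%N by rewrite jt jK.
  by rewrite addr0 /digit_type (odd_block_run t0 t_lt jj) bK.
rewrite big_split/= sumr_const_nat -(mulr_natl (log_moment b q)) subn1.
have : \sum_(1 <= j < t K.+1) (if (j < t K)%N then D else 0) <= (t K)%:R * D.
  rewrite (big_cat_nat (n := t K))/=; last exact: ltnW.
    rewrite [X in _ + X]big1_seq ?addr0; last first.
      by move=> j /andP[_]; rewrite mem_index_iota => /andP[Kj _]; rewrite ltnNge Kj.
    apply: (@le_trans _ _ (\sum_(1 <= j < t K) D)).
      by apply: ler_sum => j _; case: ifP => // _; exact: normr_ge0.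
    by rewrite sumr_const_nat -(mulr_natl D) ler_wpM2r ?normr_ge0// ler_nat leq_subr.
  exact: leq_ltn_trans (run_gt_self t0 t_lt K).
have : (t K)%:R * D <= (t K)%:R * (B%:R * e) by rewrite ler_wpM2l.
have : (B * t K)%:R * e <= (t K.+1)%:R * e by rewrite ler_pM2r// ler_nat KB.
rewrite natrM -tK -natr1; lra.
Qed.

(** The lower limit over the radii that defines [mu_L] can be taken along the ends of the
    late runs of either type. *)
Lemma mu_H_supp_eq0 b q s : log_moment b q < s * ln 2 -> mu_H mu q s (supp mu) = 0%E.
Proof.
move=> Ms; set g := s * ln 2 - log_moment b q; have g0 : 0 < g by rewrite subr_gt0.
have L0 F : F `<=` supp mu -> (mu_L mu q s F <= 0)%E.
  move=> Fs; apply/lee_addgt0Pr => eps e0; rewrite add0e.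
  apply: limf_einf_le_frequently => d d0.
  have d20 : 0 < d / 2 by rewrite divr_gt0.
  have [n0 n0d] := exists_half_expn_lt d20; have g20 : 0 < g / 2 by rewrite divr_gt0.
  pose c := g / 2 - ln (eps / upper_constant q s).
  have [n [nn nW]] := log_moment_sum_late b q (n0 + Num.bound (`|c| / (g / 2)))%N g20.
  exists (2 * (2 ^+ n)^-1).
    rewrite mulr_gt0 ?half_expn_gt0//= mulrC -ltr_pdivlMr//.
    by apply: le_lt_trans n0d; apply: ler_half_expn; rewrite (leq_trans _ nn)// leq_addr.
  have nr : ((2 ^+ n)^-1 : R) < 2 * ((2 ^+ n)^-1 : R) <= 2 * (2 ^+ n)^-1.
    by rewrite lexx andbT; have := @half_expn_gt0 R n; lra.
  apply: (@le_trans _ _ ((ball_constant q * partition_sum n q)%:E *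
      ((2 * (2 * (2 ^+ n)^-1)) `^ s)%:E)%E).
    by rewrite lee_wpmul2r ?lee_fin ?powR_ge0//; exact: mu_covering_sum_le.
  rewrite -EFinM lee_fin; apply: le_trans (scaled_partition_sum_le _ _ nr) _.
  rewrite mulrC -ler_pdivlMr ?upper_constant_gt0//.
  rewrite -ler_ln ?posrE ?expR_gt0 ?divr_gt0 ?upper_constant_gt0// expRK.
  have cn : c <= n%:R * (g / 2).
    apply: le_trans (ler_norm c) _; rewrite -ler_pdivrMr//.
    have cg : 0 <= `|c| / (g / 2) by rewrite divr_ge0// ltW.
    by apply: le_trans (ltW (archi_boundP cg)) _; rewrite ler_nat (leq_trans _ nn)// leq_addl.
  move: nW cn; rewrite /c /g; lra.
have bar0 : mu_Hbar mu q s (supp mu) = 0%E.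
  apply/eqP; rewrite eq_le mu_Hbar_ge0 andbT.
  by apply: ge_ereal_sup => _ [F Fs <-]; exact: L0.
apply/eqP; rewrite eq_le; apply/andP; split; last first.
  apply: le_ereal_inf_tmp => _ [F _ <-]; apply: nneseries_ge0 => i _ _; exact: mu_Hbar_ge0.
apply: ereal_inf_lbound; exists (fun=> supp mu); last exact: nneseries_eq0.
by split; [move=> i|move=> x sx; exists 0%N].
Qed.

Lemma log_momentE b q : log_moment b q = tau (zero_weight p ph b) q * ln 2.
Proof. by rewrite /tau /log2 divfK// gt_eqF// ln2_gt0. Qed.

Lemma b_fun_le b q : (b_fun mu q <= (tau (zero_weight p ph b) q)%:E)%E.
Proof.
apply/lee_addgt0Pr => e e0; apply: ereal_inf_lbound.
exists (tau (zero_weight p ph b) q + e) => //=; apply: (@mu_H_supp_eq0 b).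
by rewrite log_momentE ltr_pM2r ?ln2_gt0// ltrDl.
Qed.

Lemma B_fun_le q : (B_fun mu q <= (Num.max (tau p q) (tau ph q))%:E)%E.
Proof.
apply/lee_addgt0Pr => e e0; apply: ereal_inf_lbound.
exists (Num.max (tau p q) (tau ph q) + e) => //=.
apply: (@mu_P_supp_eq0 _ _ (Num.max (tau p q) (tau ph q) * ln 2)).
  move=> b; rewrite log_momentE ler_pM2r ?ln2_gt0// le_max /zero_weight.
  by case: b; rewrite lexx ?orbT.
by rewrite ltr_pM2r ?ln2_gt0// ltrDl.
Qed.

End PartitionSums.

(** * Gibbs weights and the functions tau *)

Section GibbsWeights.
Context {R : realType}.
Implicit Types (a q x y v : R).

Definition moment a q : R := a `^ q + (1 - a) `^ q.

(** The weight of the digit 0 in the normalised [q]-th power of the weights [a] and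
    [1 - a]; the derivative of [tau a] at [q] is, in base 2, minus the mean information
    of a digit with this frequency. *)
Definition gibbs a q : R := a `^ q / moment a q.

Section OneWeight.
Variable a : R.
Hypotheses (a_gt0 : 0 < a) (a_le : a <= 2^-1).

Lemma compl_weight_gt0 : 0 < 1 - a.
Proof. by have := a_le; lra. Qed.

Lemma moment_gt0 q : 0 < moment a q.
Proof. by rewrite addr_gt0// powR_gt0// compl_weight_gt0. Qed.

Lemma gibbs01 q : 0 < gibbs a q < 1.
Proof.
have a1 := powR_gt0 q a_gt0; have a2 := powR_gt0 q compl_weight_gt0.
rewrite divr_gt0 ?moment_gt0//= ltr_pdivrMr ?moment_gt0// mul1r /moment; lra.
Qed.

Lemma compl_gibbs q : 1 - gibbs a q = (1 - a) `^ q / moment a q.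
Proof.
have := moment_gt0 q; rewrite /gibbs /moment => m0.
by field; rewrite gt_eqF.
Qed.

Lemma ln_gibbs q : ln (gibbs a q) = q * ln a - ln (moment a q).
Proof. by rewrite ln_div ?posrE ?powR_gt0 ?moment_gt0// ln_powR. Qed.

Lemma ln_compl_gibbs q : ln (1 - gibbs a q) = q * ln (1 - a) - ln (moment a q).
Proof.
rewrite compl_gibbs ln_div ?posrE ?powR_gt0 ?moment_gt0 ?compl_weight_gt0//.
by rewrite ln_powR.
Qed.

Lemma tauE q : tau a q * ln 2 = ln (moment a q).
Proof. by rewrite /tau /log2 divfK// gt_eqF// ln2_gt0. Qed.

(** The Gibbs frequency realises the maximum of entropy minus [q] times information, so
    that the entropy is the value at the exponent [q] of the expression minimised in
    the Legendre transform of [tau a]. *)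
Lemma entropy_gibbs q :
  entropy (gibbs a q) = q * cross_entropy (gibbs a q) a + tau a q * ln 2.
Proof. rewrite tauE /entropy /cross_entropy ln_gibbs ln_compl_gibbs; ring. Qed.

Lemma is_derive_tau q :
  is_derive q 1 (tau a) (- cross_entropy (gibbs a q) a / ln 2).
Proof.
have d x : 0 < x -> is_derive q 1 (fun y => x `^ y) (ln x * x `^ q).
  move=> x0; have -> : (fun y => x `^ y) = expR \o (fun y => y * ln x).
    by apply/funext => y; rewrite /powR gt_eqF.
  have -> : x `^ q = expR (q * ln x) by rewrite /powR gt_eqF.
  by apply: is_derive_eq; rewrite /= scaler0 add0r /GRing.scale/=; ring.
have dm : is_derive q 1 (moment a) (ln a * a `^ q + ln (1 - a) * (1 - a) `^ q).
  have d1 := d _ a_gt0; have d2 := d _ compl_weight_gt0.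
  exact: is_deriveD.
have dl := is_derive1_ln (moment_gt0 q).
have dlm : is_derive q 1 (@ln R \o moment a) ((moment a q)^-1 *
    (ln a * a `^ q + ln (1 - a) * (1 - a) `^ q)) by exact: is_derive1_comp.
have -> : tau a = (ln 2)^-1 \*: (@ln R \o moment a).
  by apply/funext => y; rewrite /tau /log2 /GRing.scale/= mulrC.
apply: is_derive_eq; rewrite /cross_entropy compl_gibbs /gibbs /GRing.scale/=.
have m0 := moment_gt0 q; have l0 : 0 < ln 2 :> R := ln2_gt0.
by field; rewrite !gt_eqF.
Qed.

Lemma ln_weight_le : ln a <= ln (1 - a).
Proof. by rewrite ler_ln ?posrE ?compl_weight_gt0//; have := a_le; lra. Qed.

Lemma cross_entropy_le x y : x <= y -> cross_entropy x a <= cross_entropy y a.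
Proof. by move=> xy; rewrite /cross_entropy; have := ln_weight_le; nra. Qed.

Lemma cross_entropy_bounds x : 0 <= x <= 1 ->
  - ln (1 - a) <= cross_entropy x a <= - ln a.
Proof.
by move=> /andP[x0 x1]; rewrite /cross_entropy; have := ln_weight_le; nra.
Qed.

Lemma gibbs_nincr q q' : q <= q' -> gibbs a q' <= gibbs a q.
Proof.
move=> qq; rewrite ler_pdivrMr ?moment_gt0// mulrAC ler_pdivlMr ?moment_gt0//.
rewrite /moment !mulrDr mulrC lerD2l.
rewrite /powR !gt_eqF ?compl_weight_gt0// -!expRD ler_expR.
by have := ln_weight_le; nra.
Qed.

Lemma exists_gibbs v : - ln (1 - a) < v -> v < - ln a ->
  exists q, cross_entropy (gibbs a q) a = v.
Proof.
move=> v1 v2; have c0 : 0 < ln (1 - a) - ln a by lra.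
set c := ln (1 - a) - ln a in c0; pose f := (v + ln (1 - a)) / c.
have f0 : 0 < f by rewrite divr_gt0//; lra.
have f1 : f < 1 by rewrite ltr_pdivrMr// mul1r /c; lra.
exists ((ln (1 - f) - ln f) / c).
have -> : gibbs a ((ln (1 - f) - ln f) / c) = f.
  set q := _ / c; have qc : q * c = ln (1 - f) - ln f by rewrite /q divfK ?gt_eqF.
  have f1' : 0 < 1 - f by lra.
  have h : a `^ q * (1 - f) = (1 - a) `^ q * f.
    rewrite -[X in _ * X = _](@lnK _ (1 - f)) ?posrE//.
    rewrite -[X in _ = _ * X](@lnK _ f) ?posrE//.
    rewrite /powR !gt_eqF ?compl_weight_gt0// -!expRD; congr expR.
    by move: qc; rewrite /c mulrBr; lra.
  have E : a `^ q = f * moment a q by rewrite /moment; lra.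
  by rewrite /gibbs {1}E mulfK// gt_eqF// moment_gt0.
rewrite /cross_entropy; have := divfK (lt0r_neq0 c0) (v + ln (1 - a)).
by rewrite -/f /c; lra.
Qed.

Lemma derive1_tau q : derive1 (tau a) q = - cross_entropy (gibbs a q) a / ln 2.
Proof. by rewrite derive1E; apply: derive_val; exact: is_derive_tau. Qed.

Lemma derive1_tau_le q q' : q <= q' -> derive1 (tau a) q <= derive1 (tau a) q'.
Proof.
move=> qq; rewrite !derive1_tau ler_pM2r ?invr_gt0 ?ln2_gt0// lerN2.
by apply: cross_entropy_le; exact: gibbs_nincr.
Qed.

Lemma derive1_tau_bounds q :
  ln a / ln 2 <= derive1 (tau a) q <= ln (1 - a) / ln 2.
Proof.
rewrite derive1_tau !ler_pM2r ?invr_gt0 ?ln2_gt0// lerNr lerNl andbC.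
by apply: cross_entropy_bounds; have /andP[/ltW -> /ltW ->] := gibbs01 q.
Qed.

(** The limits of a bounded monotone function exist; without existence, the limits in
    the hypothesis on [alpha] would carry no information. *)
Lemma lim_derive1_tau_pinfty :
  lim (derive1 (tau a) q @[q --> +oo]) <= ln (1 - a) / ln 2.
Proof.
apply: limr_le.
  apply/cvg_ex; exists (sup (range (derive1 (tau a)))); apply: nondecreasing_cvgr.
    exact: derive1_tau_le.
  by exists (ln (1 - a) / ln 2) => _ [q _ <-]; have /andP[] := derive1_tau_bounds q.
by near=> q; have /andP[] := derive1_tau_bounds q.
Unshelve. all: by end_near. Qed.

Lemma lim_derive1_tau_ninfty :
  ln a / ln 2 <= lim (derive1 (tau a) q @[q --> -oo]).
Proof.
apply: limr_ge.
  pose g q : R := - derive1 (tau a) (- q).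
  have cg : g q @[q --> +oo] --> sup (range g).
    apply: nondecreasing_cvgr => [q q' qq|].
      by rewrite lerN2; apply: derive1_tau_le; rewrite lerN2.
    exists (- (ln a / ln 2)) => _ [q _ <-].
    by rewrite lerN2; have /andP[] := derive1_tau_bounds (- q).
  apply/cvg_ex; exists (- sup (range g)); apply/cvgNy_compNP.
  have -> : derive1 (tau a) \o -%R = - g by apply/funext => q; rewrite /g /= opprfctE opprK.
  exact: cvgN cg.
by near=> q; have /andP[] := derive1_tau_bounds q.
Unshelve. all: by end_near. Qed.

End OneWeight.

(** The sign of [d/da (a^q + (1-a)^q) = q (a^(q-1) - (1-a)^(q-1))] for [a < 1/2]
    depends on the position of [q] with respect to 0 and 1. *)
Lemma moment_MVT a a' q : 0 < a -> a < a' -> a' <= 2^-1 -> exists c,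
  [/\ 0 < c, c < 1 - c & moment a' q - moment a q =
    q * (c `^ (q - 1) - (1 - c) `^ (q - 1)) * (a' - a)].
Proof.
move=> a0 aa a2.
have d x : 0 < x -> x < 1 -> is_derive x 1 (moment ^~ q)
    (q * (x `^ (q - 1) - (1 - x) `^ (q - 1))).
  move=> x0 x1; have x1' : 0 < 1 - x by rewrite subr_gt0.
  have d1 := is_derive1_powR q x0; have d2 := is_derive1_powR q x1'.
  have d3 : is_derive x 1 (fun y : R => 1 - y) (- 1).
    by apply: is_derive_eq; ring.
  have d4 : is_derive x 1 ((fun y : R => y `^ q) \o (fun y : R => 1 - y))
      (q * (1 - x) `^ (q - 1) * - 1) by exact: is_derive1_comp.
  have -> : moment ^~ q = (fun y : R => y `^ q) \+ ((fun y : R => y `^ q) \o (fun y : R => 1 - y)) by [].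
  by apply: is_derive_eq; ring.
have [||c] := @MVT R (moment ^~ q)
  (fun x => q * (x `^ (q - 1) - (1 - x) `^ (q - 1))) _ _ aa.
- move=> x; rewrite in_itv/= => /andP[ax xa]; apply: d; lra.
- apply: derivable_within_continuous => x; rewrite in_itv/= => /andP[ax xa].
  by apply: ex_derive; apply: d; lra.
rewrite in_itv/= => /andP[ac ca] ->; exists c; split => //; lra.
Qed.

Lemma moment_le_outside a a' q : 0 < a -> a < a' -> a' <= 2^-1 ->
  q <= 0 \/ 1 <= q -> moment a' q <= moment a q.
Proof.
move=> a0 aa a2 q01; have [c [c0 c1 E]] := moment_MVT q a0 aa a2.
rewrite -subr_le0 E; apply: mulr_le0_ge0; last by lra.
have c1' : 0 < 1 - c by lra.
case: q01 => q01.
  apply: mulr_le0_ge0 => //; rewrite subr_ge0; apply: powR_le_opp => //; lra.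
apply: mulr_ge0_le0; first by lra.
by rewrite subr_le0; apply: ge0_ler_powR; rewrite ?nnegrE; lra.
Qed.

Lemma moment_le_inside a a' q : 0 < a -> a < a' -> a' <= 2^-1 ->
  0 <= q <= 1 -> moment a q <= moment a' q.
Proof.
move=> a0 aa a2 /andP[q0 q1]; have [c [c0 c1 E]] := moment_MVT q a0 aa a2.
rewrite -subr_ge0 E; apply: mulr_ge0; last by lra.
apply: mulr_ge0 => //; rewrite subr_ge0; apply: powR_le_opp => //; lra.
Qed.

Lemma tau_le_moment a a' q : 0 < a -> a <= 2^-1 -> 0 < a' -> a' <= 2^-1 ->
  moment a q <= moment a' q -> tau a q <= tau a' q.
Proof.
move=> a0 a1 a'0 a'1 h; rewrite -(ler_pM2r (@ln2_gt0 R)) !tauE//.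
by rewrite ler_ln ?posrE ?moment_gt0.
Qed.

End GibbsWeights.

Section OneSidedDerivatives.
Context {R : realType}.
Implicit Types (chi : R -> \bar R) (g : R -> R) (x l d : R).

Lemma right_derivative_is_derive chi g x l d : 0 < d ->
  (forall y, x <= y < x + d -> chi y = (g y)%:E) -> is_derive x 1 g l ->
  right_derivative chi x = l%:E.
Proof.
move=> d0 cg [dg gl]; apply/cvg_lim => //.
have := dg; rewrite /derivable -/(derive g x 1) => /cvg_ex[l' cl'].
have l'E : l' = l by rewrite -gl; apply/esym/cvg_lim.
move: cl'; rewrite {}l'E => /cvg_dnbhs_at_right cl.
have : ((h^-1 *: ((g \o shift x) h%:A - g x))%R%:E @[h --> 0^'+] --> l%:E)%E.
  by apply: cvg_EFin => //; near=> h.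
apply: cvg_trans; apply: near_eq_cvg; near=> h.
have h0 : 0 < h by near: h; exact: nbhs_right_gt.
have hd : h < d by near: h; exact: nbhs_right_lt.
have cgx : chi x = (g x)%:E by apply: cg; rewrite lexx/=; lra.
have cgh : chi (x + h) = (g (x + h))%:E by apply: cg; apply/andP; split; lra.
rewrite cgx cgh -EFinB -EFinM.
by rewrite /GRing.scale/= mulr1 mulrC [h + x]addrC.
Unshelve. all: by end_near. Qed.

Lemma left_derivative_is_derive chi g x l d : 0 < d ->
  (forall y, x - d < y <= x -> chi y = (g y)%:E) -> is_derive x 1 g l ->
  left_derivative chi x = l%:E.
Proof.
move=> d0 cg [dg gl]; apply/cvg_lim => //.
have := dg; rewrite /derivable -/(derive g x 1) => /cvg_ex[l' cl'].
have l'E : l' = l by rewrite -gl; apply/esym/cvg_lim.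
move: cl'; rewrite {}l'E => /cvg_dnbhs_at_left cl.
have : ((h^-1 *: ((g \o shift x) h%:A - g x))%R%:E @[h --> 0^'-] --> l%:E)%E.
  by apply: cvg_EFin => //; near=> h.
apply: cvg_trans; apply: near_eq_cvg; near=> h.
have h0 : h < 0 by near: h; exact: nbhs_left_lt.
have hd : - d < h by near: h; apply: nbhs_left_gt; rewrite oppr_lt0.
have cgx : chi x = (g x)%:E by apply: cg; rewrite lexx andbT; lra.
have cgh : chi (x + h) = (g (x + h))%:E by apply: cg; apply/andP; split; lra.
rewrite cgx cgh -EFinB -EFinM.
by rewrite /GRing.scale/= mulr1 mulrC [h + x]addrC.
Unshelve. all: by end_near. Qed.

End OneSidedDerivatives.

(** * The two spectra *)

Section Spectra.
Context {R : realType} (p ph : R) (t : nat -> nat).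
Context (mu : probability (measurableTypeR R) R).
Hypotheses (p_gt0 : 0 < p) (p_lt_ph : p < ph) (ph_le : ph <= 2^-1).
Hypothesis mu_assoc : associated_measure p ph t mu.
Hypotheses (t0 : t 0%N = 1%N) (t_lt : forall n, (t n < t n.+1)%N).
Hypothesis t_lim : ((t n.+1)%:R / (t n)%:R : R) @[n --> \oo] --> +oo.
Implicit Types (b : bool) (q alpha : R).

Lemma zero_weight_gt0 b : 0 < zero_weight p ph b.
Proof. by have /andP[h _] := zero_weight_bounds p_gt0 p_lt_ph ph_le b; exact: lt_le_trans h. Qed.

Lemma zero_weight_le b : zero_weight p ph b <= 2^-1.
Proof. by have /andP[] := zero_weight_bounds p_gt0 p_lt_ph ph_le b. Qed.

(** The lower bound comes from the Cantor set whose frequencies are the Gibbs frequencies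
    at [q]; the two types need not have the same information here. *)
Lemma B_funE q : B_fun mu q = (Num.max (tau p q) (tau ph q))%:E.
Proof.
apply/eqP; rewrite eq_le (B_fun_le p_gt0 p_lt_ph ph_le mu_assoc)/=.
pose f b := gibbs (zero_weight p ph b) q.
have f01 b : 0 < f b < 1 by apply: gibbs01; [exact: zero_weight_gt0|exact: zero_weight_le].
have lower b : ((tau (zero_weight p ph b) q)%:E <= B_fun mu q)%E.
  have := B_fun_cantor p_gt0 p_lt_ph ph_le mu_assoc t0 t_lt t_lim f01 b q.
  rewrite {1}/f entropy_gibbs ?zero_weight_gt0 ?zero_weight_le// addrAC subrr add0r.
  by rewrite mulfK// gt_eqF// ln2_gt0.
by rewrite EFin_max ge_max (lower true) (lower false).
Qed.

Lemma B_fun_outside q : q <= 0 \/ 1 <= q -> B_fun mu q = (tau p q)%:E.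
Proof.
move=> q01; rewrite B_funE max_l//.
have ph0 := lt_trans p_gt0 p_lt_ph; have p2 := le_trans (ltW p_lt_ph) ph_le.
by apply: tau_le_moment => //; apply: moment_le_outside.
Qed.

Lemma B_fun_inside q : 0 <= q <= 1 -> B_fun mu q = (tau ph q)%:E.
Proof.
move=> q01; rewrite B_funE max_r//.
have ph0 := lt_trans p_gt0 p_lt_ph; have p2 := le_trans (ltW p_lt_ph) ph_le.
by apply: tau_le_moment => //; apply: moment_le_inside.
Qed.

(** [B_fun] is [tau p] on the left of 0 and [tau ph] on its right, and the other way round
    at 1: its one-sided derivatives are those of these functions. *)
Lemma slope_interval_B_fun0 alpha :
  slope_interval (B_fun mu) 0 alpha%:E <->
  cross_entropy (gibbs ph 0) ph <= alpha * ln 2 <= cross_entropy (gibbs p 0) p.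
Proof.
have ph0 := lt_trans p_gt0 p_lt_ph; have p2 := le_trans (ltW p_lt_ph) ph_le.
rewrite /slope_interval (right_derivative_is_derive (g := tau ph) ltr01 _ (is_derive_tau ph0 ph_le 0)).
  rewrite (left_derivative_is_derive (g := tau p) ltr01 _ (is_derive_tau p_gt0 p2 0)).
    rewrite /= in_itv/= !lee_fin !mulNr !opprK.
    by rewrite ler_pdivrMr ?ln2_gt0// ler_pdivlMr ?ln2_gt0.
  by move=> y /andP[_ y0]; apply: B_fun_outside; left.
by move=> y /andP[y0]; rewrite add0r => /ltW y1; apply: B_fun_inside; rewrite y0.
Qed.

Lemma slope_interval_B_fun1 alpha :
  slope_interval (B_fun mu) 1 alpha%:E <->
  cross_entropy (gibbs p 1) p <= alpha * ln 2 <= cross_entropy (gibbs ph 1) ph.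
Proof.
have ph0 := lt_trans p_gt0 p_lt_ph; have p2 := le_trans (ltW p_lt_ph) ph_le.
rewrite /slope_interval (right_derivative_is_derive (g := tau p) ltr01 _ (is_derive_tau p_gt0 p2 1)).
  rewrite (left_derivative_is_derive (g := tau ph) ltr01 _ (is_derive_tau ph0 ph_le 1)).
    rewrite /= in_itv/= !lee_fin !mulNr !opprK.
    by rewrite ler_pdivrMr ?ln2_gt0// ler_pdivlMr ?ln2_gt0.
  by move=> y /andP[]; rewrite subrr => /ltW y0 y1; apply: B_fun_inside; rewrite y0.
by move=> y /andP[y0 _]; apply: B_fun_outside; right.
Qed.

Section Level.
Variable alpha : R.
Hypothesis alpha_gt : - ln (1 - ph) < alpha * ln 2.
Hypothesis alpha_lt : alpha * ln 2 < - ln ph.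

(** The range of [alpha] is that of the digits of weight [ph]; it is contained in the
    range for the weight [p], which is more unbalanced. *)
Lemma exists_exponent b : exists q,
  cross_entropy (gibbs (zero_weight p ph b) q) (zero_weight p ph b) = alpha * ln 2.
Proof.
have w1 : zero_weight p ph b <= ph by have := p_lt_ph; case: b => /= h; lra.
have w0 := zero_weight_gt0 b; have w3 := zero_weight_le b.
have ph0 := lt_trans p_gt0 p_lt_ph; have ph1 := ph_le.
have l1 : ln (zero_weight p ph b) <= ln ph by rewrite ler_ln ?posrE.
have l2 : ln (1 - ph) <= ln (1 - zero_weight p ph b) by rewrite ler_ln ?posrE//; lra.
have h1 := alpha_gt; have h2 := alpha_lt; apply: exists_gibbs => //; lra.
Qed.

Definition exponent b : R := projT1 (cid (exists_exponent b)).

Definition level_gibbs b : R := gibbs (zero_weight p ph b) (exponent b).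

Lemma level_gibbsP b : cross_entropy (level_gibbs b) (zero_weight p ph b) = alpha * ln 2.
Proof. exact: (projT2 (cid (exists_exponent b))). Qed.

Lemma level_gibbs01 b : 0 < level_gibbs b < 1.
Proof. by apply: gibbs01; [exact: zero_weight_gt0|exact: zero_weight_le]. Qed.

Lemma cantor_set_sub_level : cantor_set t level_gibbs `<=` level_set mu alpha.
Proof.
have a0 : 0 <= alpha * ln 2.
  have := alpha_gt; have : ln (1 - ph) <= 0.
    by rewrite ln_le0//; have := lt_trans p_gt0 p_lt_ph; lra.
  lra.
have := cantor_set_sub_level_set p_gt0 p_lt_ph ph_le mu_assoc t0 t_lt t_lim
  level_gibbs01 a0 (level_gibbsP true) (level_gibbsP false).
by rewrite mulfK// gt_eqF// ln2_gt0.
Qed.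

Definition exponent_dim b : R := entropy (level_gibbs b) / ln 2.

Lemma exponent_dim_gt0 b : 0 < exponent_dim b.
Proof. by rewrite divr_gt0 ?ln2_gt0// entropy_gt0// level_gibbs01. Qed.

Lemma exponent_dimE b :
  exponent_dim b = alpha * exponent b + tau (zero_weight p ph b) (exponent b).
Proof.
rewrite /exponent_dim /level_gibbs entropy_gibbs ?zero_weight_gt0 ?zero_weight_le//.
have := level_gibbsP b; rewrite /level_gibbs => ->; field.
by rewrite gt_eqF// ln2_gt0.
Qed.

Lemma legendre_b_fun_le b : (legendre (b_fun mu) alpha <= (exponent_dim b)%:E)%E.
Proof.
apply: (@le_trans _ _ ((alpha * exponent b)%:E + b_fun mu (exponent b))%E).
  by apply: ereal_inf_lbound; exists (exponent b).
by rewrite exponent_dimE EFinD leeD2l// (b_fun_le p_gt0 p_lt_ph ph_le mu_assoc).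
Qed.

(** The Hausdorff dimension is at least the smaller of the two dimensions, and the Legendre
    transform is at most each of them: all the inequalities between are equalities. *)
Lemma lower_spectrum :
  hausdorff_dim (level_set mu alpha) = lower_MB_dim (level_set mu alpha) /\
  lower_MB_dim (level_set mu alpha) = legendre (b_fun mu) alpha.
Proof.
set E := level_set mu alpha; pose m := Num.min (exponent_dim true) (exponent_dim false).
have m0 : 0 < m by rewrite lt_min !exponent_dim_gt0.
have h1 : (m%:E <= hausdorff_dim E)%E.
  have := hausdorff_dim_cantor p_gt0 p_lt_ph ph_le t0 level_gibbs01 cantor_set_sub_level.
  have l0 : 0 <= (ln 2)^-1 :> R by rewrite invr_ge0 ltW// ln2_gt0.
  by rewrite /m /exponent_dim -(minr_pMl _ _ l0).
have h2 : (hausdorff_dim E <= lower_MB_dim E)%E by exact: hausdorff_dim_le_lower_MB_dim.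
have h3 : (lower_MB_dim E <= legendre (b_fun mu) alpha)%E.
  apply: lower_MB_dim_level_set_le; apply: lt_le_trans h2; apply: lt_le_trans h1.
  by rewrite lte_fin.
have h4 : (legendre (b_fun mu) alpha <= m%:E)%E.
  by rewrite EFin_min le_min !legendre_b_fun_le.
split; apply/eqP; rewrite eq_le.
  by rewrite h2/= (le_trans h3)// (le_trans h4).
by rewrite h3/= (le_trans h4)// (le_trans h1).
Qed.

(** Outside the two slope intervals an exponent realises the maximum defining
    [B_fun]: the exponent of type [p] is negative or larger than 1, or the exponent of
    type [ph] is between 0 and 1. *)
Lemma legendre_B_fun_le :
  ~ (slope_interval (B_fun mu) 0 `|` slope_interval (B_fun mu) 1) alpha%:E ->
  exists b, (legendre (B_fun mu) alpha <= (exponent_dim b)%:E)%E.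
Proof.
move=> nI; have ph0 := lt_trans p_gt0 p_lt_ph; have p2 := le_trans (ltW p_lt_ph) ph_le.
have leg b : B_fun mu (exponent b) = (tau (zero_weight p ph b) (exponent b))%:E ->
    exists b', (legendre (B_fun mu) alpha <= (exponent_dim b')%:E)%E.
  move=> BE; exists b; rewrite exponent_dimE EFinD -BE.
  by apply: ereal_inf_lbound; exists (exponent b).
have lt_exponent b q : cross_entropy (gibbs (zero_weight p ph b) q) (zero_weight p ph b)
    < alpha * ln 2 -> exponent b <= q.
  move=> h; rewrite leNgt; apply/negP => /ltW qe; move: h; rewrite -(level_gibbsP b).
  rewrite ltNge cross_entropy_le ?zero_weight_gt0 ?zero_weight_le//.
  by apply: gibbs_nincr => //; [exact: zero_weight_gt0|exact: zero_weight_le].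
have gt_exponent b q : alpha * ln 2 <
    cross_entropy (gibbs (zero_weight p ph b) q) (zero_weight p ph b) -> q <= exponent b.
  move=> h; rewrite leNgt; apply/negP => /ltW qe; move: h; rewrite -(level_gibbsP b).
  rewrite ltNge cross_entropy_le ?zero_weight_gt0 ?zero_weight_le//.
  by apply: gibbs_nincr => //; [exact: zero_weight_gt0|exact: zero_weight_le].
have n0 : ~ (cross_entropy (gibbs ph 0) ph <= alpha * ln 2 <= cross_entropy (gibbs p 0) p).
  by move=> h; apply: nI; left; apply/slope_interval_B_fun0.
have n1 : ~ (cross_entropy (gibbs p 1) p <= alpha * ln 2 <= cross_entropy (gibbs ph 1) ph).
  by move=> h; apply: nI; right; apply/slope_interval_B_fun1.
have [a0|a0] := ltP (cross_entropy (gibbs p 0) p) (alpha * ln 2).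
  by apply: (leg true); apply: B_fun_outside; left; exact: (lt_exponent true).
have [a1|a1] := ltP (alpha * ln 2) (cross_entropy (gibbs p 1) p).
  by apply: (leg true); apply: B_fun_outside; right; exact: (gt_exponent true).
apply: (leg false); apply: B_fun_inside; apply/andP; split.
  by apply: (gt_exponent false); rewrite ltNge; apply/negP => h; apply: n0; rewrite h.
by apply: (lt_exponent false); rewrite ltNge; apply/negP => h; apply: n1; rewrite a1.
Qed.

Lemma upper_spectrum :
  ~ (slope_interval (B_fun mu) 0 `|` slope_interval (B_fun mu) 1) alpha%:E ->
  packing_dim (level_set mu alpha) = upper_MB_dim (level_set mu alpha) /\
  upper_MB_dim (level_set mu alpha) = legendre (B_fun mu) alpha.
Proof.
move=> /legendre_B_fun_le[b h4]; set E := level_set mu alpha.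
have h1 : ((exponent_dim b)%:E <= packing_dim E)%E.
  exact: (packing_dim_cantor p_gt0 p_lt_ph ph_le mu_assoc t0 t_lt t_lim
    level_gibbs01 b cantor_set_sub_level).
have h2 : (packing_dim E <= upper_MB_dim E)%E by exact: packing_dim_le_upper_MB_dim.
have h3 : (upper_MB_dim E <= legendre (B_fun mu) alpha)%E.
  apply: upper_MB_dim_level_set_le; apply: lt_le_trans h2; apply: lt_le_trans h1.
  by rewrite lte_fin exponent_dim_gt0.
split; apply/eqP; rewrite eq_le.
  by rewrite h2/= (le_trans h3)// (le_trans h4).
by rewrite h3/= (le_trans h4)// (le_trans h1).
Qed.

End Level.

End Spectra.

Theorem theorem10 (R : realType) (p ph : R) (t : nat -> nat)
    (mu : probability (measurableTypeR R) R) (alpha : R)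
    (hp : 0 < p) (hpph : p < ph) (hph : ph <= 2^-1)
    (ht0 : t 0%N = 1%N) (ht : forall n, (t n < t n.+1)%N)
    (htlim : ((t n.+1)%:R / (t n)%:R : R) @[n --> \oo] --> +oo)
    (hmu : associated_measure p ph t mu)
    (halpha : - lim (derive1 (tau ph) q @[q --> +oo]) < alpha
                < - lim (derive1 (tau ph) q @[q --> -oo])) :
  (~ (slope_interval (b_fun mu) 0 `|` slope_interval (b_fun mu) 1) alpha%:E ->
     hausdorff_dim (level_set mu alpha) = lower_MB_dim (level_set mu alpha) /\
     lower_MB_dim (level_set mu alpha) = legendre (b_fun mu) alpha) /\
  (~ (slope_interval (B_fun mu) 0 `|` slope_interval (B_fun mu) 1) alpha%:E ->
     packing_dim (level_set mu alpha) = upper_MB_dim (level_set mu alpha) /\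
     upper_MB_dim (level_set mu alpha) = legendre (B_fun mu) alpha).
Proof.
have ph0 := lt_trans hp hpph.
have l2 : 0 < ln 2 :> R := ln2_gt0.
have /andP[a1 a2] := halpha.
have agt : - ln (1 - ph) < alpha * ln 2.
  have := lim_derive1_tau_pinfty ph0 hph; rewrite ler_pdivlMr// => h.
  by move: a1; rewrite -(ltr_pM2r l2); lra.
have alt : alpha * ln 2 < - ln ph.
  have := lim_derive1_tau_ninfty ph0 hph; rewrite ler_pdivrMr// => h.
  by move: a2; rewrite -(ltr_pM2r l2); lra.
split=> [_|nI].
  exact: (lower_spectrum hp hpph hph hmu ht0 ht htlim agt alt).
exact: (upper_spectrum hp hpph hph hmu ht0 ht htlim agt alt nI).
Qed.
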